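(* The $\mathcal{C}$-Coalition Formation problem is W[1]-hard when parameterized by the twin-cover number of the input graph $G$.
   Context: $\mathcal{C}$-Coalition Formation (unweighted): the input is an undirected graph $G=(V,E)$, a capacity $\mathcal{C}\in\mathbb{N}$ and (decision form) a target $t$. A $\mathcal{C}$-partition of $V$ is a partition $\mathcal{P}=\{C_1,\dots,C_p\}$ with $|C_i|\le\mathcal{C}$; its value is $v(\mathcal{P})=\sum_i|E(G[C_i])|$; the question is whether a $\mathcal{C}$-partition of value at least $t$ exists (optimization: maximize the value). A set $S\subseteq V$ is a twin-cover of $G$ if $V\setminus S$ can be partitioned into sets $V_1,\dots,V_p$ such that the vertices within each $V_i$ are pairwise twins, equivalently every edge $uv$ has $u\in S$ or $v\in S$ or $N[u]=N[v]$; the twin-cover number is the minimum size of a twin-cover. *)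

(* Defs.v *)
From mathcomp Require Import all_boot.
Set Implicit Arguments.
Unset Strict Implicit.
Unset Printing Implicit Defensive.

(* Machine model: a random access machine with finitely many memory banks
   (the banks named by the program), presented by structured programs.  Its
   arithmetic is addition and truncated subtraction and every command has
   unit cost; since one step lengthens the binary representations of the
   contents by at most a constant depending on the program, running times
   agree with those of Turing machines up to a polynomial. *)
Inductive expr :=
  | Const of nat
  | Fetch of nat & expr         (* Fetch b e : contents of cell e of bank b *)
  | Add of expr & expr
  | Sub of expr & expr.

Inductive prog :=
  | Skip
  | Store of nat & expr & expr  (* Store b e v : bank b, cell e := v *)
  | Seq of prog & prog
  | If of expr & prog & prog    (* nonzero is true *)
  | While of expr & prog.

Definition state := nat -> nat -> nat.

Definition update (s : state) (b i v : nat) : state :=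
  fun b' i' => if (b' == b) && (i' == i) then v else s b' i'.

Fixpoint eval (s : state) (e : expr) : nat :=
  match e with
  | Const n => n
  | Fetch b e1 => s b (eval s e1)
  | Add e1 e2 => eval s e1 + eval s e2
  | Sub e1 e2 => eval s e1 - eval s e2
  end.

(* exec p s n s' : started in s, p halts in s' after n steps *)
Inductive exec : prog -> state -> nat -> state -> Prop :=
  | ExecSkip s : exec Skip s 1 s
  | ExecStore s b e v :
      exec (Store b e v) s 1 (update s b (eval s e) (eval s v))
  | ExecSeq p q s n s' m s'' :
      exec p s n s' -> exec q s' m s'' -> exec (Seq p q) s (n + m) s''
  | ExecIfTrue e p q s n s' :
      eval s e != 0 -> exec p s n s' -> exec (If e p q) s n.+1 s'
  | ExecIfFalse e p q s n s' :
      eval s e == 0 -> exec q s n s' -> exec (If e p q) s n.+1 s'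
  | ExecWhileTrue e p s n s' m s'' :
      eval s e != 0 -> exec p s n s' -> exec (While e p) s' m s'' ->
      exec (While e p) s (n + m).+1 s''
  | ExecWhileFalse e p s :
      eval s e == 0 -> exec (While e p) s 1 s.

(* Input is read from bank 0 and output is written to bank 1. *)
Definition initial (input : nat -> nat) : state :=
  fun b i => if b == 0 then input i else 0.

(* A string occupies the first cells of a bank, bit b being stored as b + 1;
   all other cells contain the blank 0.  In particular a program cannot
   output a string longer than its running time. *)
Definition tape (x : seq bool) (i : nat) : nat :=
  nth 0 [seq (nat_of_bool b).+1 | b <- x] i.

Definition transforms (p : prog) (x : seq bool) (n : nat) (y : seq bool) :=
  exists s, exec p (initial (tape x)) n s /\ s 1 =1 tape y.

Definition computable (f : nat -> nat) : Prop :=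
  exists p, forall k, exists n s,
    exec p (initial (fun i => if i == 0 then k else 0)) n s /\ s 1 0 = f k.

(* The decision problem whose instances are the strings [encode i]; ordinary
   languages over {0,1} are the case instance = seq bool, encode = id. *)
Record pproblem := PProblem {
  instance : Type;
  encode : instance -> seq bool;
  encode_inj : injective encode;
  yes : instance -> Prop;
  parameter : instance -> nat
}.

(* The successor below only matters for the empty string. *)
Definition fpt_reducible (P Q : pproblem) : Prop :=
  exists (p : prog) (f g : nat -> nat) (c : nat),
    [/\ computable f, computable g &
     forall x : instance P, exists (y : instance Q) (n : nat),
       [/\ transforms p (encode x) n (encode y),
           n <= f (parameter x) * (size (encode x)).+1 ^ c,
           yes x <-> yes y
         & parameter y <= g (parameter x)]].

(* Lists of numbers as strings, each number in unary.  All numbers in the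
   instances below are, or can be truncated to be, polynomial in the size of
   the graph or circuit, so unary and binary are interchangeable. *)
Definition code (s : seq nat) : seq bool :=
  flatten [seq rcons (nseq n true) false | n <- s].

Lemma code_inj : injective code.
Proof.
rewrite /code; elim=> [|m s IHs] [|n t] //=; rewrite -?cats1 -?catA /=.
- by case: n.
- by case: m.
elim: m n => [|m IHm] [|n] //= [].
  by move/IHs->.
by move/IHm=> [-> ->].
Qed.

(* Boolean circuits.  A circuit is the list of the nodes of an acyclic graph
   in a topological order; nodes are referred to by position and the output
   node comes last. *)
Inductive gate :=
  | Input
  | Neg of nat
  | Conj of seq nat
  | Disj of seq nat.

Definition circuit := seq gate.

Definition is_input (g : gate) : bool := if g is Input then true else false.

Definition preds (g : gate) : seq nat :=
  match g with
  | Input => [::]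
  | Neg i => [:: i]
  | Conj l => l
  | Disj l => l
  end.

Definition fan_in_ok (g : gate) : bool :=
  match g with
  | Input | Neg _ => true
  | Conj l | Disj l => (1 < size l) && uniq l
  end.

Definition is_circuit (c : circuit) : bool :=
  [&& 0 < size c,
      all fan_in_ok c,
      all (fun i => all (fun j => j < i) (preds (nth Input c i)))
          (iota 0 (size c))
    & (* only the output node has out-degree 0 *)
      all (fun i => has (fun g => i \in preds g) c) (iota 0 (size c).-1)].

(* Values at all nodes, in order; step also sees the values at earlier nodes. *)
Definition scan (A : Type) (step : gate -> seq A -> A) (c : circuit) : seq A :=
  foldl (fun vs g => rcons vs (step g vs)) [::] c.

Definition gate_value (a : nat -> bool) (g : gate) (vs : seq bool) : bool :=
  match g with
  | Input => a (size vs)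
  | Neg i => ~~ nth false vs i
  | Conj l => all (nth false vs) l
  | Disj l => has (nth false vs) l
  end.

(* The value of c under the assignment that gives input node i the value a i;
   a is irrelevant outside the input nodes. *)
Definition output (a : nat -> bool) (c : circuit) : bool :=
  last false (scan (gate_value a) c).

Definition weight (a : nat -> bool) (c : circuit) : nat :=
  count (fun i => is_input (nth (Neg 0) c i) && a i) (iota 0 (size c)).

(* The maximal number of nodes satisfying w on a path to the output node. *)
Definition path_max (w : pred gate) (c : circuit) : nat :=
  last 0 (scan (fun g vs => w g + \max_(i <- preds g) nth 0 vs i) c).

(* The length of a path from an input node is its number of other nodes. *)
Definition depth : circuit -> nat := path_max (fun g => ~~ is_input g).

Definition weft : circuit -> nat := path_max (fun g => 2 < size (preds g)).

(* WCS[C_{t,d}]: weighted satisfiability of circuits of weft at most t and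
   depth at most d, parameterized by the weight k. *)
Record wcs_instance (t d : nat) := WCSInstance {
  wcs_circuit : circuit;
  wcs_weight : nat;
  _ : [&& is_circuit wcs_circuit, weft wcs_circuit <= t
        & depth wcs_circuit <= d]
}.

Definition gate_code (g : gate) : seq nat :=
  match g with
  | Input => 0
  | Neg _ => 1
  | Conj _ => 2
  | Disj _ => 3
  end :: size (preds g) :: preds g.

Definition wcs_encode (t d : nat) (x : wcs_instance t d) : seq bool :=
  code (wcs_weight x :: flatten (map gate_code (wcs_circuit x))).

Lemma gate_code_inj : injective (fun c => flatten (map gate_code c)).
Proof.
have eq_prefix (l l' r r' : seq nat) :
    size l = size l' -> l ++ r = l' ++ r' -> l = l' /\ r = r'.
  by move=> sz /eqP; rewrite eqseq_cat // => /andP[/eqP-> /eqP->].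
elim=> [|g c IHc] [|g' c'] //=.
case: g g' => [|i|l|l] [|i'|l'|l'] //=.
- by move=> [/IHc->].
- by move=> [-> /IHc->].
- by move=> [/eq_prefix h /h[-> /IHc->]].
- by move=> [/eq_prefix h /h[-> /IHc->]].
Qed.

Lemma wcs_encode_inj (t d : nat) : injective (@wcs_encode t d).
Proof.
move=> [c k p] [c' k' p'] /code_inj[/= ek /gate_code_inj ec].
by subst; rewrite (bool_irrelevance p p').
Qed.

Definition wcs_satisfiable (t d : nat) (x : wcs_instance t d) : Prop :=
  exists a : nat -> bool,
    weight a (wcs_circuit x) = wcs_weight x /\ output a (wcs_circuit x).

Definition WCS (t d : nat) : pproblem :=
  PProblem (@wcs_encode_inj t d) (@wcs_satisfiable t d) (@wcs_weight t d).

Definition in_W (t : nat) (P : pproblem) : Prop :=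
  exists2 d, 1 <= d & fpt_reducible P (WCS t d).

Definition W_hard (t : nat) (P : pproblem) : Prop :=
  forall Q : pproblem, in_W t Q -> fpt_reducible Q P.

(* A simple undirected graph on T is given by its set E of 2-element edges. *)
Section Graph.

Variables (T : finType) (E : {set {set T}}).

Definition capacity_partition (C : nat) (P : {set {set T}}) : bool :=
  partition P [set: T] && [forall A in P, #|A| <= C].

Definition induced_edges (A : {set T}) : {set {set T}} :=
  [set e in E | e \subset A].

Definition partition_value (P : {set {set T}}) : nat :=
  \sum_(A in P) #|induced_edges A|.

Definition closed_nbhd (u : T) : {set T} :=
  u |: [set v | [set u; v] \in E].

Definition twin_cover (S : {set T}) : bool :=
  [forall u, forall v, ([set u; v] \in E) ==>
     [|| u \in S, v \in S | closed_nbhd u == closed_nbhd v]].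

Definition twin_cover_number : nat :=
  #|[arg min_(S < [set: T] | twin_cover S) #|S|]|.

End Graph.

Record coalition_instance := CoalitionInstance {
  order : nat;
  edges : {set {set 'I_order}};
  capacity : nat;
  target : nat;
  _ : [forall e in edges, #|e| == 2]
}.

Definition adjacency (n : nat) (E : {set {set 'I_n}}) : seq nat :=
  [seq nat_of_bool ([set u; v] \in E) | u <- enum 'I_n, v <- enum 'I_n].

Definition coalition_encode (x : coalition_instance) : seq bool :=
  code [:: order x, capacity x, target x & adjacency (edges x)].

Lemma coalition_encode_inj : injective coalition_encode.
Proof.
move=> [n E C t hE] [n' E' C' t' hE'] /code_inj /= [en eC et].
subst n' C' t' => eA.
suff eE : E = E' by subst E'; rewrite (bool_irrelevance hE hE').
have eqA (u v : 'I_n) : ([set u; v] \in E) = ([set u; v] \in E').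
  suff : {in [seq (u, v) | u <- enum 'I_n, v <- enum 'I_n],
      (fun p => nat_of_bool ([set p.1; p.2] \in E)) =1
      (fun p => nat_of_bool ([set p.1; p.2] \in E'))}.
    move/(_ (u, v)); rewrite allpairs_f ?mem_enum // => /(_ isT) /=.
    by do 2 case: (_ \in _).
  by apply/eq_in_map; rewrite !map_allpairs.
apply/setP=> e; case: (boolP (#|e| == 2)) => [/cards2P[u [v [_ ->]]] //|ne].
by apply/idP/idP => [/(forall_inP hE)|/(forall_inP hE')]; rewrite (negPf ne).
Qed.

Definition coalition_yes (x : coalition_instance) : Prop :=
  exists2 P : {set {set 'I_(order x)}},
    capacity_partition (capacity x) P
    & target x <= partition_value (edges x) P.

Definition coalition_by_twin_cover : pproblem :=
  PProblem coalition_encode_inj coalition_yes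
    (fun x => twin_cover_number (edges x)).

(* Main.v *)
(** A weft-1 circuit of bounded depth has boundedly many large gates, and a
    subcircuit without large gates depends on boundedly many inputs.  Guess for
    each large gate its value, with a witnessing child when the value is decided
    by one.  Order the [k] true inputs increasingly: they cut the inputs into
    [k + 1] regions, and whether an input is true can be read off the region
    containing it.  A wrong guess is therefore refuted by boundedly many
    regions, so satisfiability becomes a binary constraint problem whose
    variables are the tuples of [2 ^ d] regions; their number depends on [k]
    only.

    The constraint problem is laid out on a torus whose cell [(i, j)] chooses
    values for the variables [i] and [j].  Cells become bins: the choice is an
    item whose size encodes the two values in a positional system, and equality
    of neighbouring choices is enforced by unit items shared between
    neighbouring bins, which must fill up all digits exactly.  Bins become the
    core vertices of a graph and items become cliques of twins adjacent to the
    at most two bins that may contain them, so the bins form a twin cover.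

    The reduction is computed by terms with bounded sums and limited recursion,
    which compile to programs running in polynomial time. *)
From mathcomp Require Import all_boot zify.
Require Import Defs.
Set Implicit Arguments.
Unset Strict Implicit.
Unset Printing Implicit Defensive.

(** * Bounded terms and their compilation *)

(** A problem in W[1] comes with nothing but a reduction to circuits of weft 1 and some constant
    depth, so the construction has to start from arbitrary such circuits. Only the number of bins
    enters the parameter: it may depend on [k] alone, while items may be as many and as large as a
    polynomial permits. This is why tuples of region numbers index the variables, and everything
    that depends on the circuit is moved into the values.

    An item is adjacent to at most two bins, so a value cannot be broadcast; it is handed from bin
    to neighbouring bin along a row and a column, and the diagonal cell ties the row to the column.
    An item of weight [w] costs [w] vertices, so its weight may only have a constant number of
    digits.

    A coalition could cheat by tearing an item apart or by uniting several bins. The target value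
    credits each item vertex with all its mates and a single bin, and heavy private items make a
    union of bins lose more than it gains. *)

Definition bsum (n : nat) (F : nat -> nat) : nat := \sum_(0 <= i < n) F i.

(* Truncation at [b] keeps iterated values polynomially bounded. *)
Definition lrec (b n a : nat) (F : nat -> nat -> nat) : nat :=
  iteri n (fun i r => minn b (F i r)) (minn b a).

Lemma lrec_le b n a F : lrec b n a F <= b.
Proof. by case: n => [|n]; rewrite /lrec /= geq_minl. Qed.

Inductive tm :=
  | TVar of nat
  | TConst of nat
  | TLen
  | TBit of tm
  | TAdd of tm & tm
  | TSub of tm & tm
  | TSum of tm & tm
  | TRec of tm & tm & tm & tm
  | TLet of tm & tm
  | TWeak of tm.

Fixpoint teval (x : seq bool) (e : seq nat) (t : tm) : nat :=
  match t with
  | TVar n => nth 0 e n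
  | TConst n => n
  | TLen => size x
  | TBit a => nth false x (teval x e a)
  | TAdd a b => teval x e a + teval x e b
  | TSub a b => teval x e a - teval x e b
  | TSum a b => bsum (teval x e a) (fun i => teval x (i :: e) b)
  | TRec b n a f => lrec (teval x e b) (teval x e n) (teval x e a)
                         (fun i r => teval x [:: i, r & e] f)
  | TLet a b => teval x (teval x e a :: e) b
  | TWeak a => teval x (behead e) a
  end.

Section Compile.

Variables X R : nat.

Definition reg (i : nat) : expr := Fetch R (Const i).
Definition setr (i : nat) (v : expr) : prog := Store R (Const i) v.

(* The input is in bank [X] and its length in cell 0 of bank [R]; [rs] lists the
   cells of [R] holding the variables; the value is left in cell [k], and the
   cells from [k] on are scratch space. *)
Fixpoint compile (t : tm) (rs : seq nat) (k : nat) : prog :=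
  match t with
  | TVar n => setr k (nth (Const 0) (map reg rs) n)
  | TConst n => setr k (Const n)
  | TLen => setr k (reg 0)
  | TBit a => Seq (compile a rs k) (setr k (Sub (Fetch X (reg k)) (Const 1)))
  | TAdd a b => Seq (compile a rs k) (Seq (compile b rs k.+1)
                  (setr k (Add (reg k) (reg k.+1))))
  | TSub a b => Seq (compile a rs k) (Seq (compile b rs k.+1)
                  (setr k (Sub (reg k) (reg k.+1))))
  | TSum a b =>
      Seq (compile a rs k) (Seq (setr k.+1 (Const 0)) (Seq (setr k.+2 (Const 0))
        (Seq (While (Sub (reg k) (reg k.+2))
               (Seq (compile b (k.+2 :: rs) k.+3)
               (Seq (setr k.+1 (Add (reg k.+1) (reg k.+3)))
                    (setr k.+2 (Add (reg k.+2) (Const 1))))))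
             (setr k (reg k.+1)))))
  | TRec b n a f =>
      Seq (compile b rs k) (Seq (compile n rs k.+1) (Seq (compile a rs k.+2)
        (Seq (setr k.+2 (Sub (reg k) (Sub (reg k) (reg k.+2))))
        (Seq (setr k.+3 (Const 0))
        (Seq (While (Sub (reg k.+1) (reg k.+3))
               (Seq (compile f [:: k.+3, k.+2 & rs] k.+4)
               (Seq (setr k.+2 (Sub (reg k) (Sub (reg k) (reg k.+4))))
                    (setr k.+3 (Add (reg k.+3) (Const 1))))))
             (setr k (reg k.+2)))))))
  | TLet a b => Seq (compile a rs k)
                  (Seq (compile b (k :: rs) k.+1) (setr k (reg k.+1)))
  | TWeak a => compile a (behead rs) k
  end.

End Compile.

(** The invariant is indexed by the number of iterations done, which makes the time bound explicit;
    the induction is on the number of iterations left. *)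
Lemma exec_while (I : nat -> state -> Prop) e p M c s :
  (forall i s1, i < M -> I i s1 ->
     eval s1 e != 0 /\ exists n s2, [/\ exec p s1 n s2, n <= c & I i.+1 s2]) ->
  (forall s1, I M s1 -> eval s1 e == 0) ->
  I 0 s ->
  exists n s2, [/\ exec (While e p) s n s2, n <= (M * c.+1).+1 & I M s2].
Proof.
move=> step stop.
suff H j : j <= M -> forall s1, I (M - j) s1 -> exists n s2,
    [/\ exec (While e p) s1 n s2, n <= (j * c.+1).+1 & I M s2].
  by move=> I0; apply: (H M); rewrite ?subnn.
elim: j => [|j IHj] ljM s1 Is1.
  rewrite subn0 in Is1.
  by exists 1, s1; split=> //; apply: ExecWhileFalse; apply: stop.
have [|ne [n [s2 [ex lec I2]]]] := step _ _ _ Is1; first lia.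
rewrite (_ : (M - j.+1).+1 = M - j) in I2; last lia.
have [m [s3 [ex3 le3 I3]]] := IHj (ltnW ljM) _ I2.
exists (n + m).+1, s3; split=> //; first exact: ExecWhileTrue ex3.
lia.
Qed.

Lemma updateE (s : state) b i v b' i' :
  update s b i v b' i' = if (b' == b) && (i' == i) then v else s b' i'.
Proof. by []. Qed.

Lemma leq_exp_id N c : 0 < N -> 0 < c -> N <= N ^ c.
Proof. by case: c => // c N0 _; rewrite expnS leq_pmulr // expn_gt0 N0. Qed.

Lemma exp_gt1 N c : 1 < N -> 0 < c -> 1 < N ^ c.
Proof. by move=> N1 c0; apply: (leq_trans N1); apply: leq_exp_id => //; lia. Qed.

(** Since [1 < N], constant factors are absorbed by the exponent, and all bounds can stay pure
    powers of [N]. *)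
Lemma exp_add2 N c : 1 < N -> 4 * N ^ c <= N ^ c.+2.
Proof.
by move=> N1; rewrite !expnS mulnA leq_mul2r; apply/orP; right; apply: (@leq_mul 2 2).
Qed.

(** * Compiled terms run in polynomial time *)

Section CompileCorrect.

Variables X R : nat.
Hypothesis neXR : X != R.

Definition preserves (k : nat) (s s' : state) : Prop :=
  (forall i, i < k -> s' R i = s R i) /\ (forall b, b != R -> s' b =1 s b).

Lemma preserves_trans k l s1 s2 s3 : k <= l ->
  preserves k s1 s2 -> preserves l s2 s3 -> preserves k s1 s3.
Proof.
move=> lekl [a b] [a' b']; split=> [i lik|c nc i]; first by rewrite a' ?a //; lia.
by rewrite b' ?b.
Qed.

Lemma preserves_update k i s v : k <= i -> preserves k s (update s R i v).
Proof.
move=> leki; split=> [j ljk|b nb j]; rewrite updateE.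
  by rewrite eqxx /= ifF //; lia.
by rewrite (negPf nb).
Qed.

Definition ready (x : seq bool) (rs : seq nat) (k : nat) (s : state) : Prop :=
  [/\ s X =1 tape x, s R 0 = size x, 0 < k & all (fun r => r < k) rs].

Lemma ready_preserves x rs k l s s' :
  ready x rs k s -> k <= l -> preserves k s s' -> ready x rs l s'.
Proof.
move=> [a b c d] lekl [h1 h2]; split; last 2 [lia].
- by move=> i; rewrite h2.
- by rewrite h1.
- by apply: sub_all d => i; lia.
Qed.

Lemma map_preserves rs k s s' :
  all (fun r => r < k) rs -> preserves k s s' -> map (s' R) rs = map (s R) rs.
Proof. by move=> /allP ar [h _]; apply/eq_in_map => r /ar /h. Qed.

(** One exponent bounds value and time, relative to any [N] above the input length and the
    variables. In loops and under [TLet] the body is used with [N ^ c] in place of [N], so that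
    exponents multiply. *)
Definition computes (t : tm) (c : nat) : Prop :=
  forall x rs k s N, ready x rs k s -> 1 < N -> size x <= N ->
    all (fun v => v <= N) (map (s R) rs) ->
  teval x (map (s R) rs) t <= N ^ c /\
  exists n s', [/\ exec (compile X R t rs k) s n s', n <= N ^ c,
     s' R k = teval x (map (s R) rs) t & preserves k s s'].


(** For later operands: the environment was read in [s0], but evaluation starts in a state [s] whose
    scratch cells have changed. *)
Lemma computes_at t c x rs k l s0 s N : computes t c ->
  ready x rs k s0 -> k <= l -> preserves k s0 s -> 1 < N -> size x <= N ->
  all (fun v => v <= N) (map (s0 R) rs) ->
  exists n s', [/\ exec (compile X R t rs l) s n s', n <= N ^ c,
     s' R l = teval x (map (s0 R) rs) t & preserves l s s'].
Proof.
move=> ct rd lekl pr N1 xN aN.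
have rd' := ready_preserves rd lekl pr.
have [_ _ _ ark] := rd.
have em := map_preserves ark pr.
have [|_ H] := ct _ _ _ _ _ rd' N1 xN; first by rewrite em.
by rewrite em in H.
Qed.

Lemma computes_le t c c' : c <= c' -> computes t c -> computes t c'.
Proof.
move=> lecc ct x rs k s N rd N1 xN aN.
have leN : N ^ c <= N ^ c' by rewrite leq_pexp2l // ltnW.
have [h [n [s' [h1 h2 h3 h4]]]] := ct _ _ _ _ _ rd N1 xN aN.
by split; [lia | exists n, s'; split=> //; lia].
Qed.

Lemma exec_setr i v s : exec (setr R i v) s 1 (update s R i (eval s v)).
Proof. exact: ExecStore. Qed.

Lemma update_reg s i v j : update s R i v R j = if j == i then v else s R j.
Proof. by rewrite updateE eqxx. Qed.

Lemma computes_simple t :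
  (forall x rs k s, ready x rs k s -> exists v,
     compile X R t rs k = setr R k v /\ eval s v = teval x (map (s R) rs) t) ->
  (exists c, forall x e N, 1 < N -> size x <= N -> all (fun v => v <= N) e ->
     teval x e t <= N ^ c) ->
  exists c, 0 < c /\ computes t c.
Proof.
move=> hc [c hv]; exists c.+1; split=> // x rs k s N rd N1 xN aN.
have le1 : N ^ c <= N ^ c.+1 by rewrite leq_pexp2l // ltnW.
split; first exact: leq_trans (hv _ _ _ N1 xN aN) le1.
have [v [-> ev]] := hc _ _ _ _ rd.
exists 1, (update s R k (eval s v)); split.
- exact: exec_setr.
- by rewrite expn_gt0; lia.
- by rewrite update_reg eqxx.
- exact: preserves_update.
Qed.

Lemma computes_var n : exists c, 0 < c /\ computes (TVar n) c.
Proof.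
apply: computes_simple => [x rs k s rd|].
  exists (nth (Const 0) (map (reg R) rs) n); split=> //=.
  by elim: rs n {rd} => [|r rs IH] [|n] //=.
exists 1 => x e N N1 xN /allP aN /=; rewrite expn1.
by have [/(mem_nth 0)/aN//|le] := ltnP n (size e); rewrite nth_default.
Qed.

Lemma computes_const n : exists c, 0 < c /\ computes (TConst n) c.
Proof.
apply: computes_simple => [x rs k s rd|]; first by exists (Const n).
exists n => x e N N1 xN aN /=.
exact: leq_trans (ltnW (ltn_expl n N1)) _.
Qed.

Lemma computes_len : exists c, 0 < c /\ computes TLen c.
Proof.
apply: computes_simple => [x rs k s [_ eR _ _]|].
  by exists (reg R 0); split; rewrite //= eR.
by exists 1 => x e N N1 xN aN /=; rewrite expn1.
Qed.

Lemma computes_bit a : (exists c, 0 < c /\ computes a c) ->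
  exists c, 0 < c /\ computes (TBit a) c.
Proof.
move=> [c [c0 ca]]; exists c.+1; split=> // x rs k s N rd N1 xN aN /=.
have Q2 := exp_gt1 N1 c0.
have QE : N ^ c.+1 = N * N ^ c by rewrite expnS.
split; first by case: (nth _ _ _); nia.
have [_ [n [s1 [ex1 le1 v1 p1]]]] := ca _ _ _ _ _ rd N1 xN aN.
exists (n + 1), (update s1 R k (eval s1 (Sub (Fetch X (reg R k)) (Const 1)))).
split.
- exact: ExecSeq ex1 (exec_setr _ _ _).
- nia.
(* Bits are stored as [b + 1] and blanks as 0, so truncated subtraction of 1 yields false beyond the
   end of the input. *)
- rewrite update_reg eqxx /= v1.
  have [_ pX] := p1; have [eX _ _ _] := rd.
  rewrite pX // eX /tape; set y := teval _ _ _.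
  have [lt|le] := ltnP y (size x).
    by rewrite (nth_map false) //; lia.
  by rewrite !nth_default // size_map.
- by apply: preserves_trans p1 (preserves_update _ _ (leqnn _)).
Qed.

Lemma exists_common a b : (exists c, 0 < c /\ computes a c) ->
  (exists c, 0 < c /\ computes b c) ->
  exists c, [/\ 0 < c, computes a c & computes b c].
Proof.
move=> [c [c0 ca]] [c' [c'0 cb]]; exists (c + c').
by split; [lia | apply: computes_le ca | apply: computes_le cb]; lia.
Qed.

Lemma computes_add a b : (exists c, 0 < c /\ computes a c) ->
  (exists c, 0 < c /\ computes b c) ->
  exists c, 0 < c /\ computes (TAdd a b) c.
Proof.
move=> ha hb; have [c [c0 ca cb]] := exists_common ha hb.
exists c.+2; split=> // x rs k s N rd N1 xN aN /=.
have Q2 := exp_gt1 N1 c0.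
have QL := exp_add2 c N1.
have [va [n1 [s1 [ex1 le1 v1 p1]]]] := ca _ _ _ _ _ rd N1 xN aN.
have [vb _] := cb _ _ _ _ _ rd N1 xN aN.
split; first lia.
have [n2 [s2 [ex2 le2 v2 p2]]] := computes_at cb rd (leqnSn k) p1 N1 xN aN.
exists (n1 + (n2 + 1)), (update s2 R k (eval s2 (Add (reg R k) (reg R k.+1)))).
split.
- exact: ExecSeq ex1 (ExecSeq ex2 (exec_setr _ _ _)).
- lia.
- by rewrite update_reg eqxx /= v2 (p2.1 k) // v1.
- apply: preserves_trans (preserves_update _ _ (leqnn _)) => //.
  exact: preserves_trans (leqnSn k) p1 p2.
Qed.

Lemma computes_sub a b : (exists c, 0 < c /\ computes a c) ->
  (exists c, 0 < c /\ computes b c) ->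
  exists c, 0 < c /\ computes (TSub a b) c.
Proof.
move=> ha hb; have [c [c0 ca cb]] := exists_common ha hb.
exists c.+2; split=> // x rs k s N rd N1 xN aN /=.
have Q2 := exp_gt1 N1 c0.
have QL := exp_add2 c N1.
have [va [n1 [s1 [ex1 le1 v1 p1]]]] := ca _ _ _ _ _ rd N1 xN aN.
split; first lia.
have [n2 [s2 [ex2 le2 v2 p2]]] := computes_at cb rd (leqnSn k) p1 N1 xN aN.
exists (n1 + (n2 + 1)), (update s2 R k (eval s2 (Sub (reg R k) (reg R k.+1)))).
split.
- exact: ExecSeq ex1 (ExecSeq ex2 (exec_setr _ _ _)).
- lia.
- by rewrite update_reg eqxx /= v2 (p2.1 k) // v1.
- apply: preserves_trans (preserves_update _ _ (leqnn _)) => //.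
  exact: preserves_trans (leqnSn k) p1 p2.
Qed.

Lemma all_le N N' (e : seq nat) : N <= N' ->
  all (fun v => v <= N) e -> all (fun v => v <= N') e.
Proof. by move=> le; apply: sub_all => v; lia. Qed.

Lemma computes_let a b : (exists c, 0 < c /\ computes a c) ->
  (exists c, 0 < c /\ computes b c) ->
  exists c, 0 < c /\ computes (TLet a b) c.
Proof.
move=> ha hb; have [c [c0 ca cb]] := exists_common ha hb.
exists (c * c).+2; split=> // x rs k s N rd N1 xN aN /=.
have Q2 := exp_gt1 N1 c0.
have NQ : N <= N ^ c by apply: leq_exp_id; lia.
have QQ : N ^ c <= N ^ (c * c) by rewrite leq_pexp2l ?leq_pmulr //; lia.
have QL := exp_add2 (c * c) N1.
have [va [n1 [s1 [ex1 le1 v1 p1]]]] := ca _ _ _ _ _ rd N1 xN aN.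
have [eX eR k0 ark] := rd.
have rd1 : ready x (k :: rs) k.+1 s1.
  have [r1 r2 r3 r4] := ready_preserves rd (leqnSn k) p1.
  by split=> //=; rewrite ltnSn.
have em := map_preserves ark p1.
have am : all (fun v => v <= N ^ c) [seq s1 R i | i <- k :: rs].
  by rewrite /= v1 va em (all_le NQ).
have [vb [n2 [s2 [ex2 le2 v2 p2]]]] := cb _ _ _ _ _ rd1 Q2 (leq_trans xN NQ) am.
rewrite /= em v1 -expnM in vb v2 le2.
split; first lia.
exists (n1 + (n2 + 1)), (update s2 R k (eval s2 (reg R k.+1))).
split.
- exact: ExecSeq ex1 (ExecSeq ex2 (exec_setr _ _ _)).
- lia.
- by rewrite update_reg eqxx /= v2.
- apply: preserves_trans (preserves_update _ _ (leqnn _)) => //.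
  exact: preserves_trans (leqnSn k) p1 p2.
Qed.

Lemma computes_weak a : (exists c, 0 < c /\ computes a c) ->
  exists c, 0 < c /\ computes (TWeak a) c.
Proof.
move=> [c [c0 ca]]; exists c; split=> // x rs k s N rd N1 xN aN /=.
rewrite behead_map; apply: ca => //.
  by case: rd => a1 a2 a3; case: (rs) => //= r l /andP[].
by case: (rs) aN => //= r l /andP[].
Qed.

Lemma computes_sum a b : (exists c, 0 < c /\ computes a c) ->
  (exists c, 0 < c /\ computes b c) ->
  exists c, 0 < c /\ computes (TSum a b) c.
Proof.
move=> ha hb; have [c [c0 ca cb]] := exists_common ha hb.
exists (c * (c + 6)); split; first by rewrite muln_gt0 c0; lia.
move=> x rs k s N rd N1 xN aN /=.
have Q2 := exp_gt1 N1 c0.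
have NQ : N <= N ^ c by apply: leq_exp_id; lia.
have [va [n1 [s1 [ex1 le1 v1 p1]]]] := ca _ _ _ _ _ rd N1 xN aN.
rewrite expnM; set Q := N ^ c in Q2 NQ va le1 *.
have [eX eR k0 ark] := rd.
set e := map (s R) rs in aN va v1 *; set v := teval x e a in va v1 *.
have QC := exp_gt1 Q2 c0.
(* Beyond [Q ^ c] for the body, one power of [Q] pays for the number of rounds and five pay for the
   constant [2 ^ 5]. *)
have QL : 8 * Q + 8 * (Q * Q ^ c) <= Q ^ (c + 6).
  apply: leq_trans (_ : Q ^ c * 2 ^ 5 * Q <= _); last first.
    by rewrite -mulnA expnD leq_mul2l (expnSr Q) leq_mul2r leq_exp2r // Q2 !orbT.
  by rewrite (_ : 2 ^ 5 = 32) //; nia.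
have body i s2 : ready x rs k s2 -> map (s2 R) rs = e -> s2 R k.+2 = i -> i <= v ->
    teval x (i :: e) b <= Q ^ c /\ exists n s3,
    [/\ exec (compile X R b (k.+2 :: rs) k.+3) s2 n s3, n <= Q ^ c,
        s3 R k.+3 = teval x (i :: e) b & preserves k.+3 s2 s3].
  move=> rd2 em ei lt.
  have := cb x (k.+2 :: rs) k.+3 s2 Q; rewrite /= em ei; apply => //.
  - have [h1 h2 h3 h4] := rd2; split=> //=; rewrite ltnSn /=.
    by apply: sub_all h4 => r; lia.
  - lia.
  - by rewrite (all_le NQ) // andbT; lia.
(* The value bound is obtained by running the body in a fabricated state that holds [i]. *)
have vb i : i <= v -> teval x (i :: e) b <= Q ^ c.
  move=> le.
  have [] := body i (update s R k.+2 i) => //.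
  - by apply: ready_preserves rd (leqnn _) (preserves_update _ _ _); lia.
  - by apply: map_preserves ark (preserves_update _ _ _); lia.
  - by rewrite update_reg eqxx.
have bs : bsum v (fun i => teval x (i :: e) b) <= Q * Q ^ c.
  apply: leq_trans (_ : v * Q ^ c <= _); last by nia.
  rewrite /bsum big_mkord -[X in X * _]card_ord -sum_nat_const leq_sum // => i _.
  by apply: vb; rewrite ltnW.
split; first lia.
set s2 := update s1 R k.+1 0; set s3 := update s2 R k.+2 0.
have p3 : preserves k s s3.
  apply: preserves_trans (leqnn k) p1 _.
  by apply: preserves_trans (leqnn k) (preserves_update _ _ _) (preserves_update _ _ _); lia.
pose I i (s' : state) := [/\ preserves k s s', s' R k = v, s' R k.+2 = i
   & s' R k.+1 = bsum i (fun i => teval x (i :: e) b)].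
have [|||n4 [s4 [ex4 le4 [p4 _ _ v4]]]] := @exec_while I (Sub (reg R k) (reg R k.+2))
   (Seq (compile X R b (k.+2 :: rs) k.+3)
       (Seq (setr R k.+1 (Add (reg R k.+1) (reg R k.+3)))
            (setr R k.+2 (Add (reg R k.+2) (Const 1))))) v (Q ^ c + 2) s3.
- move=> i s4 liv [p4 ek e2 e1]; split; first by rewrite /= ek e2; lia.
  have [||||_ [n [s5 [ex5 le5 v5 p5]]]] := body i s4 => //.
  + exact: ready_preserves rd (leqnn _) p4.
  + exact: map_preserves ark p4.
  + lia.
  exists (n + (1 + 1)); set s6 := update s5 R k.+1 (eval s5 (Add (reg R k.+1) (reg R k.+3))).
  exists (update s6 R k.+2 (eval s6 (Add (reg R k.+2) (Const 1)))); split.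
  + exact: ExecSeq ex5 (ExecSeq (exec_setr _ _ _) (exec_setr _ _ _)).
  + lia.
  + have [q1 _] := p5; split.
    * apply: preserves_trans (leqnn k) p4 _.
      apply: (preserves_trans (leqnn k)); last by apply: preserves_update; lia.
      apply: (preserves_trans (leqnn k)); last by apply: preserves_update; lia.
      by split=> [j lj|]; [apply: q1; lia | case: p5].
    * by rewrite update_reg ifF ?/s6 ?update_reg ?ifF ?q1 //; lia.
    * rewrite update_reg eqxx -[eval _ _]/(s6 R k.+2 + 1) /s6 update_reg ifF; last lia.
      by rewrite q1 // e2 addn1.
    * rewrite update_reg ifF; last lia.
      by rewrite /s6 update_reg eqxx /= v5 q1 // e1 /bsum big_nat_recr.
- by move=> s4 [_ ek e2 _]; rewrite /= ek e2 subnn.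
- split=> //.
  + by rewrite /s3 /s2 !update_reg !ifF //; lia.
  + by rewrite /s3 update_reg eqxx.
  + by rewrite /s3 /s2 !update_reg ifF ?eqxx /bsum ?big_geq //; lia.
exists (n1 + (1 + (1 + (n4 + 1)))), (update s4 R k (eval s4 (reg R k.+1))); split.
- apply: (ExecSeq ex1); apply: (ExecSeq (s' := s2)); first exact: exec_setr.
  apply: (ExecSeq (s' := s3)); first exact: exec_setr.
  exact: ExecSeq ex4 (exec_setr _ _ _).
- nia.
- by rewrite update_reg eqxx /= v4.
- exact: preserves_trans (leqnn k) p4 (preserves_update _ _ (leqnn _)).
Qed.


Lemma computes_rec b n a f : (exists c, 0 < c /\ computes b c) ->
  (exists c, 0 < c /\ computes n c) -> (exists c, 0 < c /\ computes a c) ->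
  (exists c, 0 < c /\ computes f c) ->
  exists c, 0 < c /\ computes (TRec b n a f) c.
Proof.
move=> [c1 [c10 cb]] [c2 [c20 cn]] [c3 [c30 ca]] [c4 [c40 cf]].
pose c := c1 + c2 + c3 + c4; have c0 : 0 < c by rewrite /c; lia.
move/(computes_le (_ : c1 <= c)) in cb; move/(computes_le (_ : c2 <= c)) in cn.
move/(computes_le (_ : c3 <= c)) in ca; move/(computes_le (_ : c4 <= c)) in cf.
have {}cb := cb ltac:(lia); have {}cn := cn ltac:(lia).
have {}ca := ca ltac:(lia); have {}cf := cf ltac:(lia).
exists (c * (c + 6)); split; first by rewrite muln_gt0 c0; lia.
move=> x rs k s N rd N1 xN aN /=.
have Q2 := exp_gt1 N1 c0.
have NQ : N <= N ^ c by apply: leq_exp_id; lia.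
have [vb [n1 [s1 [ex1 le1 v1 p1]]]] := cb _ _ _ _ _ rd N1 xN aN.
have [vn _] := cn _ _ _ _ _ rd N1 xN aN.
have [n2 [s2 [ex2 le2 v2 p2]]] := computes_at cn rd (leqnSn k) p1 N1 xN aN.
have {}p2' := preserves_trans (leqnSn k) p1 p2.
have le02 : k <= k.+2 by lia.
have [n3 [s3 [ex3 le3 v3 p3]]] := computes_at ca rd le02 p2' N1 xN aN.
have {}p3' := preserves_trans le02 p2' p3.
rewrite expnM; set Q := N ^ c in Q2 NQ vb vn le1 le2 le3 *.
have [eX eR k0 ark] := rd.
set e := map (s R) rs in aN vb vn v1 v2 v3 *.
set B := teval x e b in vb v1 *; set M := teval x e n in vn v2 *.
set A := teval x e a in v3 *.
have QC := exp_gt1 Q2 c0.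
have QL : 8 * Q + 8 * (Q * Q ^ c) <= Q ^ (c + 6).
  apply: leq_trans (_ : Q ^ c * 2 ^ 5 * Q <= _); last first.
    by rewrite -mulnA expnD leq_mul2l (expnSr Q) leq_mul2r leq_exp2r // Q2 !orbT.
  by rewrite (_ : 2 ^ 5 = 32) //; nia.
have body i r s4 : ready x rs k s4 -> map (s4 R) rs = e -> s4 R k.+3 = i ->
    s4 R k.+2 = r -> i <= M -> r <= B -> exists n s5,
    [/\ exec (compile X R f [:: k.+3, k.+2 & rs] k.+4) s4 n s5, n <= Q ^ c,
        s5 R k.+4 = teval x [:: i, r & e] f & preserves k.+4 s4 s5].
  move=> rd4 em ei er lt ltr.
  have := cf x [:: k.+3, k.+2 & rs] k.+4 s4 Q; rewrite /= em ei er; case => //.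
  - have [h1 h2 h3 h4] := rd4; split=> //=; rewrite ltnSn !ltnS leqnSn /=.
    by apply: sub_all h4 => j; lia.
  - lia.
  - rewrite (all_le NQ) // andbT; lia.
(* Truncation at [B] prevents any growth through the iteration. *)
split; first by have := lrec_le B M A (fun i r => teval x [:: i, r & e] f); nia.
set s4 := update s3 R k.+2 (eval s3 (Sub (reg R k) (Sub (reg R k) (reg R k.+2)))).
set s5 := update s4 R k.+3 0.
have p5 : preserves k s s5.
  apply: preserves_trans (leqnn k) p3' _.
  by apply: preserves_trans (leqnn k) (preserves_update _ _ _) (preserves_update _ _ _); lia.
pose F i r := teval x [:: i, r & e] f.
pose I i (s' : state) := [/\ preserves k s s', s' R k = B, s' R k.+1 = M,
   s' R k.+3 = i & s' R k.+2 = lrec B i A F].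
have v3k : s3 R k = B by rewrite (p3.1 k) ?(p2.1 k) //; lia.
have v3k1 : s3 R k.+1 = M by rewrite (p3.1 k.+1).
(* The machine takes minima by two truncated subtractions. *)
have minE u w : u - (u - w) = minn u w by rewrite /minn; case: ltnP; lia.
have [|||n6 [s6 [ex6 le6 [p6 _ _ _ v6]]]] := @exec_while I (Sub (reg R k.+1) (reg R k.+3))
   (Seq (compile X R f [:: k.+3, k.+2 & rs] k.+4)
       (Seq (setr R k.+2 (Sub (reg R k) (Sub (reg R k) (reg R k.+4))))
            (setr R k.+3 (Add (reg R k.+3) (Const 1))))) M (Q ^ c + 2) s5.
- move=> i s6 liv [p6 ek e1 e3 e2]; split; first by rewrite /= e1 e3; lia.
  have [|||||| m [s7 [ex7 le7 v7 p7]]] := body i (lrec B i A F) s6 => //.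
  + exact: ready_preserves rd (leqnn _) p6.
  + exact: map_preserves ark p6.
  + lia.
  + exact: lrec_le.
  exists (m + (1 + 1)).
  set s8 := update s7 R k.+2 (eval s7 (Sub (reg R k) (Sub (reg R k) (reg R k.+4)))).
  exists (update s8 R k.+3 (eval s8 (Add (reg R k.+3) (Const 1)))); split.
  + exact: ExecSeq ex7 (ExecSeq (exec_setr _ _ _) (exec_setr _ _ _)).
  + lia.
  + have [q1 _] := p7; have lk : k < k.+4 by lia.
    split.
    * apply: preserves_trans (leqnn k) p6 _.
      apply: (preserves_trans (leqnn k)); last by apply: preserves_update; lia.
      apply: (preserves_trans (leqnn k)); last by apply: preserves_update; lia.
      by split=> [j lj|]; [apply: q1; lia | case: p7].
    * by rewrite update_reg ifF ?/s8 ?update_reg ?ifF ?q1 //; lia.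
    * by rewrite update_reg ifF ?/s8 ?update_reg ?ifF ?q1 //; lia.
    * rewrite update_reg eqxx -[eval _ _]/(s8 R k.+3 + 1) /s8 update_reg ifF; last lia.
      by rewrite q1 // e3 addn1.
    * rewrite update_reg ifF; last lia.
      by rewrite /s8 update_reg eqxx /= v7 q1 // ek minE.
- by move=> s6 [_ _ e1 e3 _]; rewrite /= e1 e3 subnn.
- split=> //.
  + by rewrite /s5 /s4 !update_reg !ifF //; lia.
  + by rewrite /s5 /s4 !update_reg !ifF //; lia.
  + by rewrite /s5 update_reg eqxx.
  + rewrite /s5 update_reg ifF; last lia.
    by rewrite /s4 update_reg eqxx /= v3 v3k minE.
exists (n1 + (n2 + (n3 + (1 + (1 + (n6 + 1)))))).
exists (update s6 R k (eval s6 (reg R k.+2))); split.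
- apply: (ExecSeq ex1); apply: (ExecSeq ex2); apply: (ExecSeq ex3).
  apply: (ExecSeq (s' := s4)); first exact: exec_setr.
  apply: (ExecSeq (s' := s5)); first exact: exec_setr.
  exact: ExecSeq ex6 (exec_setr _ _ _).
- nia.
- by rewrite update_reg eqxx /= v6.
- exact: preserves_trans (leqnn k) p6 (preserves_update _ _ (leqnn _)).
Qed.

Lemma compile_correct t : exists c, 0 < c /\ computes t c.
Proof.
elim: t => [n|n||a|a ? b ?|a ? b ?|a ? b ?|b ? n ? a ? f ?|a ? b ?|a].
- exact: computes_var.
- exact: computes_const.
- exact: computes_len.
- exact: computes_bit.
- exact: computes_add.
- exact: computes_sub.
- exact: computes_sum.
- exact: computes_rec.
- exact: computes_let.
- exact: computes_weak.
Qed.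

End CompileCorrect.

(** * Printing the value of a term *)

Definition definable (f : seq bool -> seq nat -> nat) : Prop :=
  exists t, forall x e, teval x e t = f x e.

Fixpoint bank_bound (p : prog) : nat :=
  match p with
  | Skip => 0
  | Store b _ _ => b.+1
  | Seq p q => maxn (bank_bound p) (bank_bound q)
  | If _ p q => maxn (bank_bound p) (bank_bound q)
  | While _ p => bank_bound p
  end.

Lemma exec_bank_bound p s n s' b :
  exec p s n s' -> bank_bound p <= b -> s' b =1 s b.
Proof.
move=> ex; elim: ex => {p s n s'} //=.
- by move=> s c e v lt i; rewrite updateE ifF //; lia.
- by move=> p q s n s' m s'' _ IH1 _ IH2; rewrite geq_max => /andP[/IH1 h /IH2 h'] i; rewrite h'.
- by move=> e p q s n s' _ _ IH; rewrite geq_max => /andP[/IH].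
- by move=> e p q s n s' _ _ IH; rewrite geq_max => /andP[_ /IH].
- by move=> e p s n s' m s'' _ _ IH1 _ IH2 lt i; rewrite IH2 ?IH1.
Qed.

(** A step writes at most one cell; this turns running time into a bound on the length of the
    output. *)
Lemma exec_changed_cells p s n s' b : exec p s n s' ->
  exists2 l, size l <= n & forall i, s' b i != s b i -> i \in l.
Proof.
move=> ex; elim: ex => {p s n s'} //=.
- by move=> s; exists [::] => // i; rewrite eqxx.
- move=> s c e v; exists [:: eval s e] => // i; rewrite updateE inE.
  by case: ifP => [/andP[_ ->]//|_]; rewrite eqxx.
- move=> p q s n s' m s'' _ [l sl hl] _ [l' sl' hl']; exists (l ++ l').
    by rewrite size_cat leq_add.
  move=> i ne; rewrite mem_cat; have [//|/negbTE h] := boolP (i \in l).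
  by apply: hl'; apply: contraNN ne => /eqP->; apply: contraFT h => /hl.
- by move=> e p q s n s' _ _ [l sl hl]; exists l => //; lia.
- by move=> e p q s n s' _ _ [l sl hl]; exists l => //; lia.
- move=> e p s n s' m s'' _ _ [l sl hl] _ [l' sl' hl']; exists (l ++ l').
    by rewrite size_cat; lia.
  move=> i ne; rewrite mem_cat; have [//|/negbTE h] := boolP (i \in l).
  by apply: hl'; apply: contraNN ne => /eqP->; apply: contraFT h => /hl.
- by move=> e p s _; exists [::] => // i; rewrite eqxx.
Qed.

Lemma tape_lt x i : i < size x -> tape x i != 0.
Proof. by move=> lt; rewrite /tape (nth_map false). Qed.

Lemma tape_ge x i : size x <= i -> tape x i = 0.
Proof. by move=> le; rewrite /tape nth_default // size_map. Qed.

Lemma tape_rcons x b i :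
  tape (rcons x b) i = if i == size x then b.+1 else tape x i.
Proof.
rewrite /tape map_rcons nth_rcons size_map.
by case: ltngtP => // lt; rewrite nth_default // size_map ltnW.
Qed.

Lemma size_transforms p x n y : transforms p x n y -> size y <= n.
Proof.
move=> [s [ex es]]; have [l sl hl] := exec_changed_cells 1 ex.
apply: leq_trans sl; rewrite -(size_iota 0 (size y)).
apply: uniq_leq_size; first exact: iota_uniq.
by move=> i; rewrite mem_iota => /andP[_ lt]; apply: hl; rewrite es /initial tape_lt.
Qed.

Section Emit.

Variables X R : nat.
Hypothesis neXR : X != R.
Hypotheses (neX : X != 1) (neR : R != 1).

Let rg i := reg R i.
Let st i v := setr R i v.

(** The string was left in bank 1 by the reduction run before. It is moved away because bank 1 must
    be blank when printing starts. *)
Definition fetch_input : prog :=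
  Seq (st 0 (Const 0))
  (While (Fetch 1 (rg 0))
     (Seq (Store X (rg 0) (Fetch 1 (rg 0)))
     (Seq (Store 1 (rg 0) (Const 0)) (st 0 (Add (rg 0) (Const 1)))))).

Lemma fetch_inputP x s : s 1 =1 tape x -> s X =1 (fun=> 0) ->
  exists n s', [/\ exec fetch_input s n s', n <= 4 * (size x).+1,
    s' X =1 tape x, s' 1 =1 (fun=> 0) & s' R 0 = size x].
Proof.
move=> e1 eX.
have n1R : 1 != R by rewrite eq_sym.
have n1X : 1 != X by rewrite eq_sym.
pose I i (s' : state) := [/\ s' R 0 = i,
  forall j, s' X j = if j < i then tape x j else 0
  & forall j, s' 1 j = if j < i then 0 else tape x j].
have [|||n [s' [ex le [h1 h2 h3]]]] := @exec_while I (Fetch 1 (rg 0))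
  (Seq (Store X (rg 0) (Fetch 1 (rg 0)))
     (Seq (Store 1 (rg 0) (Const 0)) (st 0 (Add (rg 0) (Const 1))))) (size x) 3
  (update s R 0 0).
- move=> i s1 lt [h1 h2 h3]; split; first by rewrite /= h1 h3 ltnn tape_lt.
  eexists _, _; split.
  + apply: ExecSeq; first exact: ExecStore.
    by apply: ExecSeq; first exact: ExecStore; exact: ExecStore.
  + by [].
  + have hR b j v s2 : b != R -> update s2 b j v R 0 = s2 R 0.
      by move=> nb; rewrite updateE eq_sym (negPf nb).
    split=> [|j|j] /=.
    * by rewrite updateE !eqxx /= !hR // ?h1 ?addn1 // eq_sym.
    * rewrite !hR ?h1 // 1?eq_sym //.
      rewrite updateE (negPf neXR) /= updateE (negPf neX) /= updateE eqxx /= h2 h3 ltnn.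
      by rewrite ltnS; case: ltngtP => // ->.
    * rewrite !hR ?h1 // 1?eq_sym //.
      rewrite updateE (negPf n1R) /= updateE eqxx /= updateE (negPf n1X) /= h3.
      by rewrite ltnS; case: ltngtP.
- by move=> s1 [h1 h2 h3]; rewrite /= h1 h3 ltnn tape_ge.
- split=> [|j|j]; first by rewrite updateE !eqxx.
    by rewrite updateE (negPf neXR) /= eX.
  by rewrite updateE (negPf n1R) /= e1.
exists (1 + n), s'; split=> //.
- by apply: ExecSeq ex; apply: ExecStore.
- lia.
- by move=> j; rewrite h2; case: ltnP => // /tape_ge.
- by move=> j; rewrite h3; case: ltnP => // /tape_ge.
Qed.

Variables tl tF : tm.

(** On a tape, 2 is the bit true and 1 the bit false that ends a unary number. *)
Definition print_number : prog :=
  Seq (While (rg 4) (Seq (Store 1 (rg 3) (Const 2))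
       (Seq (st 3 (Add (rg 3) (Const 1))) (st 4 (Sub (rg 4) (Const 1))))))
  (Seq (Store 1 (rg 3) (Const 1)) (st 3 (Add (rg 3) (Const 1)))).

Lemma update_bank1 s i v b j : b != 1 -> update s 1 i v b j = s b j.
Proof. by move=> nb; rewrite updateE (negPf nb). Qed.

Lemma update_bankR s i v b j : b != R -> update s R i v b j = s b j.
Proof. by move=> nb; rewrite updateE (negPf nb). Qed.

Lemma print_numberP y s : s 1 =1 tape y -> s R 3 = size y ->
  exists n s', let z := y ++ rcons (nseq (s R 4) true) false in
   [/\ exec print_number s n s', n <= 4 * (s R 4) + 4, s' 1 =1 tape z
   & s' R 3 = size z] /\
   [/\ forall j, j < 3 -> s' R j = s R j & s' X =1 s X].
Proof.
move=> e1 e3; set v := s R 4.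
have n1R : 1 != R by rewrite eq_sym.
pose I i (s' : state) := [/\ s' R 4 = v - i, s' 1 =1 tape (y ++ nseq i true),
  s' R 3 = size (y ++ nseq i true), forall j, j < 3 -> s' R j = s R j & s' X =1 s X].
have [|||n [s' [ex le [h1 h2 h3 h4 h5]]]] := @exec_while I (rg 4)
   (Seq (Store 1 (rg 3) (Const 2))
       (Seq (st 3 (Add (rg 3) (Const 1))) (st 4 (Sub (rg 4) (Const 1))))) v 3 s.
- move=> i s1 lt [h1 h2 h3 h4 h5]; split; first by rewrite /= h1; lia.
  eexists _, _; split.
  + apply: ExecSeq; first exact: ExecStore.
    by apply: ExecSeq; first exact: exec_setr; exact: exec_setr.
  + by [].
  + rewrite /I; have -> : y ++ nseq i.+1 true = rcons (y ++ nseq i true) true.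
      by rewrite -addn1 nseqD -cats1 catA.
    split=> [|j||j lj|j].
    * by rewrite /= !updateE !eqxx /= (negPf neR) /= h1; lia.
    * rewrite /= !update_bankR // updateE eqxx /= tape_rcons h3.
      by case: eqP => // _; rewrite h2.
    * by rewrite size_rcons /= !updateE !eqxx /= (negPf neR) /= h3 addn1.
    * rewrite update_reg ifF; last lia.
      rewrite update_reg ifF; last lia.
      by rewrite update_bank1 ?h4.
    * by rewrite !update_bankR // update_bank1.
- by move=> s1 [h1 _ _ _ _]; rewrite /= h1 subnn.
- by split; rewrite ?cats0 ?subn0.
eexists _, _ => /=; split; first split.
- apply: ExecSeq; first exact: ex.
  by apply: ExecSeq; first exact: ExecStore; exact: exec_setr.
- by rewrite -/v; lia.
- move=> j; rewrite update_bankR // updateE eqxx /= -cats1 catA cats1 tape_rcons h3 -/v.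
  by case: eqP => // _; rewrite h2.
- by rewrite update_reg eqxx /= updateE (negPf neR) /= h3 -cats1 catA cats1 size_rcons addn1.
- split=> [j lj|j].
    by rewrite update_reg ifF ?update_bank1 ?h4 //; lia.
  by rewrite update_bankR // update_bank1.
Qed.

(* Cell 1 holds the number of entries, 2 the current one, 3 the output position
   and 4 the entry being printed. *)
Definition emit : prog :=
  Seq fetch_input (Seq (compile X R tl [::] 1) (Seq (st 2 (Const 0)) (Seq (st 3 (Const 0))
    (While (Sub (rg 1) (rg 2))
       (Seq (compile X R tF [:: 2] 4) (Seq print_number (st 2 (Add (rg 2) (Const 1))))))))).

Lemma code_rcons l v : code (rcons l v) = code l ++ rcons (nseq v true) false.
Proof. by rewrite /code map_rcons flatten_rcons. Qed.

Lemma emitP : exists c, forall x s, s 1 =1 tape x -> s X =1 (fun=> 0) ->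
  exists n s', [/\ exec emit s n s', n <= (size x).+2 ^ c
   & s' 1 =1 tape (code (mkseq (fun i => teval x [:: i] tF) (teval x [::] tl)))].
Proof.
have [c1 [c10 cl]] := compile_correct neXR tl.
have [c2 [c20 cF]] := compile_correct neXR tF.
have n1R : 1 != R by rewrite eq_sym.
exists (c1 + c1 * c2 + c1 + 7) => x s e1 eX; set N := (size x).+2.
have N1 : 1 < N by [].
have Q2 := exp_gt1 N1 c10.
have NQ : N <= N ^ c1 by apply: leq_exp_id.
have [n1 [s1 [ex1 le1 X1 O1 R1]]] := fetch_inputP e1 eX.
have rd1 : ready X R x [::] 1 s1 by split.
have [|//|vl [n2 [s2 [ex2 le2 v2 p2]]]] := cl _ _ _ _ N rd1 N1; first by rewrite /N; lia.
rewrite /= in vl v2; set L := teval x [::] tl in vl v2 *.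
set s3 := update s2 R 2 0; set s4 := update s3 R 3 0.
pose F i := teval x [:: i] tF; set Q := N ^ c1 in Q2 NQ vl le2.
pose I i (s' : state) := [/\ s' R 0 = size x, s' R 1 = L, s' R 2 = i
  & s' X =1 tape x] /\ [/\ s' 1 =1 tape (code (mkseq F i)) & s' R 3 = size (code (mkseq F i))].
have [|||n [s' [ex le [_ [h _]]]]] := @exec_while I (Sub (rg 1) (rg 2))
       (Seq (compile X R tF [:: 2] 4) (Seq print_number (st 2 (Add (rg 2) (Const 1)))))
       L (Q ^ c2 + (4 * Q ^ c2 + 4) + 1) s4.
- move=> i s5 lt [[h0 h1 h2 hX] [h3 h4]]; split; first by rewrite /= h1 h2; lia.
  have rd5 : ready X R x [:: 2] 4 s5 by split.
  have [|/=|vF [n6 [s6 [ex6 le6 v6 p6]]]] := cF _ _ _ _ Q rd5 Q2; first by rewrite /N in NQ; lia.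
    by rewrite h2 andbT; lia.
  rewrite /= h2 in vF v6.
  have [|| n7 [s7 /= [[ex7 le7 h7 h7'] [r7 x7]]]] := @print_numberP (code (mkseq F i)) s6.
  + by move=> j; rewrite (p6.2 1).
  + by rewrite (p6.1 3).
  rewrite v6 -/(F i) in le7 h7 h7'.
  rewrite -/(F i) in vF.
  eexists _, _; split.
  + apply: ExecSeq ex6 _; apply: ExecSeq ex7 _; exact: exec_setr.
  + lia.
  + split; last first.
      rewrite mkseqS code_rcons; split=> [j|]; first by rewrite update_bankR.
      by rewrite update_reg.
    split.
    * by rewrite update_reg /= r7 // (p6.1 0).
    * by rewrite update_reg /= r7 // (p6.1 1).
    * by rewrite update_reg /= r7 // (p6.1 2) // h2 addn1.
    * by move=> j; rewrite update_bankR // x7 (p6.2 X).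
- by move=> s5 [[_ h1 h2 _] _]; rewrite /= h1 h2 subnn.
- split; split=> //.
  + by rewrite /s4 /s3 !update_reg /= (p2.1 0).
  + by rewrite /s4 /s3 !update_reg.
  + by rewrite /s4 /s3 !update_reg.
  + by move=> j; rewrite /s4 /s3 !update_bankR // (p2.2 X).
  + by move=> j; rewrite /s4 /s3 !update_bankR // (p2.2 1) // O1 /tape nth_nil.
  + by rewrite /s4 update_reg.
exists (n1 + (n2 + (1 + (1 + n)))), s'; split=> //.
  apply: ExecSeq ex1 _; apply: ExecSeq ex2 _.
  apply: (ExecSeq (s' := s3)); first exact: exec_setr.
  by apply: (ExecSeq (s' := s4)); first exact: exec_setr.
have QC := exp_gt1 Q2 c20.
have nle : n <= (Q * (5 * Q ^ c2 + 6)).+1.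
  by apply: leq_trans le _; rewrite ltnS leq_mul //; lia.
rewrite (expnD N (_ + c1)) !(expnD N) !expnM -/Q.
(* [N ^ 7] is at least [2 ^ 7], which pays for all constants. *)
apply: leq_trans (_ : Q * Q ^ c2 * Q * 2 ^ 7 <= _); last first.
  by rewrite leq_mul2l leq_exp2r // orbT.
rewrite (_ : 2 ^ 7 = 128) //.
have NQ' : size x + 2 <= Q by rewrite /N in NQ; lia.
move: (Q ^ c2) QC nle => P QC nle; nia.
Qed.

End Emit.

Lemma computable_comp f F : computable f -> definable F ->
  computable (fun k => F [::] [:: f k]).
Proof.
(* Banks from [bank_bound p] on are blank after [p]; adding 2 also keeps clear of the input and
   output banks. *)
move=> [p hp] [t ht]; set X := (bank_bound p).+2; set R := X.+1.
have neXR : X != R by rewrite /R; lia.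
exists (Seq p (Seq (setr R 0 (Const 0)) (Seq (setr R 1 (Fetch 1 (Const 0)))
   (Seq (compile X R t [:: 1] 2) (Store 1 (Const 0) (reg R 2)))))) => k.
have [n [s [ex es]]] := hp k.
have [c [c0 ct]] := compile_correct neXR t.
have eX : s X =1 tape [::].
  by move=> i; rewrite (exec_bank_bound ex) ?/X //; [rewrite /tape nth_nil | lia].
set s1 := update s R 0 0; set s2 := update s1 R 1 (f k).
have rd : ready X R [::] [:: 1] 2 s2.
  split=> [j||//|//]; last by rewrite /s2 /s1 !update_reg.
  by rewrite /s2 /s1 !update_bankR.
have [|||_ [n3 [s3 [ex3 _ v3 p3]]]] := ct _ _ _ _ (f k).+2 rd => //.
  by rewrite /= andbT /s2 updateE !eqxx /=; lia.
eexists _, _; split.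
  apply: ExecSeq ex _; apply: (ExecSeq (s' := s1)); first exact: exec_setr.
  apply: (ExecSeq (s' := s2)).
    by rewrite /s2 -es -[s 1 0]/(eval s1 (Fetch 1 (Const 0))); exact: exec_setr.
  by apply: ExecSeq ex3 _; exact: ExecStore.
by rewrite updateE eqxx /= v3 -ht /= /s2 updateE !eqxx.
Qed.

(** * Definable functions *)

Lemma definable_ext f g : (forall x e, f x e = g x e) -> definable f -> definable g.
Proof. by move=> h [t ht]; exists t => x e; rewrite ht. Qed.

Lemma definable_var n : definable (fun x e => nth 0 e n).
Proof. by exists (TVar n). Qed.

Lemma definable_const n : definable (fun x e => n).
Proof. by exists (TConst n). Qed.

Lemma definable_size : definable (fun x e => size x).
Proof. by exists TLen. Qed.

Lemma definable_bit f : definable f -> definable (fun x e => nth false x (f x e)).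
Proof. by move=> [t ht]; exists (TBit t) => x e /=; rewrite ht. Qed.

Lemma definable_add f g :
  definable f -> definable g -> definable (fun x e => f x e + g x e).
Proof. by move=> [t ht] [u hu]; exists (TAdd t u) => x e /=; rewrite ht hu. Qed.

Lemma definable_sub f g :
  definable f -> definable g -> definable (fun x e => f x e - g x e).
Proof. by move=> [t ht] [u hu]; exists (TSub t u) => x e /=; rewrite ht hu. Qed.

Lemma definable_behead f : definable f -> definable (fun x e => f x (behead e)).
Proof. by move=> [t ht]; exists (TWeak t) => x e /=; rewrite ht. Qed.

Lemma definable_let f g :
  definable f -> definable g -> definable (fun x e => f x (g x e :: e)).
Proof. by move=> [t ht] [u hu]; exists (TLet u t) => x e /=; rewrite ht hu. Qed.

Lemma eq_bsum n F G : (forall i, i < n -> F i = G i) -> bsum n F = bsum n G.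
Proof. by move=> h; apply: eq_big_nat. Qed.

Lemma bsumS n F : bsum n.+1 F = bsum n F + F n.
Proof. by rewrite /bsum big_nat_recr. Qed.

Lemma bsum0 F : bsum 0 F = 0.
Proof. by rewrite /bsum big_geq. Qed.

(** The index of summation is the head of the environment in which the body is evaluated. *)
Lemma definable_bsum f g : definable f ->
  definable (fun x e => g x (behead e) (head 0 e)) ->
  definable (fun x e => bsum (f x e) (g x e)).
Proof.
move=> [t ht] [u hu]; exists (TSum t u) => x e /=; rewrite ht.
by apply: eq_bsum => i _; rewrite hu.
Qed.

Lemma definable_lrec b n a f : definable b -> definable n -> definable a ->
  definable (fun x e => f x (behead (behead e)) (head 0 e) (head 0 (behead e))) ->
  definable (fun x e => lrec (b x e) (n x e) (a x e) (f x e)).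
Proof.
move=> [tb hb] [tn hn] [ta ha] [tf hf]; exists (TRec tb tn ta tf) => x e /=.
rewrite hb hn ha /lrec; elim: (n x e) => //= m ->.
by rewrite hf.
Qed.

Lemma definable_app1 (F : seq bool -> nat -> nat) f :
  definable (fun x e => F x (nth 0 e 0)) ->
  definable f -> definable (fun x e => F x (f x e)).
Proof. by move=> hF hf; apply: definable_ext (definable_let hF hf). Qed.

Lemma definable_app2 (F : seq bool -> nat -> nat -> nat) f g :
  definable (fun x e => F x (nth 0 e 0) (nth 0 e 1)) ->
  definable f -> definable g -> definable (fun x e => F x (f x e) (g x e)).
Proof.
move=> hF hf hg.
by apply: definable_ext (definable_let (definable_let hF (definable_behead hf)) hg).
Qed.

Lemma definable_app3 (F : seq bool -> nat -> nat -> nat -> nat) f g h :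
  definable (fun x e => F x (nth 0 e 0) (nth 0 e 1) (nth 0 e 2)) ->
  definable f -> definable g -> definable h ->
  definable (fun x e => F x (f x e) (g x e) (h x e)).
Proof.
move=> hF hf hg hh.
by apply: definable_ext (definable_let (definable_let (definable_let hF
  (definable_behead (definable_behead hf))) (definable_behead hg)) hh).
Qed.

Lemma definable_app4 (F : seq bool -> nat -> nat -> nat -> nat -> nat) f g h k :
  definable (fun x e => F x (nth 0 e 0) (nth 0 e 1) (nth 0 e 2) (nth 0 e 3)) ->
  definable f -> definable g -> definable h -> definable k ->
  definable (fun x e => F x (f x e) (g x e) (h x e) (k x e)).
Proof.
move=> hF hf hg hh hk.
by apply: definable_ext (definable_let (definable_let (definable_let (definable_let hF
  (definable_behead (definable_behead (definable_behead hf))))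
  (definable_behead (definable_behead hg))) (definable_behead hh)) hk).
Qed.

Lemma definable_mul f g :
  definable f -> definable g -> definable (fun x e => f x e * g x e).
Proof.
move=> hf hg; have h := @definable_bsum f (fun x e _ => g x e) hf (definable_behead hg).
by apply: definable_ext h => x e; rewrite /bsum sum_nat_const_nat subn0.
Qed.

(** The exponent has to be a constant, because values of terms are polynomially bounded. *)
Lemma definable_exp f c : definable f -> definable (fun x e => f x e ^ c).
Proof.
move=> hf; elim: c => [|c IH]; first exact: definable_const 1.
by apply: definable_ext (definable_mul hf IH) => x e; rewrite expnS.
Qed.

Lemma definable_succ f : definable f -> definable (fun x e => (f x e).+1).
Proof. by move=> hf; apply: definable_ext (definable_add (definable_const 1) hf). Qed.

Lemma definable_pred f : definable f -> definable (fun x e => (f x e).-1).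
Proof.
by move=> hf; apply: definable_ext (definable_sub hf (definable_const 1)) => x e; rewrite subn1.
Qed.

Lemma definable_double f : definable f -> definable (fun x e => (f x e).*2).
Proof.
by move=> hf; apply: definable_ext (definable_add hf hf) => x e; rewrite addnn.
Qed.

Lemma definable_negb (P : seq bool -> seq nat -> bool) :
  definable (fun x e => P x e) -> definable (fun x e => ~~ P x e).
Proof.
move=> hP; apply: definable_ext (definable_sub (definable_const 1) hP) => x e.
by case: (P x e).
Qed.

Lemma definable_andb (P Q : seq bool -> seq nat -> bool) :
  definable (fun x e => P x e) -> definable (fun x e => Q x e) ->
  definable (fun x e => P x e && Q x e).
Proof.
move=> hP hQ; apply: definable_ext (definable_mul hP hQ) => x e.
by case: (P x e) (Q x e) => [] [].
Qed.

Lemma definable_orb (P Q : seq bool -> seq nat -> bool) :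
  definable (fun x e => P x e) -> definable (fun x e => Q x e) ->
  definable (fun x e => P x e || Q x e).
Proof.
move=> hP hQ; apply: definable_ext (definable_negb (definable_andb (definable_negb hP)
  (definable_negb hQ))) => x e.
by case: (P x e) (Q x e) => [] [].
Qed.

Lemma definable_implb (P Q : seq bool -> seq nat -> bool) :
  definable (fun x e => P x e) -> definable (fun x e => Q x e) ->
  definable (fun x e => P x e ==> Q x e).
Proof.
move=> hP hQ; apply: definable_ext (definable_orb (definable_negb hP) hQ) => x e.
by case: (P x e) (Q x e) => [] [].
Qed.

Lemma definable_leq f g :
  definable f -> definable g -> definable (fun x e => f x e <= g x e).
Proof.
move=> hf hg; apply: definable_ext (definable_sub (definable_const 1) (definable_sub hf hg)) => x e.
by rewrite /leq; case: (f x e - g x e).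
Qed.

Lemma definable_eq f g :
  definable f -> definable g -> definable (fun x e => f x e == g x e).
Proof.
move=> hf hg; apply: definable_ext (definable_andb (definable_leq hf hg)
  (definable_leq hg hf)) => x e.
by rewrite eqn_leq.
Qed.

Lemma definable_eqb (P Q : seq bool -> seq nat -> bool) :
  definable (fun x e => P x e) -> definable (fun x e => Q x e) ->
  definable (fun x e => P x e == Q x e).
Proof.
move=> hP hQ; apply: definable_ext (definable_eq hP hQ) => x e.
by case: (P x e) (Q x e) => [] [].
Qed.

(** Naming the conditional gives the tactic [dfn] a head symbol to recognise. *)
Definition ifn (b : bool) (m n : nat) : nat := if b then m else n.

Lemma definable_if (P : seq bool -> seq nat -> bool) f g :
  definable (fun x e => P x e) -> definable f -> definable g ->
  definable (fun x e => ifn (P x e) (f x e) (g x e)).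
Proof.
move=> hP hf hg; apply: definable_ext (definable_add (definable_mul hP hf)
  (definable_mul (definable_negb hP) hg)) => x e.
by rewrite /ifn; case: (P x e); rewrite /= ?mul1n ?mul0n ?addn0.
Qed.

Definition ball (n : nat) (P : nat -> bool) : bool := all P (iota 0 n).
Definition bex (n : nat) (P : nat -> bool) : bool := has P (iota 0 n).

Lemma ballP n (P : nat -> bool) : reflect (forall i, i < n -> P i) (ball n P).
Proof.
apply: (iffP allP) => h i; first by move=> lt; apply: h; rewrite mem_iota.
by rewrite mem_iota => /h.
Qed.

Lemma bexP n (P : nat -> bool) : reflect (exists2 i, i < n & P i) (bex n P).
Proof.
apply: (iffP hasP) => [] [i]; rewrite ?mem_iota; first by exists i.
by exists i; rewrite ?mem_iota.
Qed.

Lemma definable_ball f (P : seq bool -> seq nat -> nat -> bool) : definable f ->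
  definable (fun x e => P x (behead e) (head 0 e)) ->
  definable (fun x e => ball (f x e) (P x e)).
Proof.
move=> hf hP.
apply: definable_ext (definable_eq (@definable_bsum _ (fun x e i => ~~ P x e i) hf
  (definable_negb hP)) (definable_const 0)) => x e.
rewrite /bsum sum_nat_seq_eq0 /ball /index_iota subn0; congr nat_of_bool.
by apply: eq_all => i /=; case: (P x e i).
Qed.

Lemma definable_bex f (P : seq bool -> seq nat -> nat -> bool) : definable f ->
  definable (fun x e => P x (behead e) (head 0 e)) ->
  definable (fun x e => bex (f x e) (P x e)).
Proof.
move=> hf hP.
apply: definable_ext (definable_negb (@definable_ball _ (fun x e i => ~~ P x e i) hf
  (definable_negb hP))) => x e.
by rewrite /ball /bex -has_predC; congr nat_of_bool; apply: eq_has => i /=; rewrite negbK.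
Qed.

Lemma bsum_lt n c : bsum n (fun q => q < c) = minn n c.
Proof.
elim: n => [|n IH]; first by rewrite bsum0 min0n.
by rewrite bsumS IH; case: (ltnP n c); lia.
Qed.

(** The quotient counts the [q] for which [q.+1] copies of the divisor still fit; the guard handles
    division by zero. *)
Lemma definable_div f g :
  definable f -> definable g -> definable (fun x e => f x e %/ g x e).
Proof.
move=> hf hg.
have h : definable (fun x e => bsum (f x e) (fun q => (0 < g x e) && (q.+1 * g x e <= f x e))).
  apply: (@definable_bsum _ (fun x e q => _) hf); apply: definable_andb.
    exact: definable_leq (definable_const 1) (definable_behead hg).
  apply: (definable_leq _ (definable_behead hf)).
  apply: (definable_mul _ (definable_behead hg)); apply: definable_succ.
  by apply: definable_ext (definable_var 0) => x e; rewrite nth0.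
apply: definable_ext h => x e; set a := f x e; set b := g x e.
have [->|b0] := posnP b.
  by rewrite divn0 /bsum big1.
under eq_bsum => q _ do rewrite -leq_divRL //.
by rewrite bsum_lt; apply/minn_idPr/leq_div.
Qed.

Lemma definable_mod f g :
  definable f -> definable g -> definable (fun x e => f x e %% g x e).
Proof.
move=> hf hg; apply: definable_ext (definable_sub hf (definable_mul (definable_div hf hg) hg)).
by move=> x e; rewrite {1}(divn_eq (f x e) (g x e)) addKn.
Qed.

Create HintDb dfn.

(* Works on the syntax of the body: unification would unfold defined functions. *)
Ltac dfn :=
  first [exact (definable_const _) |
  lazymatch goal with
  | |- definable (fun x e => nth 0 _ _) =>
      refine (definable_ext _ (definable_var _)); intros;
      rewrite ?nth_behead; reflexivity
  | |- definable (fun x e => head 0 _) =>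
      refine (definable_ext _ (definable_var _)); intros;
      rewrite -nth0 ?nth_behead; reflexivity
  | |- definable (fun x e => size x) => exact definable_size
  | |- definable (fun x e => nat_of_bool (nth false x (@?f x e))) =>
      apply (definable_bit (f := f)); dfn
  | |- definable (fun x e => addn (@?f x e) (@?g x e)) =>
      apply (definable_add (f := f) (g := g)); dfn
  | |- definable (fun x e => subn (@?f x e) (@?g x e)) =>
      apply (definable_sub (f := f) (g := g)); dfn
  | |- definable (fun x e => muln (@?f x e) (@?g x e)) =>
      apply (definable_mul (f := f) (g := g)); dfn
  | |- definable (fun x e => divn (@?f x e) (@?g x e)) =>
      apply (definable_div (f := f) (g := g)); dfn
  | |- definable (fun x e => modn (@?f x e) (@?g x e)) =>
      apply (definable_mod (f := f) (g := g)); dfn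
  | |- definable (fun x e => expn (@?f x e) ?c) =>
      apply (definable_exp c (f := f)); dfn
  | |- definable (fun x e => S (@?f x e)) => apply (definable_succ (f := f)); dfn
  | |- definable (fun x e => double (@?f x e)) => apply (definable_double (f := f)); dfn
  | |- definable (fun x e => predn (@?f x e)) => apply (definable_pred (f := f)); dfn
  | |- definable (fun x e => bsum (@?f x e) (@?g x e)) =>
      apply (definable_bsum (f := f) (g := g)); cbv beta; dfn
  | |- definable (fun x e => lrec (@?b x e) (@?n x e) (@?a x e) (@?f x e)) =>
      apply (definable_lrec (b := b) (n := n) (a := a) (f := f)); cbv beta; dfn
  | |- definable (fun x e => nat_of_bool (ball (@?f x e) (@?g x e))) =>
      apply (definable_ball (f := f) (P := g)); cbv beta; dfn
  | |- definable (fun x e => nat_of_bool (bex (@?f x e) (@?g x e))) =>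
      apply (definable_bex (f := f) (P := g)); cbv beta; dfn
  | |- definable (fun x e => nat_of_bool (andb (@?f x e) (@?g x e))) =>
      apply (definable_andb (P := f) (Q := g)); dfn
  | |- definable (fun x e => nat_of_bool (orb (@?f x e) (@?g x e))) =>
      apply (definable_orb (P := f) (Q := g)); dfn
  | |- definable (fun x e => nat_of_bool (implb (@?f x e) (@?g x e))) =>
      apply (definable_implb (P := f) (Q := g)); dfn
  | |- definable (fun x e => nat_of_bool (negb (@?f x e))) =>
      apply (definable_negb (P := f)); dfn
  | |- definable (fun x e => nat_of_bool (leq (@?f x e) (@?g x e))) =>
      apply (definable_leq (f := f) (g := g)); dfn
  | |- definable (fun x e => nat_of_bool (@eq_op _ (@?f x e) (@?g x e))) =>
      first [apply (definable_eq (f := f) (g := g)) | apply (definable_eqb (P := f) (Q := g))]; dfn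
  | |- definable (fun x e => ifn (@?P x e) (@?f x e) (@?g x e)) =>
      apply (definable_if (P := P) (f := f) (g := g)); dfn
  | |- definable (fun x e => nat_of_bool (?F x (@?a x e) (@?b x e) (@?c x e) (@?d x e))) =>
      apply (definable_app4 (F := fun x i j k l => nat_of_bool (F x i j k l)) (f := a) (g := b) (h := c) (k := d));
      [solve [auto with dfn nocore] | dfn | dfn | dfn | dfn]
  | |- definable (fun x e => nat_of_bool (?F x (@?a x e) (@?b x e) (@?c x e))) =>
      apply (definable_app3 (F := fun x i j k => nat_of_bool (F x i j k)) (f := a) (g := b) (h := c));
      [solve [auto with dfn nocore] | dfn | dfn | dfn]
  | |- definable (fun x e => nat_of_bool (?F x (@?a x e) (@?b x e))) =>
      apply (definable_app2 (F := fun x i j => nat_of_bool (F x i j)) (f := a) (g := b));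
      [solve [auto with dfn nocore] | dfn | dfn]
  | |- definable (fun x e => nat_of_bool (?F x (@?a x e))) =>
      apply (definable_app1 (F := fun x i => nat_of_bool (F x i)) (f := a));
      [solve [auto with dfn nocore] | dfn]
  | |- definable (fun x e => ?F x (@?a x e) (@?b x e) (@?c x e) (@?d x e)) =>
      apply (definable_app4 (F := F) (f := a) (g := b) (h := c) (k := d));
      [solve [auto with dfn nocore] | dfn | dfn | dfn | dfn]
  | |- definable (fun x e => ?F x (@?a x e) (@?b x e) (@?c x e)) =>
      apply (definable_app3 (F := F) (f := a) (g := b) (h := c));
      [solve [auto with dfn nocore] | dfn | dfn | dfn]
  | |- definable (fun x e => ?F x (@?a x e) (@?b x e)) =>
      apply (definable_app2 (F := F) (f := a) (g := b));
      [solve [auto with dfn nocore] | dfn | dfn]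
  | |- definable (fun x e => ?F x (@?a x e)) =>
      apply (definable_app1 (F := F) (f := a)); [solve [auto with dfn nocore] | dfn]
  | _ => solve [auto with dfn nocore]
  end].

(** * Reading lists of numbers from their unary code *)

Definition zeros (x : seq bool) (j : nat) : nat := bsum j (fun i => ~~ nth false x i).
(** In unary code, the ones of entry [i] are those with exactly [i] terminating zeros before
    them. *)
Definition num (x : seq bool) (i : nat) : nat :=
  bsum (size x) (fun j => nth false x j && (zeros x j == i)).
Definition count_nums (x : seq bool) : nat := zeros x (size x).

Lemma definable_zeros : definable (fun x e => zeros x (nth 0 e 0)).
Proof. rewrite /zeros; dfn. Qed.
#[global] Hint Resolve definable_zeros : dfn.

Lemma definable_num : definable (fun x e => num x (nth 0 e 0)).
Proof. rewrite /num; dfn. Qed.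
#[global] Hint Resolve definable_num : dfn.

Lemma definable_count_nums : definable (fun x e => count_nums x).
Proof. rewrite /count_nums; dfn. Qed.
#[global] Hint Resolve definable_count_nums : dfn.

Lemma bsum_add a b F : bsum (a + b) F = bsum a F + bsum b (fun i => F (a + i)).
Proof. by elim: b => [|b IH]; rewrite ?bsum0 ?addn0 // addnS !bsumS IH addnA. Qed.

Lemma nth_code_cons n s i : nth false (code (n :: s)) i =
    if i < n then true else if i == n then false else nth false (code s) (i - n.+1).
Proof.
rewrite /code /= cat_rcons nth_cat size_nseq nth_nseq.
case: ltngtP => [lt|lt|->]; rewrite ?subnn //.
by rewrite (_ : i - n = (i - n.+1).+1) //; lia.
Qed.

Lemma zeros_code_cons n s j : zeros (code (n :: s)) j =
  if j <= n then 0 else (zeros (code s) (j - n.+1)).+1.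
Proof.
have E := nth_code_cons n s.
have Z i : i <= n -> zeros (code (n :: s)) i = 0.
  move=> le; rewrite /zeros /bsum big_nat big1 // => q /andP[_ lt].
  by rewrite E (leq_trans lt).
case: leqP => [/Z//|lt].
rewrite -{1}(subnKC lt) /zeros bsum_add bsumS.
have /= := Z n (leqnn n); rewrite /zeros => ->.
rewrite E ltnn eqxx /= add0n add1n; congr S.
apply: eq_bsum => i _; rewrite E ifF; last lia.
rewrite ifF; last lia.
by congr (~~ nth _ _ _ : nat); lia.
Qed.

Lemma size_code_cons n s : size (code (n :: s)) = n.+1 + size (code s).
Proof. by rewrite /code /= size_cat size_rcons size_nseq. Qed.

Lemma count_nums_code s : count_nums (code s) = size s.
Proof.
rewrite /count_nums; elim: s => [|n s IH]; first by rewrite /zeros bsum0.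
rewrite size_code_cons zeros_code_cons ifF; last lia.
by rewrite addKn IH.
Qed.

Lemma num_code s i : num (code s) i = nth 0 s i.
Proof.
rewrite /num; elim: s i => [|n s IH] i; first by rewrite bsum0 nth_nil.
rewrite size_code_cons bsum_add bsumS.
rewrite [X in _ + X + _](_ : _ = 0); last by rewrite nth_code_cons ltnn eqxx.
rewrite addn0 (_ : bsum n _ = if i == 0 then n else 0); last first.
  transitivity (bsum n (fun=> i == 0)).
    apply: eq_bsum => j lt; rewrite nth_code_cons lt zeros_code_cons (ltnW lt) /=.
    by rewrite eq_sym.
  by rewrite /bsum sum_nat_const_nat subn0; case: eqP; lia.
case: i => [|i] /=.
  rewrite /bsum big1 ?addn0 // => j _.
  rewrite zeros_code_cons ifF ?andbF //; lia.
rewrite add0n -IH; apply: eq_bsum => j lt.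
rewrite nth_code_cons ifF; last lia.
rewrite ifF; last lia.
rewrite zeros_code_cons ifF; last lia.
by rewrite addKn.
Qed.

(** The programs are concatenated: [emit] reads the string that [p] left in bank 1 and prints the
    new instance entry by entry. That string is no longer than the running time of [p], so a
    polynomial in its length is again an admissible bound. *)
Lemma fpt_reducible_trans_definable (P Q Q' : pproblem)
    (len F : seq bool -> seq nat -> nat) (G : nat -> nat) :
  definable len -> definable F -> definable (fun x e => G (nth 0 e 0)) ->
  {homo G : i j / i <= j} ->
  (forall y : instance Q, exists z : instance Q',
    [/\ encode z = code (mkseq (fun i => F (encode y) [:: i]) (len (encode y) [::])),
        yes y <-> yes z & parameter z <= G (parameter y)]) ->
  fpt_reducible P Q -> fpt_reducible P Q'.
Proof.
move=> [tl hl] [tF hF] hG Gmono red [p [f [g [c [cf cg hp]]]]].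
set X := (bank_bound p).+2; set R := X.+1.
have neXR : X != R by rewrite /R; lia.
have neX : X != 1 by []. have neR : R != 1 by [].
have [a ha] := emitP neXR neX neR tl tF.
(* The total time is at most [n.+2 ^ a.+1], and [n.+2] is at most [(f k + 2) * s.+1 ^ c] for an
   input of size [s]. *)
exists (Seq p (emit X R tl tF)), (fun k => (f k + 2) ^ a.+1), (fun k => G (g k)), (c * a.+1).
split.
- have hd : definable (fun x e => (nth 0 e 0 + 2) ^ a.+1) by dfn.
  exact: (computable_comp cf hd).
- exact: (computable_comp cg hG).
move=> x; have [y [n [tr len_n yxy par]]] := hp x.
have [z [ez yyz parz]] := red y.
have sy := size_transforms tr.
have [s [ex es]] := tr.
have eX : s X =1 (fun=> 0).
  by move=> i; rewrite (exec_bank_bound ex) // /X; lia.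
have [m [s' [ex' le' es']]] := ha _ _ es eX.
exists z, (n + m); split.
- exists s'; split; first exact: ExecSeq ex ex'.
  move=> i; rewrite es' ez hl; congr (tape (code _) i).
  by apply: eq_mkseq => j; rewrite hF.
- have le1 : m <= n.+2 ^ a.
    by apply: leq_trans le' _; case: (a) => // b; rewrite leq_exp2r //; lia.
  have le2 : n + m <= n.+2 ^ a.+1.
    have : 0 < n.+2 ^ a by rewrite expn_gt0.
    by rewrite expnS; nia.
  apply: leq_trans le2 _; rewrite (expnM _ c) -expnMn leq_exp2r //.
  have : 0 < (size (encode x)).+1 ^ c by rewrite expn_gt0.
  by nia.
- by rewrite yxy.
- exact: leq_trans parz (Gmono _ _ par).
Qed.

(** * From bin packing to coalitions *)

Section PackingGraph.

Variables (B T M C : nat) (w p q : nat -> nat).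

(* Vertices below [B] are the bins.  Vertex [B + t * M + r] belongs to item [t] if
   [r < w t] and is isolated otherwise; [p t] and [q t] are the bins adjacent to
   item [t]. *)
Definition item (v : nat) : nat := (v - B) %/ M.
Definition slot (v : nat) : nat := (v - B) %% M.
Definition present (v : nat) : bool := (B <= v) && (slot v < w (item v)).
Definition mates (u v : nat) : bool := present u && (item u == item v).
Definition served (u v : nat) : bool :=
  (u < B) && ((p (item v) == u) || (q (item v) == u)).
(** Every edge is attached to its larger endpoint, which always belongs to an item since the bins
    have the smallest numbers. *)
Definition lower_adj (u v : nat) : bool :=
  [&& u < v, present v & served u v || mates u v].
Definition adj (u v : nat) : bool := lower_adj u v || lower_adj v u.

Local Notation n := (B + T * M).

Definition packing_edges : {set {set 'I_n}} :=
  [set [set z.1; z.2] | z : 'I_n * 'I_n & lower_adj z.1 z.2].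

Lemma lower_adj_lt u v : lower_adj u v -> u < v.
Proof. by case/and3P. Qed.

Lemma set2_lt_inj (u v u' v' : 'I_n) :
  u < v -> u' < v' -> [set u; v] = [set u'; v'] -> u = u' /\ v = v'.
Proof.
move=> lt lt' /setP e.
have := e u; have := e v; have := e u'; have := e v'; rewrite !inE !eqxx ?orbT /=.
move=> /orP[]/eqP e1 /orP[]/eqP e2; subst=> //; first [by rewrite ltnn in lt' | lia].
Qed.

Lemma mem_packing_edges (u v : 'I_n) : ([set u; v] \in packing_edges) = adj u v.
Proof.
apply/imsetP/idP => [[[a b] /= ] | ].
  rewrite inE /= => la /setP e.
  have lt := lower_adj_lt la.
  have := e a; have := e b; have := e u; have := e v; rewrite !inE !eqxx ?orbT /=.
  have ne : a != b by rewrite neq_ltn lt.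
  move=> /esym/orP[]/eqP -> /esym/orP[]/eqP -> /=; rewrite ?eqxx ?orbF ?orbb.
  - by rewrite eq_sym (negbTE ne).
  - by move=> _ _; rewrite /adj la orbT.
  - by move=> _ _; rewrite /adj la.
  - by rewrite (negbTE ne).
case/orP => la; first by exists (u, v); rewrite ?inE.
by exists (v, u); rewrite ?inE //= setUC.
Qed.

Lemma packing_edges_card2 : [forall e in packing_edges, #|e| == 2].
Proof.
apply/forall_inP => e /imsetP[[a b]]; rewrite inE /= => /lower_adj_lt lt ->.
by rewrite cards2 neq_ltn lt.
Qed.

Lemma present_twins (u v x : nat) : present u -> present v -> item u == item v ->
  (x == u) || adj u x -> (x == v) || adj v x.
Proof.
move=> pu pv eq /orP[/eqP->|].
  case: (ltngtP u v) => //= lt; rewrite /adj /lower_adj pu pv lt /mates pu pv (eqP eq) eqxx.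
    by rewrite !orbT.
  by rewrite !orbT.
have [Bu _] := andP pu; have [Bv _] := andP pv.
case/orP => /and3P[lt px].
  rewrite /served ltnNge Bu /= => /andP[_ e].
  case: (ltngtP x v) => //= lt'; rewrite /adj /lower_adj px pv lt' /mates px pv -(eqP eq) e.
    by rewrite (eqP e) eqxx !orbT.
  by rewrite !orbT.
case/orP => [/andP[xB h]|/andP[px' e]].
  by rewrite /adj /lower_adj pv (leq_trans xB Bv) /served xB -(eqP eq) h !orbT.
case: (ltngtP x v) => //= lt'; rewrite /adj /lower_adj px' pv lt' /mates px' pv -(eqP eq) e.
  by rewrite !orbT.
by rewrite (eqP e) eqxx !orbT.
Qed.

Lemma packing_twin_cover : twin_cover_number packing_edges <= B.
Proof.
rewrite /twin_cover_number; case: arg_minnP => [|S tS minS].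
  by apply/forallP => u; apply/forallP => v; rewrite inE /= implybT.
apply: leq_trans (minS [set v : 'I_n | v < B] _) _.
  apply/forallP => u; apply/forallP => v; apply/implyP.
  rewrite mem_packing_edges !inE => a.
  have [//|Bu] := ltnP u B; have [//|Bv] := ltnP v B; rewrite /=.
  have [pu pv e] : [/\ present u, present v & item u == item v].
    case/orP: a => /and3P[_ pr]; rewrite /served ltnNge ?Bu ?Bv /= => /andP[pr' e].
      by split.
    by split; rewrite // eq_sym.
  apply/eqP/setP => x; rewrite !inE !mem_packing_edges -!val_eqE /=.
  by apply/idP/idP; apply: present_twins; rewrite // eq_sym.
rewrite -sum1_card (eq_bigl (fun v : 'I_n => v < B)); last by move=> v; rewrite inE.
by rewrite big_ord_narrow ?leq_addr // sum1_card card_ord.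
Qed.

(** Each edge inside a block is counted at its larger endpoint. *)
Lemma partition_value_packing (P : {set {set 'I_n}}) : partition P [set: 'I_n] ->
  partition_value packing_edges P =
  \sum_(v < n) #|[set u : 'I_n | lower_adj u v & u \in pblock P v]|.
Proof.
case/and3P => /eqP covP tiP _.
rewrite (eq_bigl (fun v => v \in cover P)); last by move=> v; rewrite covP inE.
rewrite big_trivIset //; apply: eq_bigr => A PA.
pose Z := [set z : 'I_n * 'I_n | [&& lower_adj z.1 z.2, z.1 \in A & z.2 \in A]].
have -> : induced_edges packing_edges A = [set [set z.1; z.2] | z in Z].
  apply/setP => e; rewrite !inE; apply/andP/imsetP.
    case=> /imsetP[[a b]]; rewrite inE /= => la -> /subsetP sA.
    by exists (a, b); rewrite // inE la !sA ?set21 ?set22.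
  case=> [[a b]]; rewrite inE /= => /and3P[la aA bA] ->; split.
    by apply/imsetP; exists (a, b); rewrite ?inE.
  by apply/subsetP => x; rewrite !inE => /orP[]/eqP->.
rewrite card_in_imset; last first.
  move=> [a b] [a' b']; rewrite !inE /= => /and3P[la _ _] /and3P[la' _ _].
  by case/(set2_lt_inj (lower_adj_lt la) (lower_adj_lt la')) => -> ->.
rewrite -sum1_card (partition_big (fun z => z.2) (fun v => v \in A)) /=; last first.
  by move=> z; rewrite inE => /and3P[].
apply: eq_bigr => v vA.
rewrite (def_pblock tiP PA vA) -sum1_card.
rewrite (reindex_onto (fun u => (u, v)) (fun z => z.1)) /=; last first.
  by move=> [a b] /andP[_ /eqP <-].
by apply: eq_bigl => u; rewrite !inE /= vA !eqxx !andbT.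
Qed.

Hypothesis M_gt0 : 0 < M.
Hypothesis w_le : forall t, t < T -> w t <= M.
Hypotheses (p_lt : forall t, t < T -> p t < B) (q_lt : forall t, t < T -> q t < B).

Lemma item_lt v : v < n -> B <= v -> item v < T.
Proof. by move=> lt le; rewrite /item ltn_divLR //; lia. Qed.

Lemma item_slot v : B <= v -> v = B + item v * M + slot v.
Proof. by move=> le; rewrite -addnA -divn_eq subnKC. Qed.

Lemma item_vertex t r : r < M -> item (B + t * M + r) = t.
Proof. by move=> lt; rewrite /item -addnA addKn divnMDl // divn_small // addn0. Qed.

Lemma slot_vertex t r : r < M -> slot (B + t * M + r) = r.
Proof. by move=> lt; rewrite /slot -addnA addKn modnMDl modn_small. Qed.

Lemma sum_mul_nat a b (F : nat -> nat) :
  \sum_(0 <= i < a * b) F i = \sum_(0 <= i < a) \sum_(0 <= j < b) F (i * b + j).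
Proof.
elim: a => [|a IH]; first by rewrite mul0n !big_geq.
rewrite [RHS]big_nat_recr //= -IH mulSnr (big_cat_nat (n := a * b)) ?leq_addr //=.
by congr (_ + _); rewrite -{1}(add0n (a * b)) big_addn addKn; apply: eq_bigr => i _; rewrite addnC.
Qed.

Lemma sum_present (F : nat -> nat) :
  \sum_(v < n | present v) F v =
  \sum_(0 <= t < T) \sum_(0 <= r < w t) F (B + t * M + r).
Proof.
rewrite -(big_mkord present F) (big_cat_nat (n := B)) ?leq_addr //=.
rewrite big_nat_cond big1 ?add0n; last first.
  by move=> v /andP[lt /andP[le _]]; lia.
rewrite -{1}(add0n B) big_addn addKn big_mkcond sum_mul_nat.
apply: eq_big_nat => t ltT.
rewrite (big_cat_nat (n := w t)) ?w_le //=.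
rewrite [X in _ + X]big_nat [X in _ + X]big1 ?addn0; last first.
  move=> r /andP[le lt]; rewrite ifF // addnC addnA /present item_vertex // slot_vertex //.
  by rewrite ltnNge le andbF.
apply: eq_big_nat => r /andP[_ lt].
have ltM : r < M by apply: leq_trans lt (w_le ltT).
by rewrite addnC addnA ifT // /present item_vertex // slot_vertex // lt -addnA leq_addr.
Qed.

Lemma card_interval a b : b <= n -> #|[set u : 'I_n | a <= u < b]| = b - a.
Proof.
move=> le; rewrite -sum1_card (eq_bigl (fun v : 'I_n => (a <= v) && (v < b))); last by move=> v; rewrite inE.
rewrite -(big_mkord (fun v => (a <= v) && (v < b)) (fun=> 1)) -big_nat_widen //.
have [leab|/ltnW ltba] := leqP a b; last first.
  rewrite big_nat_cond big1 => [|i]; lia.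
rewrite (big_cat_nat (n := a)) //= big_nat_cond big1 ?add0n; last by move=> i; lia.
by rewrite big_nat_cond (eq_bigl (fun i => a <= i < b)) -?big_nat ?sum_nat_const_nat ?muln1 // => i; lia.
Qed.

Lemma mates_interval (u v : 'I_n) : present v ->
  ((u < v) && mates u v) = (v - slot v <= u < v).
Proof.
move=> pv; have [Bv sv] := andP pv; have ev := item_slot Bv.
have slM : slot v < M by rewrite ltn_mod.
have [lt|] := ltnP u v; rewrite /= ?andbF //= ?andbT.
apply/idP/idP => [/andP[/andP[Bu _] /eqP e]|le].
  by have := item_slot Bu; rewrite e; lia.
have eu : (u : nat) = B + item v * M + (u - (v - slot v)) by lia.
have ltM : u - (v - slot v) < M by lia.
rewrite /mates /present eu item_vertex // slot_vertex // eqxx andbT.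
by apply/andP; split; lia.
Qed.

Lemma card_lower_mates (v : 'I_n) : present v ->
  #|[set u : 'I_n | (u < v) && mates u v]| = slot v.
Proof.
move=> pv; have [Bv sv] := andP pv; have ev := item_slot Bv.
rewrite (_ : [set _ | _] = [set u : 'I_n | v - slot v <= u < v]).
  by rewrite card_interval; have := ltn_ord v; lia.
by apply/setP => u; rewrite !inE mates_interval.
Qed.

(** A vertex in slot [r] has [r] mates below it; the additional 1 stands for an edge to one bin. *)
Definition packing_target : nat := bsum T (fun t => bsum (w t) (fun r => r.+1)).

Lemma packing_targetE : packing_target = \sum_(v < n | present v) (slot v).+1.
Proof.
rewrite (sum_present (fun v => (slot v).+1)); apply: eq_big_nat => t lt.
apply: eq_big_nat => r /andP[_ ltr].
by rewrite slot_vertex //; apply: leq_trans ltr (w_le lt).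
Qed.

Definition dest (sg : nat -> bool) (t : nat) : nat := if sg t then p t else q t.

Definition load (sg : nat -> bool) (b : nat) : nat :=
  \sum_(0 <= t < T) (if dest sg t == b then w t else 0).

Lemma load_card sg b : load sg b = #|[set v : 'I_n | present v & dest sg (item v) == b]|.
Proof.
rewrite -sum1_card (eq_bigl (fun v : 'I_n => present v && (dest sg (item v) == b))); last first.
  by move=> v; rewrite inE.
rewrite big_mkcondr (sum_present (fun v => if dest sg (item v) == b then 1 else 0)).
apply: eq_big_nat => t lt.
transitivity (\sum_(0 <= r < w t) (dest sg t == b)).
  by rewrite sum_nat_const_nat subn0; case: eqP; lia.
apply: eq_big_nat => r /andP[_ ltr].
rewrite item_vertex; last by apply: leq_trans ltr (w_le lt).
by case: eqP.
Qed.

Lemma dest_lt sg t : t < T -> dest sg t < B.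
Proof. by move=> lt; rewrite /dest; case: (sg t); [apply: p_lt | apply: q_lt]. Qed.

Hypothesis C_gt0 : 0 < C.

(** The inequality is strict because the bin itself occupies one place of its coalition. *)
Lemma packing_partition sg : (forall b, b < B -> load sg b < C) ->
  exists2 P : {set {set 'I_n}}, capacity_partition C P
    & packing_target <= partition_value packing_edges P.
Proof.
move=> hl.
(* Blocks are the fibres of [f]: an item vertex is sent to its bin, while bins and isolated vertices
   represent themselves. *)
pose f (v : 'I_n) : nat := if (v < B) || ~~ present v then v : nat else dest sg (item v).
pose P := preim_partition f [set: 'I_n].
have partP : partition P [set: 'I_n] := preim_partitionP f _.
have inP u v : (v \in pblock P u) = (f u == f v).
  apply: (@pblock_equivalence_partition _ (fun a b => f a == f b)); rewrite ?inE //.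
  by move=> a b c _ _ _; split=> // /eqP->.
exists P.
  rewrite /capacity_partition partP; apply/forall_inP => A PA.
  have /set0Pn[v vA] : A != set0 by case/and3P: partP => _ _; apply: contraNN => /eqP <-.
  have -> : A = [set u | f v == f u].
    case/and3P: (partP) => _ tiP _.
    by apply/setP => u; rewrite inE -inP (def_pblock tiP PA vA).
  have [ltB|leB] := ltnP (f v) B.
    have ltn : f v < n by apply: leq_trans ltB (leq_addr _ _).
    apply: leq_trans (_ : #|Ordinal ltn |: [set u : 'I_n | present u & dest sg (item u) == f v]| <= _).
      apply/subset_leq_card/subsetP => u; rewrite !inE => /eqP e.
      move: e; rewrite {2}/f; case: ifP => [_ e|/negbT].
        by rewrite -val_eqE /= e eqxx.
      by rewrite negb_or negbK => /andP[_ ->] e; rewrite -e eqxx orbT.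
    rewrite cardsU1 -load_card; have := hl _ ltB; case: (_ \notin _) => /=; lia.
  apply: leq_trans (_ : #|[set v]| <= _); last by rewrite cards1.
  have fge u : B <= f u -> f u = u.
    rewrite /f; case: ifP => // /negbT; rewrite negb_or negbK => /andP[_ /andP[Bu _]].
    by rewrite leqNgt dest_lt // item_lt.
  apply/subset_leq_card/subsetP => u; rewrite !inE => /eqP e.
  by rewrite -val_eqE /= -(fge v) // e fge // -e.
rewrite partition_value_packing // packing_targetE big_mkcond /=.
apply: leq_sum => v _; case: ifP => // pv.
have [Bv _] := andP pv.
have fv : f v = dest sg (item v) by rewrite /f pv ltnNge Bv.
have ltB : dest sg (item v) < B by rewrite dest_lt // item_lt.
have ltn : dest sg (item v) < n by apply: leq_trans ltB (leq_addr _ _).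
(* The bin and the lower mates already make up the [(slot v).+1] edges credited to [v]. *)
apply: leq_trans (_ : #|Ordinal ltn |: [set u : 'I_n | (u < v) && mates u v]| <= _).
  rewrite cardsU1 card_lower_mates // inE /= /mates /present.
  by rewrite [B <= _]leqNgt ltB /= andbF.
apply/subset_leq_card/subsetP => u; rewrite !inE inP fv => /orP[/eqP->|/andP[lt m]].
  apply/andP; split.
    rewrite /lower_adj /= (leq_trans ltB Bv) pv /served ltB /=.
    by rewrite /dest; case: (sg _); rewrite eqxx ?orbT.
  by rewrite /f /= ltB.
rewrite /lower_adj lt pv m orbT /=; case/andP: m => pu /eqP e.
by have [Bu _] := andP pu; rewrite /f pu ltnNge Bu /= e.
Qed.


(** * From valuable partitions to assignments of items *)

Definition private_load (b : nat) : nat :=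
  \sum_(0 <= t < T) (if (p t == b) && (q t == b) then w t else 0).
Definition shared_weight : nat :=
  \sum_(0 <= t < T) (if p t != q t then w t else 0).

Lemma sum_present_items (f : nat -> bool) :
  \sum_(v < n | present v) f (item v) = \sum_(0 <= t < T) (if f t then w t else 0).
Proof.
rewrite (sum_present (fun v => f (item v))); apply: eq_big_nat => t lt.
transitivity (\sum_(0 <= r < w t) f t).
  apply: eq_big_nat => r /andP[_ ltr]; rewrite item_vertex //.
  exact: leq_trans ltr (w_le lt).
by rewrite sum_nat_const_nat subn0; case: (f t); rewrite ?muln1 ?muln0.
Qed.

Hypothesis private_large : forall b, b < B -> C + shared_weight <= 2 * private_load b.

Section FromPartition.

Variable P : {set {set 'I_n}}.
Hypothesis capP : capacity_partition C P.
Hypothesis valP : packing_target <= partition_value packing_edges P.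

Let partP : partition P [set: 'I_n]. Proof. by case/andP: capP. Qed.
Let tiP : trivIset P. Proof. by case/and3P: partP. Qed.
Let covP v : v \in cover P. Proof. by case/and3P: partP => /eqP-> _ _; rewrite inE. Qed.
Let block (v : 'I_n) := pblock P v.
Let in_block v : v \in block v. Proof. by rewrite mem_pblock. Qed.
Let same_block u v : u \in block v -> block u = block v.
Proof. by move=> h; apply: same_pblock. Qed.
Let card_block v : #|block v| <= C.
Proof. by case/andP: capP => _ /forall_inP; apply; apply: pblock_mem. Qed.

(** The value gained at [v] is split into edges to lower mates, [a v], and edges to bins, [b v]. *)
Let a (v : 'I_n) := #|[set u : 'I_n | (u < v) && mates u v & u \in block v]|.
Let b (v : 'I_n) := #|[set u : 'I_n | served u v & u \in block v]|.

Let a_le (v : 'I_n) : present v -> a v <= slot v.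
Proof.
move=> pv; rewrite -(card_lower_mates pv); apply/subset_leq_card/subsetP => u.
by rewrite !inE => /andP[].
Qed.

Let value_le :
  \sum_(v < n | present v) (slot v).+1 <= \sum_(v < n | present v) (a v + b v).
Proof.
rewrite -packing_targetE; apply: leq_trans valP _.
rewrite partition_value_packing // [X in _ <= X]big_mkcond /=.
apply: leq_sum => v _; case: ifP => pv; last first.
  by rewrite leqn0 cards_eq0; apply/eqP/setP => u; rewrite !inE /lower_adj pv andbF.
apply: leq_trans (leq_card_setU _ _); apply/subset_leq_card/subsetP => u.
rewrite !inE /lower_adj pv /= => /andP[/andP[lt]].
by rewrite lt => /orP[] -> -> /=; rewrite ?orbT.
Qed.

(** As [a v] cannot exceed [slot v], the target leaves at least one bin edge per vertex on
    average. *)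
Let count_le : \sum_(v < n | present v) 1 <= \sum_(v < n | present v) b v.
Proof.
have h : \sum_(v < n | present v) a v <= \sum_(v < n | present v) slot v.
  by apply: leq_sum => v; apply: a_le.
have e : \sum_(v < n | present v) (slot v).+1 =
    \sum_(v < n | present v) slot v + \sum_(v < n | present v) 1.
  by rewrite -big_split; apply: eq_bigr => v _; rewrite /= addn1.
have := value_le; rewrite e big_split /= => h'.
by rewrite -(leq_add2l (\sum_(v < n | present v) slot v)); apply: leq_trans h' _; rewrite leq_add2r.
Qed.

Let served_le (v : 'I_n) : present v -> b v <= 1 + (p (item v) != q (item v)).
Proof.
move=> pv; have [Bv _] := andP pv.
have it : item v < T by apply: item_lt.
have lp : p (item v) < n by apply: leq_trans (p_lt it) (leq_addr _ _).
have lq : q (item v) < n by apply: leq_trans (q_lt it) (leq_addr _ _).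
apply: leq_trans (_ : #|[set Ordinal lp; Ordinal lq]| <= _).
  apply/subset_leq_card/subsetP => u; rewrite !inE -!val_eqE /=.
  by rewrite ![(u : nat) == _]eq_sym => /andP[/andP[]].
by rewrite cards2 -val_eqE.
Qed.

(* Two bins in one block would leave most of their private items outside, which
   costs more than the doubly served shared items can gain. *)
Lemma separate_cores (u v : 'I_n) : u < B -> v < B -> v \in block u -> u = v.
Proof.
move=> uB vB vu; apply/eqP; apply: contraT => ne.
pose pr (t : nat) := (p t == q t) && ((p t == u) || (p t == v)).
have e1 : \sum_(x < n | present x) pr (item x) = private_load u + private_load v.
  rewrite sum_present_items -big_split /=; apply: eq_big_nat => t _; rewrite /pr.
  have [e|ne'] := eqVneq (p t) (q t); last first.
    have h (c : nat) : (p t == c) && (q t == c) = false.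
      by apply/negP => /andP[/eqP h1 /eqP h2]; rewrite h1 h2 eqxx in ne'.
    by rewrite !h.
  rewrite -e !andbb /=; have [e'|_] := eqVneq (p t) u; have [e''|_] := eqVneq (p t) v; rewrite //= ?addn0 //.
  by rewrite -val_eqE /= -e' -e'' eqxx in ne.
have e2 : \sum_(x < n | present x) (p (item x) != q (item x)) = shared_weight.
  exact: sum_present_items (fun t => p t != q t).
pose ins (x : 'I_n) := pr (item x) && (x \in block u).
pose out (x : 'I_n) := pr (item x) && (x \notin block u).
have e3 : \sum_(x < n | present x) pr (item x) =
    \sum_(x < n | present x) ins x + \sum_(x < n | present x) out x.
  rewrite -big_split; apply: eq_bigr => x _; rewrite /ins /out.
  by case: (pr _); case: (x \in _).
(* Vertices of shared items have at most two bin edges and private ones at most one; a private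
   vertex left outside has none, since its only bin is [u] or [v]. *)
have e4 : \sum_(x < n | present x) b x + \sum_(x < n | present x) out x <=
    \sum_(x < n | present x) 1 + shared_weight.
  rewrite -e2 -!big_split /=; apply: leq_sum => x px.
  have [|no] := boolP (out x); last by rewrite addn0; apply: served_le.
  case/andP=> /andP[/eqP e ed] nx; rewrite (_ : b x = 0) ?add0n ?leq_addr //.
  apply/eqP; rewrite cards_eq0; apply/eqP/setP => y; rewrite !inE.
  apply/negP => /andP[/andP[yB sv] yx].
  have yu : y \in block u.
    have : (y == u) || (y == v).
      by rewrite -!val_eqE /=; move: sv; rewrite -e orbb => /eqP <-.
    by case/orP => /eqP->.
  by move: nx; rewrite -(same_block yu) (same_block yx) in_block.
(* The 2 accounts for the bins [u] and [v] in the block. *)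
have e5 : \sum_(x < n | present x) ins x + 2 <= C.
  apply: leq_trans (card_block u).
  pose S := [set x : 'I_n | present x & ins x].
  have -> : \sum_(x < n | present x) ins x = #|S|.
    rewrite -sum1_card big_mkcond [RHS]big_mkcond; apply: eq_bigr => x _.
    by rewrite inE; case: (present x); case: (ins x).
  have cS (x : 'I_n) : x < B -> x \notin S by move=> lt; rewrite inE /present leqNgt lt.
  apply: leq_trans (_ : #|u |: (v |: S)| <= _).
    rewrite !cardsU1 in_setU1 (negbTE ne) (negbTE (cS _ uB)) (cS _ vB); lia.
  apply/subset_leq_card/subsetP => x; rewrite !inE => /or3P[/eqP->|/eqP->//|].
    exact: in_block.
  by case/andP => _ /andP[].
(* Adding the hypothesis for both bins and halving, their private items weigh at least
   [C + shared_weight]. At most [C - 2] of this is inside, so more than [shared_weight] is outside,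
   against [e4] and [count_le]. *)
have := private_large uB; have := private_large vB; move: count_le; lia.
Qed.

Let b_le1 (v : 'I_n) : present v -> b v <= 1.
Proof.
move=> pv; apply/card_le1_eqP => x y; rewrite !inE.
move=> /andP[/andP[xB _] xv] /andP[/andP[yB _] yv].
by apply: separate_cores => //; rewrite (same_block yv) // -(same_block xv).
Qed.

(** The termwise upper bounds add up to no more than the target, so each of them is attained. *)
Let tight (v : 'I_n) : present v -> a v = slot v /\ b v = 1.
Proof.
move=> pv; have le (x : 'I_n) : present x -> a x + b x <= (slot x).+1.
  by move=> px; have := a_le px; have := b_le1 px; lia.
have : \sum_(x < n | present x) (a x + b x) + ((slot v).+1 - (a v + b v)) <=
       \sum_(x < n | present x) (slot x).+1.
  rewrite (bigD1 v) //= [X in _ <= X](bigD1 v) //= -addnA [_ + (_ - _)]addnC addnA.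
  apply: leq_add; first by have := le _ pv; lia.
  by apply: leq_sum => x /andP[px _]; apply: le.
have := a_le pv; have := b_le1 pv; move: value_le; lia.
Qed.

Let mates_block (u v : 'I_n) :
  present u -> present v -> item u = item v -> u \in block v.
Proof.
suff H (x y : 'I_n) : present x -> present y -> item x = item y -> x < y -> x \in block y.
  move=> pu pv e; case: (ltngtP u v) => [lt|lt|/val_inj->//]; first exact: H.
  by have h := H v u pv pu (esym e) lt; rewrite (same_block h) in_block.
move=> px py e lt; have [ea _] := tight py.
have xS : x \in [set z : 'I_n | (z < y) && mates z y] by rewrite inE lt /mates px e eqxx.
have /eqP eS : [set z : 'I_n | (z < y) && mates z y & z \in block y] ==
    [set z : 'I_n | (z < y) && mates z y].
  rewrite eqEcard; apply/andP; split; first by apply/subsetP => z; rewrite !inE => /andP[].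
  by rewrite card_lower_mates // -ea.
by move: xS; rewrite -eS inE => /andP[].
Qed.

Lemma packing_assignment : exists sg, forall c, c < B -> load sg c < C.
Proof.
(* An item goes to its bin [p t] if one of its vertices shares a block with that bin. Otherwise the
   bin edge provided by [tight] leads to [q t]. *)
pose sg t := [exists u : 'I_n, exists v : 'I_n,
   [&& (u : nat) == p t, present v, item v == t & u \in block v]].
have key (v c : 'I_n) : present v -> dest sg (item v) = c -> v \in block c.
  move=> pv ec; suff : c \in block v by move/same_block->; apply: in_block.
  move: ec; rewrite /dest; case: ifP => [/existsP[u /existsP[x]]|/negbT].
    case/and4P => /eqP eu px /eqP ex ux ec.
    have -> : c = u by apply: val_inj; rewrite /= eu ec.
    by rewrite -(same_block (mates_block px pv ex)).
  have [_ b1] := tight pv.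
  have /card_gt0P[u] : 0 < b v by rewrite b1.
  rewrite inE => /andP[/andP[uB /orP[]/eqP eu] ub] nsg eq.
    case/negP: nsg; apply/existsP; exists u; apply/existsP; exists v.
    by rewrite eu !eqxx pv.
  by have -> : c = u by apply: val_inj; rewrite /= -eu -eq.
exists sg => c cB; have ltn : c < n by apply: leq_trans cB (leq_addr _ _).
apply: leq_trans (card_block (Ordinal ltn)); rewrite load_card.
rewrite (_ : _.+1 = #|Ordinal ltn |: [set v : 'I_n | present v & dest sg (item v) == c]|).
  apply/subset_leq_card/subsetP => v; rewrite !inE => /orP[/eqP->|/andP[pv /eqP e]].
    exact: in_block.
  exact: key.
by rewrite cardsU1 inE /present /= [B <= c]leqNgt cB.
Qed.

End FromPartition.

Lemma packingP :
  (exists2 P : {set {set 'I_n}}, capacity_partition C P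
     & packing_target <= partition_value packing_edges P) <->
  (exists sg, forall b, b < B -> load sg b < C).
Proof.
split=> [[P capP valP]|[sg hsg]]; first exact: packing_assignment capP valP.
exact: packing_partition hsg.
Qed.

End PackingGraph.

(** * From constraints on a torus to bin packing *)

Section Torus.

Variables (K D : nat) (rel : nat -> nat -> nat -> nat -> bool).

(** A digit of a load is a sum of two numbers up to [D], so this base excludes carries. *)
Definition base : nat := D.*2.+1.
(* The scales alternate because the two horizontal, and the two vertical, flows at
   a cell have to occupy different digits. *)
Definition hscale (j : nat) : nat := ifn (j %% 2 == 0) 1 base.
Definition vscale (i : nat) : nat := ifn (i %% 2 == 0) (base ^ 2) (base ^ 3).
(** The leading [base ^ 4] marks a choice. At scale [hscale j], the digit [D - u] leaves room for
    [u] of the cell's own units; at [hscale j.+1], the digit [u] leaves room for the [D - u] units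
    passed on by the left neighbour. The vertical digits do the same with [v]. *)
Definition choice_weight (i j u v : nat) : nat :=
  base ^ 4 + hscale j * (D - u) + hscale j.+1 * u + vscale i * (D - v) + vscale i.+1 * v.
Definition cell_space : nat := base ^ 4 + D * (1 + base + base ^ 2 + base ^ 3).

Definition period : nat := K * K * D * D.
Definition item_index (c i j u v : nat) : nat := c * period + (((i * K + j) * D + u) * D + v).
Definition kind_of (t : nat) : nat := t %/ period.
Definition rank_of (t : nat) : nat := t %% period.
Definition v_of (t : nat) : nat := rank_of t %% D.
Definition u_of (t : nat) : nat := (rank_of t %/ D) %% D.
Definition j_of (t : nat) : nat := (rank_of t %/ D %/ D) %% K.
Definition i_of (t : nat) : nat := rank_of t %/ D %/ D %/ K.

Definition cell (i j : nat) : nat := i * K + j.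

(* Kind 0: choices of a cell, all but one of which go to the extra bin [K * K];
   kinds 1 and 2: units shared with the next cell to the right and below, of which
   only those with [v = 0] have positive weight; kind 3: private items. *)
Definition free_weight (t : nat) : nat :=
  ifn (kind_of t == 0)
    (ifn (rel (i_of t) (j_of t) (u_of t) (v_of t))
         (choice_weight (i_of t) (j_of t) (u_of t) (v_of t)) 0)
    (ifn (v_of t == 0) (ifn (kind_of t == 1) (hscale (j_of t)) (vscale (i_of t))) 0).

Definition free_total : nat := bsum (3 * period) free_weight.
(** The size is dictated by [torus_private_large]: twice a private weight has to cover the capacity
    and [free_total]. The factor 3 comes from the extra bin, whose private weight is reduced by
    [free_total]. One unit of the capacity is for the bin itself. *)
Definition bin_capacity : nat := 3 * (free_total + K * K * cell_space) + 3.

(* The private item of the extra bin makes the total weight equal to the total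
   capacity, so that every bin has to be full. *)
Definition private_weight (r : nat) : nat :=
  ifn (r < K * K) (bin_capacity.-1 - cell_space)
    (ifn (r == K * K) (bin_capacity.-1 + K * K * cell_space - free_total) 0).

Definition torus_weight (t : nat) : nat :=
  ifn (kind_of t == 3) (private_weight (rank_of t)) (free_weight t).

(** Items of rank above [K * K] have weight 0; the default 0 keeps their bin in range. *)
Definition private_bin (r : nat) : nat := ifn (r <= K * K) r 0.

Definition torus_p (t : nat) : nat :=
  ifn (kind_of t == 3) (private_bin (rank_of t)) (cell (i_of t) (j_of t)).
Definition torus_q (t : nat) : nat :=
  ifn (kind_of t == 3) (private_bin (rank_of t))
  (ifn (kind_of t == 0) (K * K)
  (ifn (kind_of t == 1) (cell (i_of t) ((j_of t).+1 %% K))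
                        (cell ((i_of t).+1 %% K) (j_of t)))).

Definition torus_bins : nat := (K * K).+1.
Definition torus_items : nat := 4 * period.

Hypotheses (K_gt0 : 0 < K) (K_even : K %% 2 = 0) (D_gt1 : 1 < D).

Let D_gt0 : 0 < D. Proof. lia. Qed.
Lemma index_rank_lt i j u v : i < K -> j < K -> u < D -> v < D ->
  ((i * K + j) * D + u) * D + v < period.
Proof.
move=> iK jK uD vD; rewrite /period.
have h1 : i * K + j < K * K by nia.
have h2 : (i * K + j) * D + u < K * K * D by nia.
nia.
Qed.

Lemma period_gt0 : 0 < period.
Proof. by rewrite /period !muln_gt0 K_gt0 D_gt0. Qed.

Section Index.
Variables c i j u v : nat.
Hypotheses (iK : i < K) (jK : j < K) (uD : u < D) (vD : v < D).

Lemma kind_index : kind_of (item_index c i j u v) = c.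
Proof.
rewrite /kind_of /item_index divnMDl ?period_gt0 // divn_small ?addn0 //.
exact: index_rank_lt.
Qed.

Lemma rank_index : rank_of (item_index c i j u v) = ((i * K + j) * D + u) * D + v.
Proof. by rewrite /rank_of /item_index modnMDl modn_small // index_rank_lt. Qed.

Lemma v_index : v_of (item_index c i j u v) = v.
Proof. by rewrite /v_of rank_index modnMDl modn_small. Qed.

Lemma u_index : u_of (item_index c i j u v) = u.
Proof. by rewrite /u_of rank_index divnMDl // (divn_small vD) addn0 modnMDl modn_small. Qed.

Lemma j_index : j_of (item_index c i j u v) = j.
Proof.
by rewrite /j_of rank_index divnMDl // (divn_small vD) addn0 divnMDl // (divn_small uD)
  addn0 modnMDl modn_small.
Qed.

Lemma i_index : i_of (item_index c i j u v) = i.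
Proof.
by rewrite /i_of rank_index divnMDl // (divn_small vD) addn0 divnMDl // (divn_small uD)
  addn0 divnMDl // (divn_small jK) addn0.
Qed.

Definition indexE := (kind_index, v_index, u_index, j_index, i_index).

End Index.

Definition sum4 (F : nat -> nat -> nat -> nat -> nat) : nat :=
  \sum_(0 <= i < K) \sum_(0 <= j < K) \sum_(0 <= u < D) \sum_(0 <= v < D) F i j u v.

Lemma sum_period c (F : nat -> nat) :
  \sum_(0 <= r < period) F (c * period + r) = sum4 (fun i j u v => F (item_index c i j u v)).
Proof.
rewrite /period sum_mul_nat sum_mul_nat sum_mul_nat.
by apply: eq_bigr => i _; apply: eq_bigr => j _; apply: eq_bigr => u _; apply: eq_bigr.
Qed.

Lemma sum_items (F : nat -> nat) : \sum_(0 <= t < torus_items) F t =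
  \sum_(0 <= c < 3) sum4 (fun i j u v => F (item_index c i j u v)) +
  \sum_(0 <= r < period) F (3 * period + r).
Proof.
by rewrite /torus_items sum_mul_nat big_nat_recr //=; congr (_ + _);
  apply: eq_bigr => c _; rewrite sum_period.
Qed.

Lemma sum_delta n a (F : nat -> nat) : a < n ->
  \sum_(0 <= i < n) (i == a) * F i = F a.
Proof.
move=> lt; rewrite (big_cat_nat (n := a)) ?(ltnW lt) //= big_nat big1 ?add0n.
  rewrite (big_ltn lt) eqxx mul1n big_nat big1 ?addn0 // => i /andP[le _].
  by rewrite gtn_eqF.
by move=> i /andP[_ le]; rewrite ltn_eqF.
Qed.

Lemma cell_eq i j i' j' : j < K -> j' < K ->
  (cell i j == cell i' j') = (i == i') && (j == j').
Proof.
move=> jK jK'; apply/eqP/andP => [e|[/eqP-> /eqP->]//].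
have ei : i = i'.
  by have := congr1 (fun n => n %/ K) e; rewrite /= !divnMDl // !divn_small // !addn0.
by subst i'; move: e => /addnI ->.
Qed.

Lemma cell_lt i j : i < K -> j < K -> cell i j < K * K.
Proof. by rewrite /cell => iK jK; nia. Qed.

Definition pred_mod (j : nat) : nat := (j + K.-1) %% K.

Lemma pred_mod_lt j : pred_mod j < K. Proof. by rewrite ltn_mod. Qed.

Lemma succ_mod_eq j j' : j < K -> j' < K -> (j.+1 %% K == j') = (j == pred_mod j').
Proof.
move=> jK jK'; rewrite /pred_mod.
have -> : j.+1 %% K = if j.+1 == K then 0 else j.+1.
  by case: eqP => [->|ne]; rewrite ?modnn // modn_small; lia.
have -> : (j' + K.-1) %% K = if j' == 0 then K.-1 else j'.-1.
  case: eqP => [->|ne]; first by rewrite modn_small; lia.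
  by rewrite (_ : j' + K.-1 = j'.-1 + K); [rewrite modnDr modn_small; lia | lia].
by case: (j.+1 =P K); case: (j' =P 0); lia.
Qed.

(** [K] is even, so the alternation of the scales closes up around the torus. *)
Lemma hscale_pred j : hscale (pred_mod j) = hscale j.+1.
Proof. by rewrite /hscale /pred_mod; congr (ifn (_ == _)); lia. Qed.

Lemma vscale_pred j : vscale (pred_mod j) = vscale j.+1.
Proof. by rewrite /vscale /pred_mod; congr (ifn (_ == _)); lia. Qed.

Section Loads.

Variable sg : nat -> bool.

Definition chosen (i j : nat) : nat :=
  \sum_(0 <= u < D) \sum_(0 <= v < D)
     (rel i j u v && sg (item_index 0 i j u v)) * choice_weight i j u v.
Definition hflow (i j : nat) : nat := \sum_(0 <= u < D) sg (item_index 1 i j u 0).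
Definition vflow (i j : nat) : nat := \sum_(0 <= u < D) sg (item_index 2 i j u 0).

Local Notation tload := (load torus_items torus_weight torus_p torus_q sg).

Lemma load_termE b t : (if dest torus_p torus_q sg t == b then torus_weight t else 0) =
  (torus_p t == b) * (sg t * torus_weight t) + (torus_q t == b) * (~~ sg t * torus_weight t).
Proof. by rewrite /dest; case: (sg t); case: eqP; case: eqP; rewrite /= ?mul0n ?mul1n ?addn0. Qed.

Lemma hflow_le i j : hflow i j <= D.
Proof.
rewrite /hflow -[X in _ <= X]mul1n -[X in _ <= _ * X]subn0 mulnC -sum_nat_const_nat leq_sum // => u _.
by case: (sg _).
Qed.

Lemma vflow_le i j : vflow i j <= D.
Proof.
rewrite /vflow -[X in _ <= X]mul1n -[X in _ <= _ * X]subn0 mulnC -sum_nat_const_nat leq_sum // => u _.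
by case: (sg _).
Qed.

Lemma sum_first (F : nat -> nat) : \sum_(0 <= v < D) (v == 0) * F v = F 0.
Proof. exact: sum_delta. Qed.

Lemma flow_compl c i j : \sum_(0 <= u < D) (~~ sg (item_index c i j u 0)) =
  D - \sum_(0 <= u < D) sg (item_index c i j u 0).
Proof.
apply/eqP; rewrite -(eqn_add2r (\sum_(0 <= u < D) sg (item_index c i j u 0))) -big_split /=.
rewrite (eq_bigr (fun=> 1)) => [|u _]; last by case: (sg _).
rewrite sum_nat_const_nat subn0 muln1 subnK //.
rewrite -[X in _ <= X]mul1n -[X in _ <= _ * X]subn0 mulnC -sum_nat_const_nat leq_sum // => u _.
by case: (sg _).
Qed.

Lemma load_cell a b : a < K -> b < K -> tload (cell a b) =
  chosen a b + (hscale b * hflow a b + hscale b.+1 * (D - hflow a (pred_mod b))) +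
  (vscale a * vflow a b + vscale a.+1 * (D - vflow (pred_mod a) b)) +
  (bin_capacity.-1 - cell_space).
Proof.
move=> aK bK; have cK := cell_lt aK bK.
rewrite /load sum_items; congr (_ + _); last first.
  (* Kind 3: both candidate bins coincide, so [sg] does not matter. *)
  transitivity (\sum_(0 <= r < period) (r == cell a b) * private_weight r).
    apply: eq_big_nat => r lt.
    have kr : kind_of (3 * period + r) = 3.
      by rewrite /kind_of divnMDl ?period_gt0 // divn_small // addn0.
    have rr : rank_of (3 * period + r) = r.
      by rewrite /rank_of modnMDl modn_small.
    rewrite load_termE /torus_p /torus_q /torus_weight kr rr /= -mulnDr -mulnDl.
    have -> : sg (3 * period + r) + ~~ sg (3 * period + r) = 1 by case: (sg _).
    rewrite mul1n /private_bin /private_weight /ifn.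
    by case: (ltngtP r (K * K)) => // lt'; rewrite !muln0.
  rewrite sum_delta; first by rewrite /private_weight /ifn cK.
  by apply: leq_trans cK _; rewrite /period -mulnA leq_pmulr // muln_gt0 D_gt0.
rewrite !big_nat_recr //= big_geq // add0n; congr (_ + _ + _).
(* Kind 0: the alternative bin is the extra one, which is no cell. *)
- transitivity (\sum_(0 <= i < K) (i == a) * \sum_(0 <= j < K) (j == b) * chosen i j).
    apply: eq_big_nat => i iK; rewrite big_distrr; apply: eq_big_nat => j jK /=.
    rewrite mulnA mulnb -cell_eq // big_distrr; apply: eq_big_nat => u uD /=.
    rewrite big_distrr; apply: eq_big_nat => v vD /=.
    rewrite load_termE /torus_p /torus_q /torus_weight /free_weight !indexE //=.
    rewrite /ifn /= (gtn_eqF cK) mul0n addn0; congr (_ * _).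
    by case: (rel _ _ _ _); rewrite ?muln0 ?mul0n.
  by rewrite sum_delta // sum_delta.
(* Kind 1: the cell keeps some of its own units and receives those given away by its left
   neighbour. *)
- transitivity (\sum_(0 <= i < K) (i == a) * (\sum_(0 <= j < K) (j == b) * (hscale j * hflow i j) +
     \sum_(0 <= j < K) (j == pred_mod b) * (hscale j * (D - hflow i j)))); last first.
    by rewrite sum_delta // !sum_delta ?pred_mod_lt // hscale_pred.
  apply: eq_big_nat => i iK; rewrite -big_split big_distrr; apply: eq_big_nat => j jK /=.
  rewrite mulnDr !mulnA !mulnb -cell_eq // -succ_mod_eq // -cell_eq ?ltn_mod //.
  rewrite -!mulnA -flow_compl /hflow !big_distrr -big_split; apply: eq_big_nat => u uD /=.
  rewrite -[X in X + _](sum_first (fun=> _)) -[X in _ + X](sum_first (fun=> _)) -big_split.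
  apply: eq_big_nat => v vD /=.
  rewrite load_termE /torus_p /torus_q /torus_weight /free_weight !indexE //= /ifn /=.
  by case: (v =P 0) => [->|_]; rewrite ?muln0 ?mul0n ?mul1n //; congr (_ * _ + _ * _); rewrite mulnC.
(* Kind 2: the same vertically; exchanging the sums isolates the column first. *)
- transitivity (\sum_(0 <= j < K) (j == b) * (\sum_(0 <= i < K) (i == a) * (vscale i * vflow i j) +
     \sum_(0 <= i < K) (i == pred_mod a) * (vscale i * (D - vflow i j)))); last first.
    by rewrite sum_delta // !sum_delta ?pred_mod_lt // vscale_pred.
  rewrite /sum4 exchange_big_nat /=.
  apply: eq_big_nat => j jK; rewrite -big_split big_distrr; apply: eq_big_nat => i iK /=.
  rewrite mulnDr !mulnA !mulnb ![(j == b) && _]andbC -cell_eq // -succ_mod_eq // -cell_eq //.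
  rewrite -!mulnA -flow_compl /vflow !big_distrr -big_split; apply: eq_big_nat => u uD /=.
  rewrite -[X in X + _](sum_first (fun=> _)) -[X in _ + X](sum_first (fun=> _)) -big_split.
  apply: eq_big_nat => v vD /=.
  rewrite load_termE /torus_p /torus_q /torus_weight /free_weight !indexE //= /ifn /=.
  by case: (v =P 0) => [->|_]; rewrite ?muln0 ?mul0n ?mul1n //; congr (_ * _ + _ * _); rewrite mulnC.
Qed.


Lemma kind3 r : r < period -> kind_of (3 * period + r) = 3 /\ rank_of (3 * period + r) = r.
Proof.
move=> lt; split; first by rewrite /kind_of divnMDl ?period_gt0 // divn_small // addn0.
by rewrite /rank_of modnMDl modn_small.
Qed.

Lemma i_of_lt t : i_of t < K.
Proof.
by rewrite /i_of !ltn_divLR // ltn_pmod // period_gt0.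
Qed.

Lemma j_of_lt t : j_of t < K. Proof. by rewrite ltn_mod. Qed.

Lemma torus_p_lt t : torus_p t < torus_bins.
Proof.
rewrite /torus_p /private_bin /torus_bins /ifn.
have := cell_lt (i_of_lt t) (j_of_lt t).
by case: ifP => // _; [case: ifP | lia].
Qed.

Lemma torus_q_lt t : torus_q t < torus_bins.
Proof.
rewrite /torus_q /private_bin /torus_bins /ifn.
case: ifP => _; first by case: ifP.
case: ifP => // _; case: ifP => _; apply: ltnW; rewrite ltnS cell_lt ?ltn_mod ?i_of_lt ?j_of_lt //.
Qed.

Lemma cell_space_lt : cell_space < bin_capacity.
Proof.
have : cell_space <= K * K * cell_space by rewrite leq_pmull // muln_gt0 K_gt0.
by rewrite /bin_capacity; lia.
Qed.

Lemma KK_lt_period : K * K < period.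
Proof. by rewrite /period -mulnA ltn_Pmulr ?muln_gt0 ?K_gt0 //; nia. Qed.

Lemma sum_private : \sum_(0 <= r < period) private_weight r =
  K * K * (bin_capacity.-1 - cell_space) + (bin_capacity.-1 + K * K * cell_space - free_total).
Proof.
rewrite (big_cat_nat (n := K * K)) ?(ltnW KK_lt_period) //=; congr (_ + _).
  transitivity (\sum_(0 <= r < K * K) (bin_capacity.-1 - cell_space)).
    by apply: eq_big_nat => r /andP[_ lt]; rewrite /private_weight /ifn lt.
  by rewrite sum_nat_const_nat subn0.
rewrite (big_ltn KK_lt_period) /private_weight ltnn eqxx /= big_nat big1 ?addn0 //.
by move=> r /andP[lt _]; rewrite /ifn ltnNge (ltnW lt) /= gtn_eqF.
Qed.

Lemma sum_torus_weight : \sum_(0 <= t < torus_items) torus_weight t =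
  free_total + \sum_(0 <= r < period) private_weight r.
Proof.
rewrite /torus_items (_ : 4 * period = 3 * period + period); last lia.
rewrite (big_cat_nat (n := 3 * period)) ?leq_addr //=; congr (_ + _).
  apply: eq_big_nat => t /andP[_ lt]; rewrite /torus_weight /ifn ifF //.
  by apply/negbTE; rewrite neq_ltn /kind_of ltn_divLR ?period_gt0 ?lt.
rewrite -{1}(add0n (3 * period)) big_addn addKn; apply: eq_big_nat => r lt.
by rewrite addnC /torus_weight; have [-> ->] := kind3 lt.
Qed.

Lemma total_load : \sum_(0 <= b < torus_bins) tload b = torus_bins * bin_capacity.-1.
Proof.
rewrite /load exchange_big_nat /=.
transitivity (\sum_(0 <= t < torus_items) torus_weight t).
  apply: eq_big_nat => t _; set d := dest _ _ _ _.
  have lt : d < torus_bins by apply: dest_lt => [t' _|t' _|]; rewrite ?torus_p_lt ?torus_q_lt.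
  rewrite -[RHS](sum_delta (fun=> torus_weight t) lt); apply: eq_bigr => b _.
  by rewrite [d == b]eq_sym; case: (b == d); rewrite ?mul1n.
rewrite sum_torus_weight sum_private /torus_bins.
have := cell_space_lt; have : free_total <= bin_capacity.-1 by rewrite /bin_capacity; lia.
rewrite mulnBr; nia.
Qed.

Lemma scales_sum a b :
  hscale b + hscale b.+1 + vscale a + vscale a.+1 = 1 + base + base ^ 2 + base ^ 3.
Proof.
have h c : c.+1 %% 2 == 0 = ~~ (c %% 2 == 0) by lia.
by rewrite /hscale /vscale /ifn !h; case: (_ == 0); case: (_ == 0); rewrite /=; lia.
Qed.

End Loads.

(** Two nonzero terms would already reach [H * 2]. *)
Lemma one_big_term n H (F : nat -> nat) :
  (forall i, i < n -> F i = 0 \/ H <= F i) -> 0 < \sum_(0 <= i < n) F i < H * 2 ->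
  exists2 i, i < n & F i = \sum_(0 <= i < n) F i.
Proof.
elim: n => [|n IH] h; first by rewrite big_geq.
rewrite big_nat_recr //=; set s := \sum_(0 <= i < n) F i.
have s0 : s = 0 \/ H <= s.
  have : forall i, i < n -> F i = 0 \/ H <= F i by move=> i lt; apply: h; lia.
  rewrite /s; elim: (n) => [|m IHm] hm; first by left; rewrite big_geq.
  rewrite big_nat_recr //=.
  have [|e|e] := IHm; first by move=> i lt; apply: hm; lia.
    by rewrite e; apply: hm.
  by right; lia.
case: (h n (ltnSn n)) => [e|le] bd.
  rewrite e addn0 in bd *.
  by have [|i lt ei] := IH _ bd; [move=> i lt; apply: h; lia | exists i; rewrite // ltnS ltnW].
by exists n => //; lia.
Qed.

Lemma digit_step N a a' x y : a < N -> a' < N -> a + N * x = a' + N * y -> a = a' /\ x = y.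
Proof.
move=> lt lt' e; have N0 : 0 < N by lia.
have ea : a = a'.
  have := congr1 (fun z => z %% N) e.
  by rewrite /= ![N * _]mulnC ![_ + _ * N]addnC !modnMDl !modn_small.
by split=> //; subst a'; move/addnI: e => /eqP; rewrite eqn_pmul2l // => /eqP.
Qed.

Lemma digits4 N a b c d e : a < N -> b < N -> c < N -> d < N -> e < N ->
  a + N * b + N ^ 2 * c + N ^ 3 * d = e * (1 + N + N ^ 2 + N ^ 3) ->
  [/\ a = e, b = e, c = e & d = e].
Proof.
move=> ha hb hc hd he h.
have {h} : a + N * (b + N * (c + N * d)) = e + N * (e + N * (e + N * e)).
  by move: h; rewrite (_ : N ^ 2 = N * N) ?expnS ?expn0 ?muln1 //; lia.
by case/(digit_step ha he) => -> /(digit_step hb he)[-> /(digit_step hc he)[-> ->]].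
Qed.

(** The four sums [D - u + x], [u + (D - x')], [D - v + y] and [v + (D - y')] are digits in base
    [base], and each has to equal [D]. *)
Lemma cell_balance a b u v x x' y y' : u < D -> v < D ->
  x <= D -> x' <= D -> y <= D -> y' <= D ->
  choice_weight a b u v + (hscale b * x + hscale b.+1 * (D - x')) +
  (vscale a * y + vscale a.+1 * (D - y')) = cell_space ->
  [/\ x = u, x' = u, y = v & y' = v].
Proof.
move=> uD vD xD xD' yD yD'.
have hc c : c.+1 %% 2 == 0 = ~~ (c %% 2 == 0) by lia.
rewrite /choice_weight /cell_space => e.
have {e} : hscale b * (D - u + x) + hscale b.+1 * (u + (D - x')) +
   vscale a * (D - v + y) + vscale a.+1 * (v + (D - y')) = D * (1 + base + base ^ 2 + base ^ 3).
  by rewrite !mulnDr in e *; lia.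
have lt1 : D - u + x < base by rewrite /base; lia.
have lt2 : u + (D - x') < base by rewrite /base; lia.
have lt3 : D - v + y < base by rewrite /base; lia.
have lt4 : v + (D - y') < base by rewrite /base; lia.
have lt5 : D < base by rewrite /base; lia.
(* The parities of [b] and [a] merely swap the digits within the horizontal and the vertical
   pair. *)
rewrite /hscale /vscale /ifn !hc; case: (_ == 0); case: (_ == 0); rewrite /= ?mul1n => e.
- by have [|h1 h2 h3 h4] := digits4 lt1 lt2 lt3 lt4 lt5; [lia | split; lia].
- by have [|h1 h2 h3 h4] := digits4 lt1 lt2 lt4 lt3 lt5; [lia | split; lia].
- by have [|h1 h2 h3 h4] := digits4 lt2 lt1 lt3 lt4 lt5; [lia | split; lia].
- by have [|h1 h2 h3 h4] := digits4 lt2 lt1 lt4 lt3 lt5; [lia | split; lia].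
Qed.

Hypothesis rel_diag : forall i u v, rel i i u v -> u = v.

Local Notation tload := (load torus_items torus_weight torus_p torus_q).

Lemma torus_solution : 
  (exists sg, forall b, b < torus_bins -> tload sg b < bin_capacity) ->
  exists val, (forall i, i < K -> val i < D) /\
    (forall i j, i < K -> j < K -> rel i j (val i) (val j)).
Proof.
move=> [sg hsg].
(* No bin exceeds its capacity and the total weight equals the total capacity, so there is no slack
   anywhere. *)
have tight b : b < torus_bins -> tload sg b = bin_capacity.-1.
  move=> lt; have le c : c < torus_bins -> tload sg c <= bin_capacity.-1.
    by move=> ltc; have := hsg c ltc; lia.
  apply/eqP; rewrite eqn_leq le //= leqNgt; apply/negP => ltb.
  have := total_load sg; rewrite (big_cat_nat (n := b)) ?(ltnW lt) //= (big_ltn lt).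
  have : \sum_(0 <= i < b) tload sg i <= \sum_(0 <= i < b) bin_capacity.-1.
    by rewrite !big_nat; apply: leq_sum => i /andP[_ li]; apply: le; apply: ltn_trans li lt.
  have : \sum_(b.+1 <= i < torus_bins) tload sg i <= \sum_(b.+1 <= i < torus_bins) bin_capacity.-1.
    by rewrite !big_nat; apply: leq_sum => i /andP[_ li]; apply: le.
  rewrite !sum_nat_const_nat subn0 mulnBl; nia.
have cellP i j : i < K -> j < K ->
   [/\ hflow sg i j < D, vflow sg i j < D, rel i j (hflow sg i j) (vflow sg i j),
       hflow sg i j = hflow sg i (pred_mod j) & vflow sg i j = vflow sg (pred_mod i) j].
  move=> iK jK; have := tight (cell i j); rewrite load_cell // => e.
  have {}e : chosen sg i j + (hscale j * hflow sg i j + hscale j.+1 * (D - hflow sg i (pred_mod j))) +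
      (vscale i * vflow sg i j + vscale i.+1 * (D - vflow sg (pred_mod i) j)) = cell_space.
    have {}e := e (ltnW (cell_lt iK jK)); have := cell_space_lt; lia.
  have h1 := hflow_le sg i j; have h2 := hflow_le sg i (pred_mod j).
  have h3 := vflow_le sg i j; have h4 := vflow_le sg (pred_mod i) j.
  have dS : D * (1 + base + base ^ 2 + base ^ 3) < base ^ 4.
    have : D.*2.+1 = base by [].
    by move: (base) => N <-; rewrite !expnS !expn0; nia.
  have bd : hscale j * hflow sg i j + hscale j.+1 * (D - hflow sg i (pred_mod j)) +
      (vscale i * vflow sg i j + vscale i.+1 * (D - vflow sg (pred_mod i) j)) < base ^ 4.
    apply: leq_ltn_trans (_ : D * (hscale j + hscale j.+1 + vscale i + vscale i.+1) < _).
      by rewrite !mulnDr ![D * _]mulnC !addnA !leq_add // leq_mul2l ?leq_subr ?h1 ?h3 orbT.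
    by rewrite scales_sum.
  (* The units weigh less than [base ^ 4], so they cannot fill the cell without a choice; two
     choices would overfill it. *)
  have hch : 0 < chosen sg i j < base ^ 4 * 2.
    have ar c a f E : c + f = E + a -> f < E -> a < E -> 0 < c < E * 2 by lia.
    by apply: ar bd dS; rewrite addnA.
  have Hc u v : base ^ 4 <= choice_weight i j u v by rewrite /choice_weight -!addnA leq_addr.
  have [|| u uD eu] := @one_big_term D (base ^ 4)
    (fun u => \sum_(0 <= v < D) (rel i j u v && sg (item_index 0 i j u v)) * choice_weight i j u v).
  - move=> u _; have [/eqP e0|] := posnP (\sum_(0 <= v < D) (rel i j u v && sg (item_index 0 i j u v)) * choice_weight i j u v).
      by left; apply/eqP.
    rewrite lt0n sum_nat_seq_neq0 => /hasP[v]; rewrite mem_index_iota => /andP[_ vD].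
    rewrite /= muln_eq0 negb_or eqb0 negbK => /andP[hb _]; right.
    apply: leq_trans (Hc u v) _; rewrite -/(index_iota 0 D) (bigD1_seq v) ?iota_uniq ?mem_index_iota //=.
    by rewrite hb mul1n leq_addr.
  - exact: hch.
  rewrite -/(chosen sg i j) in eu.
  have [|| v vD ev] := @one_big_term D (base ^ 4)
    (fun v => (rel i j u v && sg (item_index 0 i j u v)) * choice_weight i j u v).
  - by move=> v _; case: (_ && _); [right; rewrite mul1n | left].
  - by rewrite eu.
  rewrite eu in ev.
  have /andP[hr _] : rel i j u v && sg (item_index 0 i j u v).
    by case: (_ && _) ev hch => // <-.
  have ec : chosen sg i j = choice_weight i j u v.
    by case: (_ && _) ev hch => [<-|<-//]; rewrite mul1n.
  rewrite ec in e; have [-> -> -> ->] := cell_balance uD vD h1 h2 h3 h4 e.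
  by split.
exists (fun i => hflow sg i 0); split=> [i iK|i j iK jK].
  by have [] := cellP i 0 iK K_gt0.
have predS m : m.+1 < K -> pred_mod m.+1 = m.
  move=> lt; rewrite /pred_mod (_ : m.+1 + K.-1 = m + K); last lia.
  by rewrite modnDr modn_small // ltnW.
have hrow a b : a < K -> b < K -> hflow sg a b = hflow sg a 0.
  move=> aK; elim: b => // b IH bK.
  by have [_ _ _ -> _] := cellP a b.+1 aK bK; rewrite predS // IH // ltnW.
have hcol a b : a < K -> b < K -> vflow sg a b = vflow sg 0 b.
  move=> aK bK; elim: a aK => // a IH aK.
  by have [_ _ _ _ ->] := cellP a.+1 b aK bK; rewrite predS // IH // ltnW.
(* Flows are constant along rows and columns. In the diagonal cell the two values of the choice
   agree, so column [j] carries the value of row [j]. *)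
have [_ _ hr _ _] := cellP i j iK jK; have [_ _ /rel_diag hd _ _] := cellP j j jK jK.
by rewrite -(hrow i j) // -(hrow j j) // hd (hcol j j) // -(hcol i j).
Qed.

Lemma torus_assignment val :
  (forall i, i < K -> val i < D) ->
  (forall i j, i < K -> j < K -> rel i j (val i) (val j)) ->
  exists sg, forall b, b < torus_bins -> tload sg b < bin_capacity.
Proof.
move=> valD hr.
(* A cell keeps the one choice prescribed by [val], and as many of its units as the value of its row
   or column says. *)
pose sg t := if kind_of t == 0 then (u_of t == val (i_of t)) && (v_of t == val (j_of t))
  else if kind_of t == 1 then u_of t < val (i_of t) else u_of t < val (j_of t).
have cellE i j : i < K -> j < K -> tload sg (cell i j) = bin_capacity.-1.
  move=> iK jK; rewrite load_cell //.
  have hf a b : a < K -> b < K -> hflow sg a b = val a.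
    move=> aK bK; have := bsum_lt D (val a); rewrite /bsum (minn_idPr (ltnW (valD _ aK))) => <-.
    by apply: eq_big_nat => u uD; rewrite /sg !indexE.
  have vf a b : a < K -> b < K -> vflow sg a b = val b.
    move=> aK bK; have := bsum_lt D (val b); rewrite /bsum (minn_idPr (ltnW (valD _ bK))) => <-.
    by apply: eq_big_nat => u uD; rewrite /sg !indexE.
  rewrite !hf ?pred_mod_lt // !vf ?pred_mod_lt //.
  have -> : chosen sg i j = choice_weight i j (val i) (val j).
    rewrite -(sum_delta (fun u => choice_weight i j u (val j)) (valD _ iK)).
    apply: eq_big_nat => u uD.
    rewrite -(sum_delta (fun v => choice_weight i j u v) (valD _ jK)) big_distrr.
    apply: eq_big_nat => v vD; rewrite /sg !indexE //= mulnA mulnb; congr (nat_of_bool _ * _).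
    by case: eqP => [->|]; rewrite ?andbF //; case: eqP => [->|]; rewrite ?andbF // hr.
  have := scales_sum i j; have := cell_space_lt.
  have := valD i iK; have := valD j jK; rewrite /choice_weight.
  move: (hscale j) (hscale j.+1) (vscale i) (vscale i.+1) => s1 s2 s3 s4.
  move=> lj li lt e.
  suff : base ^ 4 + s1 * (D - val i) + s2 * val i + s3 * (D - val j) + s4 * val j +
    (s1 * val i + s2 * (D - val i)) + (s3 * val j + s4 * (D - val j)) = cell_space.
    by move=> ->; rewrite subnKC // -ltnS prednK //; apply: leq_ltn_trans lt.
  rewrite /cell_space -e; move: (base ^ 4) => E.
  have h s a : a < D -> s * (D - a) + s * a = D * s.
    by move=> /ltnW aD; rewrite -mulnDr subnK // mulnC.
  rewrite !mulnDr -(h s1 _ li) -(h s2 _ li) -(h s3 _ lj) -(h s4 _ lj).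
  by move: (s1 * _) (s2 * _) (s3 * _) (s4 * _) (s1 * _) (s2 * _) (s3 * _) (s4 * _); lia.
have cells b : b < K * K -> tload sg b = bin_capacity.-1.
  move=> lt; rewrite (divn_eq b K); apply: cellE; last by rewrite ltn_mod.
  by rewrite ltn_divLR.
exists sg => b; rewrite ltnS leq_eqVlt => /orP[/eqP->|/cells->]; last first.
  by rewrite prednK // (leq_ltn_trans _ cell_space_lt).
(* The extra bin receives what the full cells leave of the total weight. *)
have := total_load sg; rewrite /torus_bins big_nat_recr //=.
have -> : \sum_(0 <= i < K * K) tload sg i = K * K * bin_capacity.-1.
  transitivity (\sum_(0 <= i < K * K) bin_capacity.-1).
    by apply: eq_big_nat => i /andP[_ lt]; apply: cells.
  by rewrite sum_nat_const_nat subn0.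
rewrite mulSnr => /addnI ->; rewrite prednK // (leq_ltn_trans _ cell_space_lt) //.
Qed.

Lemma bin_capacity_gt0 : 0 < bin_capacity.
Proof. exact: leq_ltn_trans cell_space_lt. Qed.

(** Hides the product behind [S], so that [lia] meets linear terms only. *)
Lemma bin_capacityE :
  exists2 S, K * K * cell_space = S & bin_capacity = 3 * (free_total + S) + 3.
Proof. by exists (K * K * cell_space). Qed.

Lemma free_weight_le t : t < 3 * period -> free_weight t <= free_total.
Proof.
move=> lt; rewrite /free_total /bsum (big_cat_nat (n := t)) ?(ltnW lt) //= (big_ltn lt).
by rewrite addnCA leq_addr.
Qed.

(** The factor 2 is for the private item of the extra bin, which exceeds the capacity when the free
    items are too light to fill the cells. *)
Lemma torus_weight_le t : t < torus_items -> torus_weight t <= 2 * bin_capacity.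
Proof.
move=> lt; rewrite /torus_weight {1}/ifn; case: ifP => k3.
  have [S eS eC] := bin_capacityE.
  by rewrite /private_weight /ifn eS eC; case: ifP => _; [lia | case: ifP => // _; lia].
apply: leq_trans (free_weight_le _) _; last first.
  by have [S _ ->] := bin_capacityE; lia.
have : kind_of t < 4 by rewrite /kind_of ltn_divLR ?period_gt0.
rewrite leq_eqVlt eqSS k3 /= ltnS /kind_of => le.
by rewrite -ltn_divLR ?period_gt0.
Qed.

Lemma torus_private_large b : b < torus_bins ->
  bin_capacity + shared_weight torus_items torus_weight torus_p torus_q <=
  2 * private_load torus_items torus_weight torus_p torus_q b.
Proof.
rewrite ltnS => le.
have h1 : shared_weight torus_items torus_weight torus_p torus_q <= free_total.
  rewrite /shared_weight /torus_items (_ : 4 * period = 3 * period + period); last lia.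
  rewrite (big_cat_nat (n := 3 * period)) ?leq_addr //= -[X in _ <= X]addn0 leq_add //.
    rewrite /free_total /bsum !big_nat leq_sum // => t /andP[_ lt].
    case: ifP => // _; rewrite /torus_weight /ifn ifF //.
    by apply/negbTE; rewrite neq_ltn /kind_of ltn_divLR ?period_gt0 ?lt.
  rewrite -{1}(add0n (3 * period)) big_addn addKn big_nat big1 // => r /andP[_ lt].
  by rewrite addnC /torus_p /torus_q; have [-> _] := kind3 lt; rewrite /ifn /= eqxx.
have h2 : private_weight b <= private_load torus_items torus_weight torus_p torus_q b.
  have lp : b < period by apply: leq_ltn_trans le KK_lt_period.
  rewrite /private_load /torus_items (_ : 4 * period = 3 * period + period); last lia.
  rewrite (big_cat_nat (n := 3 * period)) ?leq_addr //=.
  apply: leq_trans (leq_addl _ _).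
  rewrite -{1}(add0n (3 * period)) big_addn addKn (big_cat_nat (n := b)) ?(ltnW lp) //= (big_ltn lp).
  apply: leq_trans (leq_addl _ _); apply: leq_trans (leq_addr _ _).
  rewrite addnC /torus_p /torus_q /torus_weight; have [-> ->] := kind3 lp.
  by rewrite /ifn /= /private_bin /ifn le eqxx.
have h3 : bin_capacity + free_total <= 2 * private_weight b.
  have := cell_space_lt; have : cell_space <= K * K * cell_space by rewrite leq_pmull // muln_gt0 K_gt0.
  have [S eS eC] := bin_capacityE; rewrite /private_weight /ifn eS eC; case: (ltnP b (K * K)) => [_|le'].
    by lia.
  by rewrite (_ : b == K * K) ?eqn_leq ?le //; lia.
lia.
Qed.

End Torus.

(** * The constraint problem of a circuit *)

(** Position of a gate in the encoded list: entry 0 is the weight, and a gate occupies two entries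
    besides its children. *)
Definition offset (x : seq bool) (g : nat) : nat :=
  lrec (count_nums x) g 1 (fun _ o => o + 2 + num x o.+1).
Definition gates (x : seq bool) : nat :=
  bsum (count_nums x) (fun g => offset x g < count_nums x).
Definition kind (x : seq bool) (g : nat) : nat := num x (offset x g).
Definition arity (x : seq bool) (g : nat) : nat := num x (offset x g).+1.
Definition child (x : seq bool) (g j : nat) : nat := num x (offset x g + 2 + j).
Definition ones (x : seq bool) : nat := num x 0.
(** The rank gives the claim of a large gate a fixed place among the digits of a value. *)
Definition large_rank (x : seq bool) (g : nat) : nat := bsum g (fun h => 2 < arity x h).

Lemma definable_offset : definable (fun x e => offset x (nth 0 e 0)).
Proof. rewrite /offset; dfn. Qed.
#[global] Hint Resolve definable_offset : dfn.

Lemma definable_gates : definable (fun x e => gates x).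
Proof. rewrite /gates; dfn. Qed.
#[global] Hint Resolve definable_gates : dfn.

Lemma definable_kind : definable (fun x e => kind x (nth 0 e 0)).
Proof. rewrite /kind; dfn. Qed.
#[global] Hint Resolve definable_kind : dfn.

Lemma definable_arity : definable (fun x e => arity x (nth 0 e 0)).
Proof. rewrite /arity; dfn. Qed.
#[global] Hint Resolve definable_arity : dfn.

Lemma definable_child : definable (fun x e => child x (nth 0 e 0) (nth 0 e 1)).
Proof. rewrite /child; dfn. Qed.
#[global] Hint Resolve definable_child : dfn.

Lemma definable_ones : definable (fun x e => ones x).
Proof. rewrite /ones; dfn. Qed.
#[global] Hint Resolve definable_ones : dfn.

Lemma definable_large_rank : definable (fun x e => large_rank x (nth 0 e 0)).
Proof. rewrite /large_rank; dfn. Qed.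
#[global] Hint Resolve definable_large_rank : dfn.

Definition digit (b u i : nat) : nat := (u %/ b ^ i) %% b.

(** The argument [x] brings the function into the shape that [dfn] applies lemmas to. *)
Definition digit_at (x : seq bool) (b u i : nat) : nat := digit b u i.

(** Powers with a variable exponent may be too large for terms, so the division is iterated; its
    values decrease, and truncation at the starting value never acts. *)
Lemma definable_digit_at :
  definable (fun x e => digit_at x (nth 0 e 0) (nth 0 e 1) (nth 0 e 2)).
Proof.
have h : definable (fun x e => lrec (nth 0 e 1) (nth 0 e 2) (nth 0 e 1)
   (fun _ a => a %/ nth 0 e 0) %% nth 0 e 0) by dfn.
apply: definable_ext h => x e; rewrite /digit_at /digit; congr (_ %% _).
move: (nth 0 e 1) (nth 0 e 2) (nth 0 e 0) => u i b; rewrite /lrec minnn.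
elim: i => [|i IH] /=; first by rewrite divn1.
rewrite IH expnSr divnMA; apply/minn_idPr.
by apply: leq_trans (leq_div _ _) (leq_div _ _).
Qed.
#[global] Hint Resolve definable_digit_at : dfn.

Lemma digit_lt b u i : 0 < b -> digit b u i < b.
Proof. by move=> b0; rewrite ltn_mod. Qed.

Section Csp.

Variable d : nat.

(* A value [u] consists of [2 ^ d] claims followed by [2 ^ d] regions.  The claim of
   a large gate is 0 if all children are to have the value of the gate, and [j + 1]
   if child [j] alone decides it.  A region [low, high) shifts inputs by one: it
   says that input [low - 1] is true (unless [low = 0]) and that the inputs strictly
   between are false. *)
Definition radix (x : seq bool) : nat := gates x + 2.
Definition position (x : seq bool) (i a : nat) : nat := digit_at x (ones x).+1 i a.
Definition claim (x : seq bool) (u g : nat) : nat := digit_at x (radix x) u (large_rank x g).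
Definition low (x : seq bool) (u a : nat) : nat := digit_at x (radix x) u (2 ^ d + 2 * a).
Definition high (x : seq bool) (u a : nat) : nat := digit_at x (radix x) u (2 ^ d + 2 * a + 1).

Definition known_one (x : seq bool) (u g : nat) : bool :=
  bex (2 ^ d) (fun a => low x u a == g.+1).
Definition known_zero (x : seq bool) (u g : nat) : bool :=
  bex (2 ^ d) (fun a => (low x u a < g.+1) && (g.+1 < high x u a)).

(* Three-valued evaluation: the regions and claims in [u] force value [b] at [g]. *)
Fixpoint known (e : nat) (b : bool) (x : seq bool) (u g : nat) : bool :=
  if e is e'.+1 then
    [|| (kind x g == 0) && (if b then known_one x u g else known_zero x u g),
        (kind x g == 1) && known e' (~~ b) x u (child x g 0),
        (1 < kind x g) && (2 < arity x g) && ((b == (kind x g == 2)) == (claim x u g == 0))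
      | (1 < kind x g) && (arity x g <= 2) &&
          (((b == (kind x g == 2)) && ball (arity x g) (fun j => known e' b x u (child x g j)))
        || ((b != (kind x g == 2)) && bex (arity x g) (fun j => known e' b x u (child x g j))))]
  else false.

(** With claim 0 a conjunction expects all children to be true and a disjunction all to be false; a
    positive claim names a child of the other value. A row rejects a claim only if it definitely
    knows better. *)
Definition contradicts (x : seq bool) (u g h : nat) : bool :=
  ((kind x g == 2) && known d.+1 false x u h) || ((kind x g != 2) && known d.+1 true x u h).
Definition supports (x : seq bool) (u g h : nat) : bool :=
  ((kind x g == 2) && known d.+1 true x u h) || ((kind x g != 2) && known d.+1 false x u h).

Definition claim_ok (x : seq bool) (u g : nat) : bool :=
  ((claim x u g == 0) ==> ball (arity x g) (fun j => ~~ contradicts x u g (child x g j))) &&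
  ((0 < claim x u g) ==> (claim x u g <= arity x g) &&
     ~~ supports x u g (child x g (claim x u g).-1)).

Definition region_ok (x : seq bool) (i u a : nat) : bool :=
  [&& low x u a < high x u a,
      (position x i a == 0) ==> (low x u a == 0),
      (0 < position x i a) ==>
        [&& 0 < low x u a, low x u a <= gates x & kind x (low x u a).-1 == 0]
    & (position x i a == ones x) ==> (high x u a == (gates x).+1)].

Definition row_ok (x : seq bool) (i u : nat) : bool :=
  [&& ball (2 ^ d) (fun a => region_ok x i u a),
      ~~ known d.+1 false x u (gates x).-1
    & ball (gates x) (fun g => (2 < arity x g) ==> claim_ok x u g)].

Definition compatible (x : seq bool) (i j u v : nat) : bool :=
  ball (2 ^ d) (fun r => digit_at x (radix x) u r == digit_at x (radix x) v r) &&
  ball (2 ^ d) (fun a => ball (2 ^ d) (fun b =>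
    ((position x i a == position x j b) ==>
       (low x u a == low x v b) && (high x u a == high x v b)) &&
    (((position x i a).+1 == position x j b) ==> (high x u a == low x v b)))).

Definition csp_rel (x : seq bool) (i j u v : nat) : bool :=
  [&& (i == j) ==> (u == v), row_ok x i u & compatible x i j u v].

(** The factor 2 makes the side of the torus even. [position] is consulted for the lowest [2 ^ d]
    digits, so each tuple of regions just occurs twice. *)
Definition csp_rows (x : seq bool) : nat := 2 * (ones x).+1 ^ (2 ^ d).
Definition csp_values (x : seq bool) : nat := radix x ^ (2 ^ d + 2 * 2 ^ d).

End Csp.

(** * Definability of the constraint problem *)

Lemma definable_radix : definable (fun x e => radix x).
Proof. rewrite /radix; dfn. Qed.
#[global] Hint Resolve definable_radix : dfn.

Lemma definable_position : definable (fun x e => position x (nth 0 e 0) (nth 0 e 1)).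
Proof. rewrite /position; dfn. Qed.
#[global] Hint Resolve definable_position : dfn.

Lemma definable_claim : definable (fun x e => claim x (nth 0 e 0) (nth 0 e 1)).
Proof. rewrite /claim; dfn. Qed.
#[global] Hint Resolve definable_claim : dfn.

Section Definability.

Variable d : nat.

Lemma definable_low : definable (fun x e => low d x (nth 0 e 0) (nth 0 e 1)).
Proof. rewrite /low; dfn. Qed.
Hint Resolve definable_low : dfn.

Lemma definable_high : definable (fun x e => high d x (nth 0 e 0) (nth 0 e 1)).
Proof. rewrite /high; dfn. Qed.
Hint Resolve definable_high : dfn.

Lemma definable_known_one : definable (fun x e => known_one d x (nth 0 e 0) (nth 0 e 1)).
Proof. rewrite /known_one; dfn. Qed.
Hint Resolve definable_known_one : dfn.

Lemma definable_known_zero : definable (fun x e => known_zero d x (nth 0 e 0) (nth 0 e 1)).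
Proof. rewrite /known_zero; dfn. Qed.
Hint Resolve definable_known_zero : dfn.

(** The depth [e] and the value [b] are fixed outside the term, so the recursion unfolds into a
    finite term. *)
Lemma definable_known e b : definable (fun x s => known d e b x (nth 0 s 0) (nth 0 s 1)).
Proof.
elim: e b => [|e IH] b /=; first exact: definable_const.
have IHt := IH true; have IHf := IH false; have IHb := IH b; have IHn := IH (~~ b).
by case: b IHb IHn => IHb IHn; dfn.
Qed.
Hint Resolve definable_known : dfn.

Lemma definable_contradicts :
  definable (fun x e => contradicts d x (nth 0 e 0) (nth 0 e 1) (nth 0 e 2)).
Proof. rewrite /contradicts; dfn. Qed.
Hint Resolve definable_contradicts : dfn.

Lemma definable_supports :
  definable (fun x e => supports d x (nth 0 e 0) (nth 0 e 1) (nth 0 e 2)).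
Proof. rewrite /supports; dfn. Qed.
Hint Resolve definable_supports : dfn.

Lemma definable_claim_ok : definable (fun x e => claim_ok d x (nth 0 e 0) (nth 0 e 1)).
Proof. rewrite /claim_ok; dfn. Qed.
Hint Resolve definable_claim_ok : dfn.

Lemma definable_region_ok :
  definable (fun x e => region_ok d x (nth 0 e 0) (nth 0 e 1) (nth 0 e 2)).
Proof. rewrite /region_ok; dfn. Qed.
Hint Resolve definable_region_ok : dfn.

Lemma definable_row_ok : definable (fun x e => row_ok d x (nth 0 e 0) (nth 0 e 1)).
Proof. rewrite /row_ok; dfn. Qed.
Hint Resolve definable_row_ok : dfn.

Lemma definable_csp_rel :
  definable (fun x e => csp_rel d x (nth 0 e 0) (nth 0 e 1) (nth 0 e 2) (nth 0 e 3)).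
Proof. rewrite /csp_rel /compatible; dfn. Qed.

Lemma definable_csp_rows : definable (fun x e => csp_rows d x).
Proof. rewrite /csp_rows; dfn. Qed.

Lemma definable_csp_values : definable (fun x e => csp_values d x).
Proof. rewrite /csp_values; dfn. Qed.

End Definability.

#[global] Hint Resolve definable_csp_rel definable_csp_rows definable_csp_values : dfn.

(** * Circuits read from their encoding *)

Lemma scan_rcons A (step : gate -> seq A -> A) c g :
  scan step (rcons c g) = rcons (scan step c) (step g (scan step c)).
Proof. by rewrite /scan foldl_rcons. Qed.

Lemma size_scan A (step : gate -> seq A -> A) c : size (scan step c) = size c.
Proof. by elim/last_ind: c => // c g IH; rewrite scan_rcons !size_rcons IH. Qed.

Lemma nth_scan A (a0 : A) (step : gate -> seq A -> A) c i : i < size c ->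
  nth a0 (scan step c) i = step (nth Input c i) (take i (scan step c)).
Proof.
elim/last_ind: c => // c g IH; rewrite size_rcons ltnS leq_eqVlt scan_rcons.
rewrite !nth_rcons size_scan -cats1 => /orP[/eqP->|lt].
  by rewrite !ltnn eqxx take_cat size_scan ltnn subnn take0 cats0.
by rewrite lt IH // take_cat size_scan lt.
Qed.

(** Course-of-values recursion: the value at [g] depends only on values at smaller arguments. *)
Lemma spec_exists m (F : (nat -> bool) -> nat -> bool) :
  (forall g V V', g < m -> (forall h, h < g -> V h = V' h) -> F V g = F V' g) ->
  exists V, forall g, g < m -> V g = F V g.
Proof.
elim: m => [|m IH] ext; first by exists xpred0.
have [|V hV] := IH; first by move=> g V V' lt; apply: ext; lia.
exists (fun g => if g == m then F V m else V g) => g; rewrite ltnS => le.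
have e : F V g = F (fun h => if h == m then F V m else V h) g.
  by apply: ext; [lia | move=> h lt; rewrite ifF //; lia].
rewrite -e; case: eqP => [->//|ne]; apply: hV; lia.
Qed.

Section Circuit.

Variables (k : nat) (c : circuit).
Hypothesis circ : is_circuit c.

Let nums := k :: flatten (map gate_code c).
Let x := code nums.
Let pre g := flatten (map gate_code (take g c)).

Lemma circuit_gt0 : 0 < size c. Proof. by case/and4P: circ. Qed.

Lemma gate_fan_in g : g < size c -> fan_in_ok (nth Input c g).
Proof. by case/and4P: circ => _ /all_nthP h _ _; apply: h. Qed.

Lemma preds_lt g h : g < size c -> h \in preds (nth Input c g) -> h < g.
Proof.
move=> lt; case/and4P: circ => _ _ /allP h1 _.
by have /allP := h1 g ltac:(by rewrite mem_iota); apply.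
Qed.

Lemma successor g : g < (size c).-1 ->
  exists2 i, i < size c & g \in preds (nth Input c i).
Proof.
move=> lt; case/and4P: circ => _ _ _ /allP h.
have /(has_nthP Input)[i li gp] := h g ltac:(by rewrite mem_iota).
by exists i.
Qed.

Lemma pre_recr g : g < size c -> pre g.+1 = pre g ++ gate_code (nth Input c g).
Proof. by move=> lt; rewrite /pre (take_nth Input) // map_rcons flatten_rcons. Qed.

Lemma flatten_pre g : g < size c -> exists r, flatten (map gate_code c) = pre g.+1 ++ r.
Proof.
move=> lt; exists (flatten (map gate_code (drop g.+1 c))).
by rewrite -flatten_cat -map_cat cat_take_drop.
Qed.

Lemma num_gate g j : g < size c -> j < size (gate_code (nth Input c g)) ->
  num x ((size (pre g)).+1 + j) = nth 0 (gate_code (nth Input c g)) j.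
Proof.
move=> lt lj; rewrite num_code /=; have [r ->] := flatten_pre lt.
rewrite pre_recr // -catA nth_cat ifF; last lia.
by rewrite addKn nth_cat lj.
Qed.

Lemma size_pre g : g < size c ->
  (size (pre g)).+1 + size (gate_code (nth Input c g)) <= size nums.
Proof.
move=> lt; have [r e] := flatten_pre lt.
by rewrite /nums -cat1s size_cat e pre_recr // !size_cat [size [:: k]]/=; lia.
Qed.

Lemma size_gate_code g : size (gate_code g) = (size (preds g)).+2.
Proof. by []. Qed.

Lemma offset_pre g : g <= size c -> offset x g = (size (pre g)).+1.
Proof.
rewrite /offset count_nums_code /lrec; elim: g => [_|g IH lt] /=.
  by rewrite /pre take0 /=; apply/minn_idPr.
rewrite IH ?(ltnW lt) // pre_recr // size_cat.
have h := num_gate (j := 1) lt ltac:(by []); rewrite addn1 in h; rewrite h.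
have := size_pre lt; rewrite size_gate_code -[nth 0 _ 1]/(size (preds (nth Input c g))).
rewrite -[(size (flatten _)).+1]/(size nums).
by move: (size nums) (size (preds _)) => n1 n2; lia.
Qed.

(** Beyond the circuit the recursion is held at its bound, the number of entries; this is how
    [gates] detects the end. *)
Lemma offset_ge g : size c <= g -> offset x g = size nums.
Proof.
move=> /subnK <-; elim: (g - size c) => [|n IH].
  by rewrite add0n offset_pre // /pre take_size.
have le : offset x (n + size c).+1 <= size nums by rewrite /offset count_nums_code lrec_le.
apply/eqP; rewrite eqn_leq le /offset /lrec /= -/(lrec _ _ _ _) -/(offset x (n + size c)) IH.
by rewrite count_nums_code leq_min leqnn /= -addnA leq_addr.
Qed.

Lemma gates_size : gates x = size c.
Proof.
rewrite /gates count_nums_code.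
have le : size c <= size nums.
  rewrite /= size_flatten /shape -map_comp.
  elim: (c) => //= g l IH; lia.
rewrite -(minn_idPr le) -bsum_lt; apply: eq_bsum => g _; congr nat_of_bool.
have [lt|ge] := ltnP g (size c); last by rewrite offset_ge // ltnn.
by rewrite offset_pre ?(ltnW lt) //; have := size_pre lt; rewrite size_gate_code; lia.
Qed.

Lemma ones_weight : ones x = k.
Proof. by rewrite /ones num_code. Qed.

Section Gate.
Variable g : nat.
Hypothesis lt : g < size c.
Let gt := nth Input c g.

Lemma kindE : kind x g = match gt with Input => 0 | Neg _ => 1 | Conj _ => 2 | Disj _ => 3 end.
Proof.
rewrite /kind offset_pre ?(ltnW lt) //.
by have h := num_gate (j := 0) lt ltac:(by []); rewrite addn0 in h; rewrite h.
Qed.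

Lemma arityE : arity x g = size (preds gt).
Proof.
rewrite /arity offset_pre ?(ltnW lt) //.
by have h := num_gate (j := 1) lt ltac:(by []); rewrite addn1 in h; rewrite h.
Qed.

Lemma childE j : j < arity x g -> child x g j = nth 0 (preds gt) j.
Proof.
rewrite arityE => lj; rewrite /child offset_pre ?(ltnW lt) // -addnA.
have h := num_gate (j := j.+2) lt; rewrite size_gate_code in h.
by rewrite h ?ltnS.
Qed.

Lemma child_in j : j < arity x g -> child x g j \in preds gt.
Proof. by move=> lj; rewrite childE // mem_nth // -arityE. Qed.

Lemma child_lt j : j < arity x g -> child x g j < g.
Proof. by move=> lj; apply: preds_lt (child_in lj). Qed.

Lemma arity_neg : kind x g = 1 -> arity x g = 1.
Proof. by rewrite kindE arityE; case: gt. Qed.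

(** Children are distinct and precede the gate. The bound makes a claim fit into one digit. *)
Lemma arity_le : arity x g <= size c.
Proof.
rewrite arityE; have := gate_fan_in lt; have pl h := @preds_lt g h lt; rewrite -/gt in pl *.
move=> ok; have u : uniq (preds gt) by move: ok; case: gt => //= l /andP[].
apply: leq_trans (ltnW lt); rewrite -(size_iota 0 g).
by apply: uniq_leq_size => // h /pl; rewrite mem_iota.
Qed.

End Gate.

(** One equation serves both connectives: a conjunction is true, and a disjunction false, exactly
    when all children are. *)
Definition gate_spec (a V : nat -> bool) (g : nat) : Prop :=
  [/\ kind x g = 0 -> V g = a g, kind x g = 1 -> V g = ~~ V (child x g 0)
    & 1 < kind x g -> (V g == (kind x g == 2)) =
        ball (arity x g) (fun j => V (child x g j) == (kind x g == 2))].

Lemma all_preds (p : pred nat) g : g < size c ->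
  ball (arity x g) (fun j => p (child x g j)) = all p (preds (nth Input c g)).
Proof.
move=> lt; apply/ballP/allP => [h i /(nthP 0)[j lj <-]|h j lj].
  by rewrite -arityE // in lj; rewrite -childE //; apply: h.
by apply: h; apply: child_in.
Qed.

Lemma output_spec a V : (forall g, g < size c -> gate_spec a V g) ->
  V (size c).-1 = output a c.
Proof.
move=> spec; rewrite /output.
have ns i := @nth_scan _ false (gate_value a) c i.
have ss := size_scan (gate_value a) c.
move: ns ss; set vs := scan _ c => ns ss.
have eqV g : g < size c -> V g = nth false vs g.
  have [n] := ubnP g; elim: n g => // n IH g lgn lt; rewrite ns //.
  have [h0 h1 h2] := spec g lt.
  have nt h : h \in preds (nth Input c g) -> nth false (take g vs) h = V h.
    move=> hp; have lh := preds_lt lt hp.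
    by rewrite nth_take // IH //; lia.
  have ar := arityE lt; have kd := kindE lt; have ap := all_preds _ lt.
  case E: (nth Input c g) nt ar kd ap => [|i|l|l] nt ar kd ap; rewrite /= in nt ar kd ap *.
  - by rewrite h0 // size_take ss lt.
  - by rewrite h1 // childE ?ar // E /= nt ?inE.
  - have := h2 ltac:(by rewrite kd); rewrite kd /= (ap (fun i => V i == true)) eqb_id => ->.
    by apply: eq_in_all => i /nt ->; rewrite eqb_id.
  - have := h2 ltac:(by rewrite kd); rewrite kd /= (ap (fun i => V i == false)) eqbF_neg.
    move=> e; rewrite -[V g]negbK e -has_predC; apply: eq_in_has => i /nt -> /=.
    by rewrite eqbF_neg negbK.
rewrite eqV ?nth_last //; last by have := circuit_gt0; lia.
by rewrite -ss nth_last.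
Qed.

(** * Depth, weft and the number of large gates *)

Section PathMax.

Variable wt : pred gate.

Let val i := nth 0 (scan (fun g vs => wt g + \max_(i <- preds g) nth 0 vs i) c) i.

Lemma path_max_last : val (size c).-1 = path_max wt c.
Proof.
rewrite /val /path_max; set sc := scan _ c.
by rewrite -nth_last /sc size_scan.
Qed.

Lemma path_max_step g h : g < size c -> h \in preds (nth Input c g) ->
  wt (nth Input c g) + val h <= val g.
Proof.
move=> lt hp; rewrite {2}/val nth_scan // leq_add2l.
apply: leq_trans (leq_bigmax_seq _ hp isT).
by rewrite nth_take // (preds_lt lt).
Qed.

Lemma path_max_self g : g < size c -> wt (nth Input c g) <= val g.
Proof. by move=> lt; rewrite /val nth_scan // leq_addr. Qed.

(** Successors lead from any node to the output, and the maximum never decreases on the way. *)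
Lemma path_max_le g : g < size c -> val g <= path_max wt c.
Proof.
move=> lt; have [n] := ubnP (size c - g); elim: n g lt => // n IH g lt ltn.
have [e|lt'] := leqP (size c).-1 g; first by rewrite -path_max_last (_ : g = (size c).-1) //; lia.
have [i li gi] := successor lt'.
have lgi := preds_lt li gi.
by apply: leq_trans (IH i li _); [have := path_max_step li gi; lia | lia].
Qed.

End PathMax.

Definition node_depth (g : nat) : nat :=
  nth 0 (scan (fun g vs => ~~ is_input g + \max_(i <- preds g) nth 0 vs i) c) g.
Definition node_weft (g : nat) : nat :=
  nth 0 (scan (fun g vs => (2 < size (preds g)) + \max_(i <- preds g) nth 0 vs i) c) g.

Lemma node_depth_le g : g < size c -> node_depth g <= depth c.
Proof. exact: (path_max_le (fun g => ~~ is_input g)). Qed.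

Lemma node_weft_le g : g < size c -> node_weft g <= weft c.
Proof. exact: (path_max_le (fun g => 2 < size (preds g))). Qed.

Lemma child_depth g j : g < size c -> j < arity x g ->
  node_depth (child x g j) < node_depth g.
Proof.
move=> lt lj; have hp := child_in lt lj.
have := path_max_step (fun g => ~~ is_input g) lt hp; rewrite -/(node_depth g) -/(node_depth _).
by move: hp; case: (nth Input c g).
Qed.

Inductive reaches (h : nat) : nat -> Prop :=
  | reaches_refl : reaches h h
  | reaches_step i g : reaches h i -> g < size c -> i \in preds (nth Input c g) -> reaches h g.

Lemma reaches_output g : g < size c -> reaches g (size c).-1.
Proof.
suff H i : i < size c -> reaches g i -> reaches g (size c).-1 by move=> lt; apply: H (reaches_refl g).
move=> lt; have [n] := ubnP (size c - i); elim: n i lt => // n IH i lt ltn ri.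
have [e|lt'] := leqP (size c).-1 i; first by rewrite (_ : (size c).-1 = i) //; lia.
have [s ls is_] := successor lt'; have := preds_lt ls is_ => lis.
by apply: (IH s) => //; [lia | apply: reaches_step ri ls is_].
Qed.

Lemma reaches_weft h g : h < size c -> 2 < arity x h -> reaches h g -> 0 < node_weft g.
Proof.
move=> lh large; elim=> [|i g' _ IH lt hp].
  rewrite arityE // in large.
  have := path_max_self (fun g => 2 < size (preds g)) lh.
  by rewrite large.
have := path_max_step (fun g => 2 < size (preds g)) lt hp.
rewrite -/(node_weft g') -/(node_weft i); lia.
Qed.

Hypothesis weft1 : weft c <= 1.

(* No large gate lies below another one, so that the large gates below a node
   are found by unfolding gates of fan-in at most 2. *)
Lemma few_large e g : g < size c -> node_depth g <= e ->
  exists2 l, size l <= 2 ^ e &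
    forall h, h < size c -> 2 < arity x h -> reaches h g -> h \in l.
Proof.
elim: e g => [|e IH] g lt dg.
  exists [::] => // h lh large r.
  have ar : arity x g = 0.
    by case ea: (arity x g) => [//|n]; have := child_depth (j := 0) lt; rewrite ea; lia.
  case: r lh large ar => [|i g' _ lg hp] lh large ar; first lia.
  by rewrite arityE // in ar; move: hp; case: (preds _) ar.
have [large|small] := ltnP 2 (arity x g).
  exists [:: g] => [|h lh lg r]; first by rewrite expn_gt0.
  case: r lt dg large => [|i g' r lt' hp] _ _ large; first by rewrite inE.
  have := path_max_step (fun g => 2 < size (preds g)) lt' hp.
  rewrite -/(node_weft g') -/(node_weft i) -arityE // large.
  have := reaches_weft lh lg r; have := node_weft_le lt'; lia.
have sub j : exists2 l, size l <= 2 ^ e & j < arity x g ->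
    forall h, h < size c -> 2 < arity x h -> reaches h (child x g j) -> h \in l.
  have [lj|_] := ltnP j (arity x g); last by exists [::].
  have lc := child_lt lt lj.
  have [||l sl hl] := IH (child x g j); first lia.
    by have := child_depth lt lj; lia.
  by exists l.
have [l0 s0 h0] := sub 0; have [l1 s1 h1] := sub 1.
exists (l0 ++ l1); first by rewrite size_cat expnS mul2n -addnn leq_add.
move=> h lh lg r; rewrite mem_cat.
case: r lt dg small h0 h1 {sub} => [|i g' r lt' hp] lt dg small h0 h1; first lia.
have [j lj ej] : exists2 j, j < arity x g' & i = child x g' j.
  case/(nthP 0): hp => j lj ej; rewrite -arityE // in lj.
  by exists j; rewrite // childE.
subst i; case: j lj r {hp} => [|[|j]] lj r; last lia.
  by rewrite h0.
by rewrite h1 ?orbT.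
Qed.

(** Every node reaches the output, so [few_large] applied there bounds the number of all large
    gates. *)
Lemma large_rank_lt g : g < size c -> 2 < arity x g -> large_rank x g < 2 ^ depth c.
Proof.
move=> lt lg.
have lo : (size c).-1 < size c by have := circuit_gt0; lia.
have [l sl hl] := few_large lo (node_depth_le lo).
apply: leq_trans sl.
have -> : large_rank x g = size [seq h <- iota 0 g | 2 < arity x h].
  rewrite size_filter /large_rank /bsum /index_iota subn0 -sum1_count [RHS]big_mkcond.
  by apply: eq_bigr => h _; case: (_ < _).
rewrite -(size_rcons _ g); apply: uniq_leq_size.
  by rewrite rcons_uniq mem_filter mem_iota add0n ltnn !andbF filter_uniq ?iota_uniq.
move=> h; rewrite mem_rcons inE mem_filter mem_iota => /orP[/eqP->|/andP[lh /andP[_ lth]]].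
  by apply: hl => //; apply: reaches_output.
by apply: hl; [lia | | apply: reaches_output; lia].
Qed.

Lemma weightE a : weight a c = count (fun i => (kind x i == 0) && a i) (iota 0 (size c)).
Proof.
apply: eq_in_count => i; rewrite mem_iota => /andP[_ lt].
by rewrite kindE // (set_nth_default Input (Neg 0)) //; case: (nth Input c i).
Qed.

End Circuit.

(** * Solutions and satisfying assignments *)

Fixpoint undigits (b L : nat) (h : nat -> nat) : nat :=
  if L is L'.+1 then undigits b L' (fun i => h i.+1) * b + h 0 else 0.

Lemma undigits_lt b L h : (forall i, i < L -> h i < b) -> undigits b L h < b ^ L.
Proof.
elim: L h => [|L IH] h hb //=.
have b0 : 0 < b by apply: leq_ltn_trans (hb 0 _).
rewrite expnSr -ltn_divLR // divnMDl // (divn_small (hb 0 isT)) addn0.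
by apply: IH => i lt; apply: hb.
Qed.

Lemma digit_undigits b L h i : (forall i, i < L -> h i < b) -> i < L ->
  digit b (undigits b L h) i = h i.
Proof.
elim: L h i => [|L IH] h i hb //= lt.
have b0 : 0 < b by apply: leq_ltn_trans (hb 0 _).
case: i lt => [_|i lt]; first by rewrite /digit divn1 modnMDl modn_small // hb.
rewrite /digit expnS divnMA divnMDl // (divn_small (hb 0 isT)) addn0.
by rewrite -/(digit b _ i) IH // => j lj; apply: hb.
Qed.

Section Reduction.

Variables (d k : nat) (c : circuit) (x : seq bool).
Hypotheses (circ : is_circuit c) (weft1 : weft c <= 1) (depthd : depth c <= d).
Hypothesis xE : x = code (k :: flatten (map gate_code c)).

Local Notation m := (size c).
Local Notation K := (csp_rows d x).
Local Notation cj g := (kind x g == 2).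

Let m_gt0 : 0 < m := circuit_gt0 circ.
Let gatesE : gates x = m. Proof. by rewrite xE gates_size. Qed.
Let onesE : ones x = k. Proof. by rewrite xE ones_weight. Qed.
Let radixE : radix x = m.+2. Proof. by rewrite /radix gatesE addn2. Qed.
Let child_small g j : g < m -> j < arity x g -> child x g j < g.
Proof. by rewrite xE => lt lj; exact: (child_lt circ lt lj). Qed.
Let arity_negation g : g < m -> kind x g = 1 -> arity x g = 1.
Proof. by rewrite xE; exact: (arity_neg circ). Qed.
Let arity_small g : g < m -> arity x g <= m.
Proof. by rewrite xE; exact: (arity_le k circ). Qed.
Let depth_child g j : g < m -> j < arity x g ->
  node_depth c (child x g j) < node_depth c g.
Proof. by rewrite xE; exact: (child_depth circ). Qed.
Let large_kind g : g < m -> 2 < arity x g -> 1 < kind x g.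
Proof. by move=> lt; rewrite xE arityE // kindE //; case: (nth Input c g). Qed.
Let weight_count a : weight a c = count (fun i => (kind x i == 0) && a i) (iota 0 m).
Proof. by rewrite xE -weightE. Qed.

Let spec (a V : nat -> bool) (g : nat) : Prop :=
  [/\ kind x g = 0 -> V g = a g, kind x g = 1 -> V g = ~~ V (child x g 0)
    & 1 < kind x g -> (V g == cj g) = ball (arity x g) (fun j => V (child x g j) == cj g)].

Let spec_output a V : (forall g, g < m -> spec a V g) -> V m.-1 = output a c.
Proof. by rewrite /spec xE; exact: (output_spec circ). Qed.

Let rank_lt g : g < m -> 2 < arity x g -> large_rank x g < 2 ^ d.
Proof.
rewrite xE => lt lg; apply: leq_trans (large_rank_lt circ weft1 lt lg) _.
by rewrite leq_exp2l.
Qed.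

Let exp_gt0 : 0 < 2 ^ d. Proof. by rewrite expn_gt0. Qed.

Let position_le i a : position x i a <= k.
Proof. by rewrite -ltnS /position onesE digit_lt. Qed.

(** * A solution from a satisfying assignment *)

Section FromAssignment.

Variable a : nat -> bool.
Hypotheses (weight_a : weight a c = k) (sat_a : output a c).

Let t := [seq i.+1 | i <- iota 0 m & (kind x i == 0) && a i].
(** Region [p] is the interval from [bd p] to [bd p.+1]: the leading 0 opens the first region and
    the default [m.+1] closes the last. *)
Let bd p := nth m.+1 (0 :: t) p.

Let size_t : size t = k.
Proof. by rewrite size_map size_filter -weight_count. Qed.

Let mem_t v : v \in t -> exists g, [/\ v = g.+1, g < m, kind x g = 0 & a g].
Proof.
by case/mapP => g; rewrite mem_filter mem_iota => /andP[/andP[/eqP kg ag] /andP[_ lt]] ->; exists g.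
Qed.

Let t_mem g : g < m -> kind x g = 0 -> a g -> g.+1 \in t.
Proof. by move=> lt kg ag; apply: map_f; rewrite mem_filter kg ag mem_iota. Qed.

Let bd_step p : p <= k -> bd p < bd p.+1.
Proof.
move=> le; have ltm v : v \in 0 :: t -> v < m.+1.
  by rewrite inE => /orP[/eqP->//|/mem_t[g [-> lt _ _]]].
have st : sorted ltn (0 :: t).
  rewrite /= path_sortedE; last exact: ltn_trans.
  apply/andP; split; first by apply/allP => v /mem_t[g [->]].
  rewrite sorted_map; apply: (sorted_filter (leT := fun i j => i.+1 < j.+1)).
    by move=> u v w; rewrite /= => h1 h2; lia.
  exact: iota_ltn_sorted.
have [lt|ge] := ltnP p k; last first.
  rewrite {2}/bd nth_default; last by rewrite /= size_t.
  by apply/ltm/mem_nth; rewrite /= size_t ltnS.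
by apply: (sortedP m.+1 st); rewrite /= size_t ltnS.
Qed.

Let bd_mono p q : p < q -> q <= k.+1 -> bd p < bd q.
Proof.
elim: q => // q IH; rewrite ltnS leq_eqVlt => /orP[/eqP->|lt] le; first exact: bd_step.
by apply: ltn_trans (IH lt _) (bd_step _); lia.
Qed.

Let bd_max : bd k.+1 = m.+1.
Proof. by rewrite /bd nth_default //= size_t. Qed.

Let bd_le p : p <= k.+1 -> bd p <= m.+1.
Proof. by rewrite leq_eqVlt => /orP[/eqP->|lt]; rewrite -bd_max // ltnW // bd_mono. Qed.

Let bd_in p : 0 < p <= k -> exists g, [/\ bd p = g.+1, g < m, kind x g = 0 & a g].
Proof.
case: p => // p /= le; apply: mem_t.
by rewrite /bd /= mem_nth // size_t.
Qed.

Let node_values : exists V, forall g, g < m -> V g =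
  if kind x g == 0 then a g else if kind x g == 1 then ~~ V (child x g 0)
  else (ball (arity x g) (fun j => V (child x g j) == cj g) == cj g).
Proof.
apply: (@spec_exists m (fun V g => if kind x g == 0 then a g else
  if kind x g == 1 then ~~ V (child x g 0) else
  (ball (arity x g) (fun j => V (child x g j) == cj g) == cj g))) => g V V' lt e.
case: eqP => // _; case: eqP => [k1|_].
  by rewrite e // child_small // arity_negation.
congr (_ == _); apply: eq_in_all => j; rewrite mem_iota => /andP[_ lj].
by rewrite e // child_small.
Qed.

Lemma csp_of_assignment : exists val, (forall i, i < K -> val i < csp_values d x) /\
  (forall i j, i < K -> j < K -> csp_rel d x i j (val i) (val j)).
Proof.
have [V hV] := node_values.
have Vspec g : g < m -> spec a V g.
  move=> lt; have e := hV g lt; split=> [k0|k1|k2]; rewrite e.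
  - by rewrite k0.
  - by rewrite k1.
  - by rewrite !ifF; [case: (ball _ _); case: (cj g) | lia | lia].
have Vout : V m.-1 by rewrite (spec_output Vspec).
pose cl g := if V g == cj g then 0
  else (find (fun j => V (child x g j) != cj g) (iota 0 (arity x g))).+1.
pose gr r := find (fun g => (2 < arity x g) && (large_rank x g == r)) (iota 0 m).
(* The digits of the value of row [i]: claims first, then the bounds of its regions, where the
   parity of [r - 2 ^ d] selects the lower or the upper one. *)
pose h i r := if r < 2 ^ d then (if gr r < m then cl (gr r) else 0)
  else bd (position x i ((r - 2 ^ d) %/ 2) + (r - 2 ^ d) %% 2).
have clP g : g < m -> 1 < kind x g -> V g != cj g ->
    cl g <= arity x g /\ V (child x g (cl g).-1) != cj g.
  move=> lt kg ne; rewrite /cl (negbTE ne).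
  have hs : has (fun j => V (child x g j) != cj g) (iota 0 (arity x g)).
    have [_ _ h2] := Vspec g lt; move: ne; rewrite h2 // /ball -has_predC.
    by apply: sub_has => j.
  split; first by move: (hs); rewrite has_find size_iota.
  have := nth_find 0 hs; rewrite nth_iota // ?add0n //.
  by move: (hs); rewrite has_find size_iota.
have cl_le g : g < m -> 2 < arity x g -> cl g <= m.
  move=> lt lg; have kg := large_kind lt lg.
  have [e|ne] := eqVneq (V g) (cj g); first by rewrite /cl e eqxx.
  by have [le _] := clP g lt kg ne; apply: leq_trans le (arity_small lt).
have grE g : g < m -> 2 < arity x g -> gr (large_rank x g) = g.
  move=> lt lg.
  have hs : has (fun g' => (2 < arity x g') && (large_rank x g' == large_rank x g)) (iota 0 m).
    by apply/hasP; exists g; rewrite ?mem_iota // lg eqxx.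
  have := nth_find 0 hs; rewrite -/(gr (large_rank x g)).
  have ltr : gr (large_rank x g) < m by move: (hs); rewrite has_find size_iota.
  rewrite nth_iota // add0n; move: (gr _) ltr => g' ltr /andP[lg' /eqP er].
  have mono u v : u < v -> 2 < arity x u -> large_rank x u < large_rank x v.
    move=> /subnK <- lu; rewrite addnC /large_rank bsum_add bsumS lu addn1.
    exact: leq_addr.
  case: (ltngtP g g') => // l'; first by have := mono _ _ l' lg; rewrite er ltnn.
  by have := mono _ _ l' lg'; rewrite er ltnn.
(* Claims are at most [m] and bounds at most [m.+1], whence the radix [m.+2]. *)
have h_lt i r : r < 2 ^ d + 2 * 2 ^ d -> h i r < radix x.
  move=> lt; rewrite radixE /h; case: ifP => _.
    case: ifP => // ltg; have hs : has (fun g => (2 < arity x g) && (large_rank x g == r)) (iota 0 m).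
      by rewrite has_find size_iota.
    have := nth_find 0 hs; rewrite -/(gr r) nth_iota // add0n => /andP[lg _].
    by have := cl_le _ ltg lg; lia.
  rewrite ltnS; apply: bd_le; rewrite -[k.+1]addn1 leq_add ?position_le //.
  by rewrite -ltnS ltn_mod.
pose val i := undigits (radix x) (2 ^ d + 2 * 2 ^ d) (h i).
have digE i r : r < 2 ^ d + 2 * 2 ^ d -> digit_at x (radix x) (val i) r = h i r.
  by move=> lt; rewrite /digit_at digit_undigits // => r'; apply: h_lt.
have claimE i g : g < m -> 2 < arity x g -> claim x (val i) g = cl g.
  move=> lt lg; have rl := rank_lt lt lg.
  by rewrite /claim digE ?(leq_trans rl) ?leq_addr // /h rl grE // lt.
have lowE i b : b < 2 ^ d -> low d x (val i) b = bd (position x i b).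
  move=> lt; rewrite /low digE ?ltn_add2l ?ltn_mul2l //.
  by rewrite /h ltnNge leq_addr /= addKn mulKn // modnMr addn0.
have highE i b : b < 2 ^ d -> high d x (val i) b = bd (position x i b).+1.
  move=> lt; rewrite /high digE; last by move: (2 ^ d) lt => G; lia.
  rewrite /h ifF; last by apply/negbTE; rewrite -leqNgt -addnA leq_addr.
  rewrite -addnA addKn mulnC divnMDl // divn_small // addn0 modnMDl.
  by rewrite modn_small // addn1.
(* Soundness: whatever a row knows is true under [V], so no row can reject. *)
have knownP i e b g : g < m -> known d e b x (val i) g -> V g = b.
  elim: e b g => // e IH b g lt /=; have [s0 s1 s2] := Vspec g lt.
  case/or4P.
  - case/andP => /eqP k0; rewrite s0 //; case: b.
      case/bexP => p lp; rewrite lowE // => /eqP eb.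
      case: (position x i p) (position_le i p) eb => [|q] le; first by rewrite /bd.
      by have [|g' [-> _ _ ag]] := @bd_in q.+1 => // -[<-].
    (* If [g] were true, [g.+1] would be a bound strictly between two consecutive bounds. *)
    case/bexP => p lp; rewrite lowE // highE // => /andP[l1 l2]; apply/negbTE/negP => ag.
    have /(nthP m.+1)[q lq eq] := t_mem lt k0 ag; rewrite size_t in lq.
    have eb : bd q.+1 = g.+1 by rewrite -eq.
    have le := position_le i p; move: l1 l2; rewrite -eb; move: (position x i p) le => p' le.
    have [lt1|lt2] := ltnP p' q.+1.
      move=> _; have [->|ne] := eqVneq p' q; first by rewrite ltnn.
      by have := @bd_mono p'.+1 q.+1; lia.
    by have [->|ne] := eqVneq p' q.+1; [rewrite ltnn | have := @bd_mono q.+1 p'; lia].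
  - case/andP => /eqP k1 kn; rewrite s1 //.
    have lc : child x g 0 < m.
      by have l0 : 0 < arity x g; [rewrite arity_negation | apply: ltn_trans (child_small lt l0) lt].
    by rewrite (IH _ _ lc kn) negbK.
  - case/andP => /andP[k2 lg]; rewrite claimE // => /eqP e1.
    move: e1; rewrite /cl; case: (V g =P cj g) => [->|ne]; first by move=> /eqP.
    by case: b (cj g) (V g) ne => [] [] [].
  - case/andP => /andP[k2 _] /orP[] /andP[bc].
      move/ballP => al; rewrite (eqP bc); apply/eqP; rewrite s2 //.
      apply/ballP => j lj; rewrite (IH b) //; last exact: al.
      by apply: ltn_trans (child_small lt lj) lt.
    case/bexP => j lj kn.
    have ej : V (child x g j) = b by apply: IH kn; apply: ltn_trans (child_small lt lj) lt.
    have nb : V g != cj g.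
      by rewrite s2 //; apply/negP => /ballP/(_ j lj); rewrite ej => /eqP e1; rewrite e1 eqxx in bc.
    by case: b (cj g) (V g) bc nb {kn ej} => [] [] [].
have ltK i : i < K -> val i < csp_values d x by move=> _; apply: undigits_lt => r; apply: h_lt.
exists val; split=> // i j iK jK; apply/and3P; split.
- by apply/implyP => /eqP->.
- apply/and3P; split.
  + apply/ballP => b lb; rewrite /region_ok lowE // highE // gatesE onesE.
    have le := position_le i b; move: (position x i b) le => p le.
    apply/and4P; split; first exact: bd_step.
    * by apply/implyP => /eqP->.
    * apply/implyP => p0; have [|g [-> lt kg _]] := @bd_in p; first by rewrite p0.
      by rewrite /= lt kg.
    * by apply/implyP => /eqP->; rewrite bd_max.
  + rewrite gatesE; apply/negP => /knownP e.
    by rewrite e ?prednK // in Vout.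
  + rewrite gatesE; apply/ballP => g lt; apply/implyP => lg.
    have kg := large_kind lt lg; have [_ _ s2] := Vspec g lt.
    have lc q : q < arity x g -> child x g q < m.
      by move=> lq; apply: ltn_trans (child_small lt lq) lt.
    rewrite /claim_ok claimE //; apply/andP; split; apply/implyP.
      rewrite {1}/cl; case: ifP => // e _; apply/ballP => q lq.
      move: e; rewrite s2 // => /ballP/(_ q lq) => /eqP e.
      apply/negP; rewrite /contradicts => /orP[] /andP[kk] /(knownP _ _ _ _ (lc _ lq)).
        by rewrite e kk.
      by rewrite e (negbTE kk).
    move=> c0; have ne : V g != cj g by move: c0; rewrite {1}/cl; case: ifP.
    have [le nv] := clP g lt kg ne; rewrite le /=.
    have lq : (cl g).-1 < arity x g by lia.
    apply/negP; rewrite /supports => /orP[] /andP[kk] /(knownP _ _ _ _ (lc _ lq)) e.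
      by rewrite e kk in nv.
    by rewrite e (negbTE kk) in nv.
- apply/andP; split.
    apply/ballP => r lr; rewrite !digE ?(leq_trans lr) ?leq_addr //.
    by rewrite /h lr.
  apply/ballP => b lb; apply/ballP => b' lb'; rewrite !lowE // !highE //.
  by apply/andP; split; apply/implyP => /eqP->; rewrite ?eqxx.
Qed.

End FromAssignment.

(** * A satisfying assignment from a solution *)

Section FromSolution.

Variable val : nat -> nat.
Hypothesis valP : forall i j, i < K -> j < K -> csp_rel d x i j (val i) (val j).

Let ltK p : p <= k -> p < K.
Proof.
move=> le; rewrite /csp_rows onesE.
have : k.+1 <= k.+1 ^ (2 ^ d) by apply: leq_exp_id.
lia.
Qed.

Let K_gt0 : 0 < K. Proof. exact: ltK. Qed.

Let rowP i : i < K -> row_ok d x i (val i).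
Proof. by move=> iK; have /and3P[] := valP iK iK. Qed.

(** For [p <= k] the first region of row [p] is region [p], so its bounds are read off there;
    compatibility makes all other rows agree. *)
Let lo p := low d x (val p) 0.
Let hi p := high d x (val p) 0.

Let position0 p : p <= k -> position x p 0 = p.
Proof. by move=> le; rewrite /position /digit_at /digit onesE divn1 modn_small. Qed.

Let compatP i j b b' : i < K -> j < K -> b < 2 ^ d -> b' < 2 ^ d ->
  (position x i b = position x j b' ->
     low d x (val i) b = low d x (val j) b' /\ high d x (val i) b = high d x (val j) b') /\
  ((position x i b).+1 = position x j b' -> high d x (val i) b = low d x (val j) b').
Proof.
move=> iK jK lb lb'; have /and3P[_ _ /andP[_ /ballP/(_ b lb)/ballP/(_ b' lb')]] := valP iK jK.
case/andP => /implyP h1 /implyP h2; split=> e.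
  by have /andP[/eqP-> /eqP->] := h1 ltac:(by rewrite e).
by apply/eqP/h2; rewrite e.
Qed.

Let lowE i b : i < K -> b < 2 ^ d -> low d x (val i) b = lo (position x i b).
Proof.
move=> iK lb; have le := position_le i b.
by have [h _] := compatP iK (ltK le) lb exp_gt0; have [|-> _] := h; rewrite ?position0.
Qed.

Let highE i b : i < K -> b < 2 ^ d -> high d x (val i) b = hi (position x i b).
Proof.
move=> iK lb; have le := position_le i b.
by have [h _] := compatP iK (ltK le) lb exp_gt0; have [|_ ->] := h; rewrite ?position0.
Qed.

Let regionP p : p <= k -> [/\ lo p < hi p, p = 0 -> lo p = 0,
  0 < p -> [/\ 0 < lo p, lo p <= m & kind x (lo p).-1 = 0] & p = k -> hi p = m.+1].
Proof.
move=> le; have /and3P[/ballP/(_ 0 exp_gt0) h _ _] := rowP (ltK le).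
move: h; rewrite /region_ok position0 // gatesE onesE => /and4P[h1 /implyP h2 /implyP h3 /implyP h4].
split=> //.
- by move=> p0; apply/eqP/h2; rewrite p0.
- by move=> /h3/and3P[a1 a2 /eqP a3].
- by move=> pk; apply/eqP/h4; rewrite pk.
Qed.

Let hi_lo p : p < k -> hi p = lo p.+1.
Proof.
move=> lt; have [_ h] := compatP (ltK (ltnW lt)) (ltK lt) exp_gt0 exp_gt0.
by apply: h; rewrite !position0 // ltnW.
Qed.

Let lo_mono p q : p < q -> q <= k -> hi p <= lo q.
Proof.
elim: q => // q IH; rewrite ltnS leq_eqVlt => /orP[/eqP->|lt] le; first by rewrite hi_lo.
rewrite -hi_lo //; have [h _ _ _] := regionP (ltnW le).
by apply: leq_trans (IH lt (ltnW le)) (ltnW h).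
Qed.

(** Region 0 is opened by no input, so only the lower bounds of the later regions count. *)
Let a g := bex k (fun p => lo p.+1 == g.+1).

Let region_of g : g < m -> exists2 p, p <= k & lo p <= g.+1 < hi p.
Proof.
move=> lt.
suff H n p : p + n = k -> lo p <= g.+1 -> exists2 p, p <= k & lo p <= g.+1 < hi p.
  by apply: (H k 0) => //; have [_ -> ] := regionP (leq0n k).
elim: n p => [|n IH] p.
  rewrite addn0 => -> le; exists k; rewrite // le /=.
  by have [_ _ _ ->] := regionP (leqnn k).
move=> e le; have [lth|] := ltnP g.+1 (hi p); first by exists p; [lia | rewrite le].
by rewrite hi_lo => [h|]; [apply: (IH p.+1) => //; lia | lia].
Qed.

Let a_region g p : p <= k -> lo p <= g.+1 < hi p -> a g = (lo p == g.+1).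
Proof.
move=> le /andP[h1 h2]; apply/bexP/eqP => [[q lq /eqP e]|e].
  case: (ltngtP p q.+1) => [lt|lt|->//].
    by have := lo_mono lt lq; lia.
  by have := lo_mono lt le; have [h _ _ _] := regionP lq; lia.
case: p le h1 h2 e => [|p] le h1 h2 e; last by exists p; rewrite // e.
by have [_ h0 _ _] := regionP le; rewrite h0 in e.
Qed.

Let weight_a : weight a c = k.
Proof.
rewrite weight_count -size_filter.
transitivity (size [seq (lo p.+1).-1 | p <- iota 0 k]); last by rewrite size_map size_iota.
have pos p : p < k -> [/\ 0 < lo p.+1, lo p.+1 <= m & kind x (lo p.+1).-1 = 0].
  by move=> lt; have [_ _ h _] := regionP lt; apply: h.
apply/eqP; rewrite eqn_leq; apply/andP; split; apply: uniq_leq_size.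
- by rewrite filter_uniq ?iota_uniq.
- move=> g; rewrite mem_filter => /andP[/andP[_ /bexP[p lp /eqP e]] _].
  by apply/mapP; exists p; rewrite ?mem_iota // e.
- rewrite map_inj_in_uniq ?iota_uniq // => p q; rewrite !mem_iota => /andP[_ lp] /andP[_ lq] e.
  have [p0 _ _] := pos p lp; have [q0 _ _] := pos q lq.
  have {}e : lo p.+1 = lo q.+1 by lia.
  have [hp _ _ _] := regionP lp; have [hq _ _ _] := regionP lq.
  case: (ltngtP p q) => // lt.
    by have := @lo_mono p.+1 q.+1 lt lq; lia.
  by have := @lo_mono q.+1 p.+1 lt lp; lia.
- move=> g /mapP[p]; rewrite mem_iota => /andP[_ lp] ->; have [p0 pm pk] := pos p lp.
  rewrite mem_filter pk eqxx mem_iota /=; apply/andP; split; last lia.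
  by apply/bexP; exists p; rewrite // prednK.
Qed.

Let cl g := claim x (val 0) g.

Let claimE i g : i < K -> g < m -> 2 < arity x g -> claim x (val i) g = cl g.
Proof.
move=> iK lt lg; have /and3P[_ _ /andP[/ballP h _]] := valP iK K_gt0.
exact/eqP/h/rank_lt.
Qed.

(** Large gates take the value they claim instead of the one computed from their children; that the
    two agree is proved below as [Vspec]. *)
Let claimed_values : exists V, forall g, g < m -> V g =
  if kind x g == 0 then a g else if kind x g == 1 then ~~ V (child x g 0)
  else if 2 < arity x g then (cl g == 0) == cj g
  else (ball (arity x g) (fun j => V (child x g j) == cj g) == cj g).
Proof.
apply: (@spec_exists m (fun V g => if kind x g == 0 then a g else
  if kind x g == 1 then ~~ V (child x g 0) else if 2 < arity x g then (cl g == 0) == cj g else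
  (ball (arity x g) (fun j => V (child x g j) == cj g) == cj g))) => g V V' lt e.
case: eqP => // _; case: eqP => [k1|_].
  by rewrite e // child_small // arity_negation.
case: ifP => // _; congr (_ == _); apply: eq_in_all => j; rewrite mem_iota => /andP[_ lj].
by rewrite e // child_small.
Qed.

Let covers (ps : seq nat) i := forall p, p \in ps -> exists2 b, b < 2 ^ d & position x i b = p.

Let cover_exists ps : size ps <= 2 ^ d -> (forall p, p \in ps -> p <= k) ->
  exists2 i, i < K & covers ps i.
Proof.
move=> sp hp.
(* A short list is padded with region 0, the default of [nth]. *)
have hb r : r < 2 ^ d -> nth 0 ps r < k.+1.
  move=> _; have [lt|ge] := ltnP r (size ps); last by rewrite nth_default.
  by rewrite ltnS hp // mem_nth.
have lti := undigits_lt hb; set i := undigits _ _ _ in lti.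
exists i; first by rewrite /csp_rows onesE; lia.
move=> p pp; have lt : index p ps < 2 ^ d by apply: leq_trans sp; rewrite index_mem.
exists (index p ps) => //.
by rewrite /position /digit_at onesE digit_undigits // nth_index.
Qed.

Lemma assignment_of_csp : exists a, weight a c = k /\ output a c.
Proof.
have [V hV] := claimed_values.
(* A node unfolds to at most [2 ^ e] inputs before large gates are met. *)
have complete e g : g < m -> node_depth c g <= e -> exists ps,
    [/\ size ps <= 2 ^ e, forall p, p \in ps -> p <= k
      & forall i, i < K -> covers ps i -> known d e.+1 (V g) x (val i) g].
  have [n] := ubnP e; elim: n e g => // n IH e g len lt de; have VE := hV g lt.
  (* The halved bound leaves room for the lists of two children. *)
  have sub j : exists ps, [/\ size ps * 2 <= 2 ^ e, forall p, p \in ps -> p <= k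
      & j < arity x g -> forall i, i < K -> covers ps i ->
          known d e (V (child x g j)) x (val i) (child x g j)].
    have [lj|_] := ltnP j (arity x g); last by exists [::].
    have dc := depth_child lt lj; have lc := ltn_trans (child_small lt lj) lt.
    case: e len de => [|e] len de; first lia.
    have [||ps [h1 h2 h3]] := IH e (child x g j) _ lc; [lia | lia |].
    by exists ps; split=> //; rewrite expnSr leq_mul2r h1 orbT.
  have [k0|kn0] := eqVneq (kind x g) 0.
    have [p lp rg] := region_of lt.
    exists [:: p]; split=> [|q|i iK cv]; rewrite ?inE ?expn_gt0 //; first by move=> /eqP->.
    have [b lb eb] := cv p (mem_head _ _).
    rewrite /= VE k0 /= (a_region lp rg); apply/orP; left.
    case: eqP => e1; apply/bexP; exists b; rewrite // lowE // ?highE // eb; first exact/eqP.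
    by case/andP: rg => rg1 rg2; rewrite rg2 andbT ltn_neqAle rg1 andbT; apply/eqP.
  have [k1|kn1] := eqVneq (kind x g) 1.
    have [ps [h1 h2 h3]] := sub 0; exists ps; split=> [|//|i iK cv].
      by apply: leq_trans h1; rewrite leq_pmulr.
    by rewrite /= VE k1 /= negbK h3 // arity_negation.
  have kg : 1 < kind x g by move: kn0 kn1; case: (kind x g) => [|[|]].
  rewrite (negbTE kn0) (negbTE kn1) in VE.
  have [lg|sm] := ltnP 2 (arity x g).
    (* The claim alone decides a large gate, in every row. *)
    exists [::]; split=> // i iK _; rewrite /= kg lg claimE // VE lg.
    apply/or4P; apply: Or43 => /=.
    by case: (cl g == 0); case: (cj g).
  have [p0 [s0 h0 k0]] := sub 0; have [p1 [s1 h1 k1]] := sub 1.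
  exists (p0 ++ p1); split=> [|p|i iK cv]; first by rewrite size_cat; lia.
    by rewrite mem_cat => /orP[/h0|/h1].
  have kc j : j < arity x g -> known d e (V (child x g j)) x (val i) (child x g j).
    case: j => [|[|j]] lj; last by lia.
      by apply: k0 => // p pp; apply: cv; rewrite mem_cat pp.
    by apply: k1 => // p pp; apply: cv; rewrite mem_cat pp orbT.
  rewrite ltnNge sm /= in VE.
  rewrite /= kg sm; apply/or4P; apply: Or44 => /=.
  have [al|nal] := boolP (ball (arity x g) (fun j => V (child x g j) == cj g)).
    have -> : V g = cj g by rewrite VE al; case: (cj g).
    rewrite eqxx /=; apply/orP; left; apply/ballP => j lj.
    by have /ballP/(_ j lj)/eqP <- := al; apply: kc.
  have e1 : V g = ~~ cj g by rewrite VE (negbTE nal); case: (cj g).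
  have -> : (V g == cj g) = false by rewrite e1; case: (cj g).
  move: nal; rewrite /ball -has_predC => /hasP[j]; rewrite mem_iota => /andP[_ lj] /= ne.
  apply/bexP; exists j => //; have <- : V (child x g j) = V g; last exact: kc.
  by rewrite e1; case: (V _) (cj g) ne => [] [].
(* Completeness: for each node some row knows its value, and that row was not rejected. *)
have witness g : g < m -> exists2 i, i < K & known d d.+1 (V g) x (val i) g.
  move=> lt; have [ps [h1 h2 h3]] := complete d g lt (leq_trans (node_depth_le circ lt) depthd).
  by have [i iK cv] := cover_exists h1 h2; exists i => //; apply: h3.
have Vspec g : g < m -> spec a V g.
  move=> lt; have e := hV g lt; split=> [k0|k1|kg].
  - by rewrite e k0.
  - by rewrite e k1.
  have [n0 n1] : (kind x g == 0) = false /\ (kind x g == 1) = false by lia.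
  rewrite n0 n1 in e.
  have [lg|sm] := ltnP 2 (arity x g); last first.
    by rewrite e ltnNge sm /=; case: (ball _ _); case: (cj g).
  rewrite lg in e.
  have clm i : i < K -> claim_ok d x (val i) g.
    by move=> iK; have /and3P[_ _ /ballP h] := rowP iK; have := h g; rewrite gatesE lg; apply.
  have lc j : j < arity x g -> child x g j < m.
    by move=> lj; apply: ltn_trans (child_small lt lj) lt.
  have [c0|c0] := posnP (cl g).
    rewrite e c0 eqxx (_ : ball _ _) ?eqb_id; last first.
      (* A child of the wrong value would be known as such in row [i], which would reject the claim
         0. *)
      apply/ballP => j lj; have [i iK kn] := witness _ (lc j lj).
      have /andP[/implyP h _] := clm i iK; rewrite claimE // c0 in h.
      have /ballP/(_ j lj) := h (eqxx _); rewrite /contradicts negb_or !negb_and.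
      by case: (V _) kn => kn; case: (cj g); rewrite kn.
    by case: (cj g).
  have [i iK _] := witness _ lt; have /andP[_ /implyP] := clm i iK.
  rewrite claimE // => /(_ c0)/andP[lej _].
  have lj : (cl g).-1 < arity x g by lia.
  (* If the named child had the uniform value after all, row [i'] would know it and reject the
     claim. *)
  have [i' iK' kn] := witness _ (lc _ lj).
  have /andP[_ /implyP] := clm i' iK'; rewrite claimE // => /(_ c0)/andP[_].
  rewrite /supports negb_or !negb_and => ns.
  rewrite e gtn_eqF // (_ : ball _ _ = false); first by case: (cj g).
  apply/negbTE/negP => /ballP/(_ _ lj)/eqP ev; rewrite ev in kn.
  by case: (cj g) ns kn => ns kn; rewrite kn in ns.
exists a; split; first exact: weight_a.
rewrite -(spec_output Vspec); have lo1 : m.-1 < m by rewrite prednK.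
(* Were the output false, this row would know it, which [row_ok] forbids. *)
have [i iK] := witness _ lo1; have /and3P[_ + _] := rowP iK; rewrite gatesE.
by case: (V m.-1) => // /negbTE->.
Qed.

End FromSolution.

End Reduction.

(** * The reduction *)

Section DefinableTorus.

Variables (K D : seq bool -> nat) (R : seq bool -> nat -> nat -> nat -> nat -> bool).
Hypotheses (dK : definable (fun x e => K x)) (dD : definable (fun x e => D x)).
Hypothesis dR : definable (fun x e => R x (nth 0 e 0) (nth 0 e 1) (nth 0 e 2) (nth 0 e 3)).

Lemma definable_free_total : definable (fun x e => free_total (K x) (D x) (R x)).
Proof.
rewrite /free_total /free_weight /choice_weight /hscale /vscale /base.
by rewrite /kind_of /i_of /j_of /u_of /v_of /rank_of /period; dfn.
Qed.
Hint Resolve definable_free_total : dfn.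

Lemma definable_bin_capacity : definable (fun x e => bin_capacity (K x) (D x) (R x)).
Proof. by rewrite /bin_capacity /cell_space /base; dfn. Qed.
Hint Resolve definable_bin_capacity : dfn.

Lemma definable_torus_weight :
  definable (fun x e => torus_weight (K x) (D x) (R x) (nth 0 e 0)).
Proof.
rewrite /torus_weight /private_weight /cell_space.
rewrite /free_weight /choice_weight /hscale /vscale /base.
by rewrite /kind_of /i_of /j_of /u_of /v_of /rank_of /period; dfn.
Qed.

Lemma definable_torus_p : definable (fun x e => torus_p (K x) (D x) (nth 0 e 0)).
Proof.
rewrite /torus_p /private_bin /cell.
by rewrite /kind_of /i_of /j_of /rank_of /period; dfn.
Qed.

Lemma definable_torus_q : definable (fun x e => torus_q (K x) (D x) (nth 0 e 0)).
Proof.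
rewrite /torus_q /private_bin /cell.
by rewrite /kind_of /i_of /j_of /rank_of /period; dfn.
Qed.

End DefinableTorus.

Section DefinableGraph.

Variables (B T M C : seq bool -> nat) (w p q : seq bool -> nat -> nat).
Hypotheses (dB : definable (fun x e => B x)) (dT : definable (fun x e => T x)).
Hypotheses (dM : definable (fun x e => M x)) (dC : definable (fun x e => C x)).
Hypothesis dw : definable (fun x e => w x (nth 0 e 0)).
Hypothesis dp : definable (fun x e => p x (nth 0 e 0)).
Hypothesis dq : definable (fun x e => q x (nth 0 e 0)).

Definition packing_order (x : seq bool) : nat := B x + T x * M x.

Definition packing_adj (x : seq bool) : nat -> nat -> bool :=
  adj (B x) (M x) (w x) (p x) (q x).

(** The encoded instance as a function of the index, the form that [emit] prints; three header
    entries shift the adjacency matrix. *)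
Definition packing_entry (x : seq bool) (i : nat) : nat :=
  ifn (i == 0) (packing_order x) (ifn (i == 1) (C x)
    (ifn (i == 2) (packing_target (T x) (w x))
       (packing_adj x ((i - 3) %/ packing_order x) ((i - 3) %% packing_order x)))).

Definition packing_length (x : seq bool) : nat := 3 + packing_order x * packing_order x.

Lemma definable_packing_order : definable (fun x e => packing_order x).
Proof. by rewrite /packing_order; dfn. Qed.
Hint Resolve definable_packing_order : dfn.

Lemma definable_packing_adj : definable (fun x e => packing_adj x (nth 0 e 0) (nth 0 e 1)).
Proof.
by rewrite /packing_adj /adj /lower_adj /served /mates /present /item /slot; dfn.
Qed.
Hint Resolve definable_packing_adj : dfn.

Lemma definable_packing_entry : definable (fun x e => packing_entry x (nth 0 e 0)).
Proof. by rewrite /packing_entry /packing_target; dfn. Qed.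

Lemma definable_packing_length : definable (fun x e => packing_length x).
Proof. by rewrite /packing_length; dfn. Qed.

Lemma allpairs_iota (g : nat -> nat -> nat) m n :
  [seq g a b | a <- iota 0 m, b <- iota 0 n] =
  mkseq (fun i => g (i %/ n) (i %% n)) (m * n).
Proof.
elim: m => [|m IH]; first by rewrite mul0n.
rewrite -{1}addn1 iotaD allpairs_cat IH /= cats0 mulSnr /mkseq iotaD map_cat add0n.
congr (_ ++ _); rewrite -[m * n]addn0 (iotaDl (m * n) 0) -map_comp.
apply/eq_in_map => b; rewrite mem_iota => /andP[_ lt] /=.
by rewrite divnMDl ?divn_small ?addn0 ?modnMDl ?modn_small //; lia.
Qed.

Lemma adjacency_packing x :
  adjacency (packing_edges (B x) (T x) (M x) (w x) (p x) (q x)) =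
  mkseq (fun i => nat_of_bool (packing_adj x (i %/ packing_order x) (i %% packing_order x)))
        (packing_order x * packing_order x).
Proof.
rewrite -(allpairs_iota (fun a b => packing_adj x a b)) -val_enum_ord.
rewrite /adjacency allpairs_mapl allpairs_mapr.
by apply: eq_allpairs => u v; rewrite mem_packing_edges.
Qed.

Lemma packing_encoding x :
  [:: packing_order x, C x, packing_target (T x) (w x)
   & adjacency (packing_edges (B x) (T x) (M x) (w x) (p x) (q x))] =
  mkseq (packing_entry x) (packing_length x).
Proof.
rewrite adjacency_packing /packing_length /mkseq iotaD map_cat /=; congr [:: _, _, _ & _].
rewrite -[0 + 3]addn0 (iotaDl 3 0) -map_comp; apply: eq_map => i /=.
by rewrite /packing_entry /ifn !add3n /= !subSS subn0.
Qed.

End DefinableGraph.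

Theorem theorem1p8 : W_hard 1 coalition_by_twin_cover.
Proof.
move=> Q [d _ red].
pose K := csp_rows d; pose D := csp_values d; pose R := csp_rel d.
pose B x := torus_bins (K x); pose T x := torus_items (K x) (D x).
(* [M] is the number of vertices reserved for each item, a bound on its weight by
   [torus_weight_le]. *)
pose C x := bin_capacity (K x) (D x) (R x); pose M x := 2 * C x.
pose w x := torus_weight (K x) (D x) (R x).
pose p x := torus_p (K x) (D x); pose q x := torus_q (K x) (D x).
have dK : definable (fun x e => K x) := definable_csp_rows d.
have dD : definable (fun x e => D x) := definable_csp_values d.
have dR := definable_csp_rel d.
have dC : definable (fun x e => C x) := definable_bin_capacity dK dD dR.
have dM : definable (fun x e => M x) by rewrite /M; dfn.
have dB : definable (fun x e => B x) by rewrite /B /torus_bins; dfn.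
have dT : definable (fun x e => T x) by rewrite /T /torus_items /period; dfn.
have dw : definable (fun x e => w x (nth 0 e 0)) := definable_torus_weight dK dD dR.
have dp : definable (fun x e => p x (nth 0 e 0)) := definable_torus_p dK dD.
have dq : definable (fun x e => q x (nth 0 e 0)) := definable_torus_q dK dD.
(* The number of bins, which depends on [k] only because the side of the torus does. *)
pose G k := torus_bins (2 * k.+1 ^ (2 ^ d)).
apply: (fpt_reducible_trans_definable (G := G) (definable_packing_length dB dT dM)
  (definable_packing_entry dB dT dM dC dw dp dq) _ _ _ red).
- by rewrite /G /torus_bins; dfn.
- move=> i j le; rewrite /G /torus_bins ltnS.
  by rewrite leq_mul // leq_mul2l /= leq_exp2r ?expn_gt0.
move=> y; pose x := encode y; case: y @x => c k hc x.
have /and3P[circ weft1 depthd] := hc.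
have xE : x = code (k :: flatten (map gate_code c)) by [].
exists (CoalitionInstance (C x) (packing_target (T x) (w x))
   (packing_edges_card2 (B x) (T x) (M x) (w x) (p x) (q x))).
have K_gt0 : 0 < K x by rewrite muln_gt0 expn_gt0.
have K_even : K x %% 2 = 0 by rewrite modnMr.
have D_gt1 : 1 < D x.
  by rewrite /D /csp_values exp_gt1 // /radix; [lia | rewrite addn_gt0 expn_gt0].
have C_gt0 : 0 < C x by apply: bin_capacity_gt0.
have M_gt0 : 0 < M x by rewrite muln_gt0.
split.
- exact (congr1 code (packing_encoding B T M C w p q x)).
- rewrite /yes /= /coalition_yes /= packingP //; last first.
  + by move=> b; apply: torus_private_large.
  + by move=> t _; apply: torus_q_lt.
  + by move=> t _; apply: torus_p_lt.
  + by move=> t; apply: torus_weight_le.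
  split=> [[a [wa sa]]|].
    have [val [h1 h2]] := csp_of_assignment circ weft1 depthd xE wa sa.
    exact: torus_assignment h1 h2.
  case/torus_solution => //; first by move=> i u v /and3P[]; rewrite eqxx => /eqP.
  by move=> val [_ h]; apply: assignment_of_csp circ weft1 depthd xE _ h.
- rewrite /parameter /= (leq_trans (packing_twin_cover _ _ _ _ _ _)) //.
  by rewrite /B /G /K /csp_rows (_ : ones x = k) // xE ones_weight.
Qed.
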